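(* Let $(t^j,x^j,v^j)_{j\ge0}$ be the bounce-back cycles starting from $(t,x,v)$, let $\partial_{\mathbf e}$ denote differentiation with respect to $x$ or $v$ ($\mathbf e\in\{x,v\}$), and let $f=f(t,x,v)$. Then, in the sense of distributions, $$\partial_{\mathbf e}\Big[\int_{t^{j+1}}^{t^j}f(\tau,x^j-(t^j-\tau)v^j,v^j)\,d\tau\Big]$$ $$=\int_{t^{j+1}}^{t^j}\big[\partial_{\mathbf e}t^j,\ \partial_{\mathbf e}x^j+\tau\,\partial_{\mathbf e}v^j,\ \partial_{\mathbf e}v^j\big]\cdot\nabla_{t,x,v}f(\tau,x^j-(t^j-\tau)v^j,v^j)\,d\tau$$ $$\qquad+\lim_{\tau\downarrow t^{j+1}}\big[\partial_{\mathbf e}t^j-\partial_{\mathbf e}t^{j+1}\big]f(\tau,x^j-(t^j-\tau)v^j,v^j).$$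
   Context: Domain: $\Omega\subset\mathbb R^3$ is a bounded open set for which there is a smooth $\xi:\mathbb R^3\to\mathbb R$ with $\Omega=\{\xi<0\}$, $\partial\Omega=\{\xi=0\}$, $\nabla\xi(x)\ne0$ when $|\xi(x)|\ll1$, and $\sum_{i,j}\partial_{ij}\xi(x)\zeta_i\zeta_j\ge C_\xi|\zeta|^2$ for all $x\in\bar\Omega$, $\zeta\in\mathbb R^3$ ($C_\xi>0$). $n(x)=\nabla\xi(x)/|\nabla\xi(x)|$. $t_{\mathbf b}(x,v)=\inf\{\tau>0:x-\tau v\notin\Omega\}$ and $x_{\mathbf b}(x,v)=x-t_{\mathbf b}(x,v)v$. Bounce-back cycles: for $(x,v)\in\bar\Omega\times\mathbb R^3$ not in the grazing set $\{(x,v)\in\partial\Omega\times\mathbb R^3:n(x)\cdot v=0\}$, $(t^0,x^0,v^0)=(t,x,v)$ and $(t^{\ell+1},x^{\ell+1},v^{\ell+1})=(t^\ell-t_{\mathbf b}(x^\ell,v^\ell),\,x_{\mathbf b}(x^\ell,v^\ell),\,-v^\ell)$ for $\ell\ge0$; these are regarded as functions of $(t,x,v)$.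
   Formalization: In the bracket the factor τ multiplying ∂_e v^j is replaced by τ − t^j; as printed the formula fails for e = v (j = 0, f = x_1, e = v_1: the two sides differ by t·t_b). For e = x nothing changes. *)

(* Defs.v *)
From HB Require Import structures.
From mathcomp Require Import all_boot all_order all_algebra.
From mathcomp Require Import all_classical all_reals all_analysis.

Set Implicit Arguments.
Unset Strict Implicit.
Unset Printing Implicit Defensive.

Import Order.TTheory GRing.Theory Num.Theory.
Import numFieldNormedType.Exports.

Local Open Scope classical_set_scope.
Local Open Scope ring_scope.

(* Iterated products of R carry both the product topology and the product
   sigma-algebra.  The norm of the library on R3 is the sup norm, so Euclidean
   quantities are written with dot3. *)
Notation R3 R := (prod (prod R R) R).
(* Points (t, x, v), with t = z.1.1, x = z.1.2 and v = z.2. *)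
Notation txv R := (prod (prod R (R3 R)) (R3 R)).

Definition e3 (R : realType) (i : 'I_3) : R3 R :=
  ((i == 0%N :> nat)%:R, (i == 1%N :> nat)%:R, (i == 2%N :> nat)%:R).

Definition coord3 (R : realType) (x : R3 R) (i : 'I_3) : R :=
  [:: x.1.1; x.1.2; x.2]`_i.

Definition dot3 (R : realType) (x y : R3 R) : R :=
  \sum_(i < 3) coord3 x i * coord3 y i.

Definition dot7 (R : realType) (z w : txv R) : R :=
  z.1.1 * w.1.1 + dot3 z.1.2 w.1.2 + dot3 z.2 w.2.

Definition et (R : realType) : txv R := (1, 0, 0).
Definition ex (R : realType) (i : 'I_3) : txv R := (0, e3 R i, 0).
Definition ev (R : realType) (i : 'I_3) : txv R := (0, 0, e3 R i).

Definition xv_dir (R : realType) : set (txv R) :=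
  [set e | exists i, e = ex R i \/ e = ev R i].

(* C^infinity: all iterated directional derivatives exist and are continuous. *)
Definition smooth (R : realType) (V : normedModType R) (h : V -> R) : Prop :=
  forall s : seq V, let hs := foldr (fun d g => 'D_d g) h s in
    continuous hs /\ forall x d, derivable hs x d.

Definition grad3 (R : realType) (xi : R3 R -> R) (x : R3 R) : R3 R :=
  ('D_(e3 R 0) xi x, 'D_(e3 R 1) xi x, 'D_(e3 R 2%:R) xi x).

Definition boundary (T : topologicalType) (A : set T) : set T :=
  closure A `\` interior A.

Definition convex_domain (R : realType) (xi : R3 R -> R) (Omega : set (R3 R))
    : Prop :=
  [/\ open Omega /\ bounded_set Omega,
      smooth xi,
      Omega = [set x | xi x < 0] /\ boundary Omega = [set x | xi x = 0],
      exists2 delta : R, 0 < delta &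
        forall x, `|xi x| < delta -> grad3 xi x != 0 &
      exists2 C : R, 0 < C &
        forall x zeta, closure Omega x ->
          C * dot3 zeta zeta <=
          \sum_(i < 3) \sum_(j < 3)
            'D_(e3 R i) ('D_(e3 R j) xi) x * coord3 zeta i * coord3 zeta j].

Definition normal (R : realType) (xi : R3 R -> R) (x : R3 R) : R3 R :=
  (Num.sqrt (dot3 (grad3 xi x) (grad3 xi x)))^-1 *: grad3 xi x.

Definition grazing (R : realType) (xi : R3 R -> R) (Omega : set (R3 R))
    : set (R3 R * R3 R) :=
  [set y | boundary Omega y.1 /\ dot3 (normal xi y.1) y.2 = 0].

(* For Omega bounded and v != 0 the set below is nonempty; when it is empty
   (x in Omega, v = 0) the exit time is +oo and the real inf is a junk value. *)
Definition t_b (R : realType) (Omega : set (R3 R)) (x v : R3 R) : R :=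
  inf [set tau : R | 0 < tau /\ ~ Omega (x - tau *: v)].

Definition x_b (R : realType) (Omega : set (R3 R)) (x v : R3 R) : R3 R :=
  x - t_b Omega x v *: v.

Definition bounce (R : realType) (Omega : set (R3 R)) (z : txv R) : txv R :=
  (z.1.1 - t_b Omega z.1.2 z.2, x_b Omega z.1.2 z.2, - z.2).

Definition cycle (R : realType) (Omega : set (R3 R)) (j : nat) (z : txv R)
    : txv R :=
  iter j (bounce Omega) z.

Definition tc (R : realType) (Omega : set (R3 R)) j (z : txv R) : R :=
  (cycle Omega j z).1.1.
Definition xc (R : realType) (Omega : set (R3 R)) j (z : txv R) : R3 R :=
  (cycle Omega j z).1.2.
Definition vc (R : realType) (Omega : set (R3 R)) j (z : txv R) : R3 R :=
  (cycle Omega j z).2.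

Definition traj (R : realType) (Omega : set (R3 R)) (j : nat) (z : txv R)
    (tau : R) : txv R :=
  (tau, xc Omega j z - (tc Omega j z - tau) *: vc Omega j z, vc Omega j z).

(* The e-derivative of traj at fixed elapsed time s = tc j z - tau, that is, of
   (tc j - s, xc j - s *: vc j, vc j); the factor of the derivative of vc j is
   the signed elapsed time tau - tc j z, not the absolute time tau. *)
Definition dtraj (R : realType) (Omega : set (R3 R)) (j : nat) (e z : txv R)
    (tau : R) : txv R :=
  ('D_e (tc Omega j) z,
   'D_e (xc Omega j) z + (tau - tc Omega j z) *: 'D_e (vc Omega j) z,
   'D_e (vc Omega j) z).

(* The open set on which all the cycles are defined: for x in Omega and v = 0
   the exit time is infinite. *)
Definition phase (R : realType) (Omega : set (R3 R)) : set (txv R) :=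
  [set z | Omega z.1.2 /\ z.2 != 0].

Definition closed_phase (R : realType) (xi : R3 R -> R) (Omega : set (R3 R))
    : set (txv R) :=
  [set z | [/\ closure Omega z.1.2, z.2 != 0 &
               ~ grazing xi Omega (z.1.2, z.2)]].

(* The product m1 \x m2 under a name: the sigma-finite structure of \x itself is
   not found by inference, its subprobability instance taking precedence. *)
Definition sfprod d1 d2 (T1 : measurableType d1) (T2 : measurableType d2)
    (R : realType) (m1 : {sigma_finite_measure set T1 -> \bar R})
    (m2 : {sigma_finite_measure set T2 -> \bar R})
    : set (T1 * T2)%type -> \bar R :=
  (m1 \x m2)%E.

Lemma sigma_finite_sfprod d1 d2 (T1 : measurableType d1)
    (T2 : measurableType d2) (R : realType)
    (m1 : {sigma_finite_measure set T1 -> \bar R})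
    (m2 : {sigma_finite_measure set T2 -> \bar R}) :
  sigma_finite setT (sfprod m1 m2).
Proof.
have /sigma_finiteP[F [TF ndF Foo]] := sigma_finiteT m1.
have /sigma_finiteP[G [TG ndG Goo]] := sigma_finiteT m2.
exists (fun n => F n `*` G n).
  rewrite -setXTT TF TG predeqE => -[x y]; split.
    move=> [/= [n _ Fnx] [k _ Gky]]; exists (maxn n k) => //; split.
    - by move: x Fnx; exact/subsetPset/ndF/leq_maxl.
    - by move: y Gky; exact/subsetPset/ndG/leq_maxr.
  by move=> [n _ []/= ? ?]; split; exists n.
move=> k; have [? ?] := Foo k; have [? ?] := Goo k.
split; first exact: measurableX.
by rewrite /sfprod product_measure1E// lte_mul_pinfty// ge0_fin_numE.
Qed.

HB.instance Definition _ d1 d2 T1 T2 R m1 m2 :=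
  Measure.on (@sfprod d1 d2 T1 T2 R m1 m2).
HB.instance Definition _ d1 d2 T1 T2 R m1 m2 :=
  Measure_isSigmaFinite.Build _ _ _ (@sfprod d1 d2 T1 T2 R m1 m2)
    (sigma_finite_sfprod m1 m2).

Definition leb3 (R : realType) :=
  sfprod (sfprod (@lebesgue_measure R) (@lebesgue_measure R))
    (@lebesgue_measure R).
HB.instance Definition _ R := SigmaFiniteMeasure.on (@leb3 R).

Definition leb7 (R : realType) :=
  sfprod (sfprod (@lebesgue_measure R) (@leb3 R)) (@leb3 R).
HB.instance Definition _ R := SigmaFiniteMeasure.on (@leb7 R).

(* Integrability on the trace on U of every compact subset of V; V = U gives
   L^1_loc(U), a larger V gives integrability up to a part of the boundary. *)
Definition integrable_on_compacts (R : realType) (V U : set (txv R))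
    (h : txv R -> R) : Prop :=
  forall K : set (txv R), compact K -> K `<=` V ->
    (@leb7 R).-integrable (K `&` U) (EFin \o h).

Definition test_function (R : realType) (U : set (txv R)) (phi : txv R -> R)
    : Prop :=
  smooth phi /\ exists K : set (txv R),
    [/\ compact K, K `<=` U & forall z, ~ K z -> phi z = 0].

Definition distr_deriv (R : realType) (U : set (txv R)) (e : txv R)
    (F G : txv R -> R) : Prop :=
  [/\ integrable_on_compacts U U F,
      integrable_on_compacts U U G &
      forall phi, test_function U phi ->
        \int[@leb7 R]_(z in U) (F z * 'D_e phi z) =
        - \int[@leb7 R]_(z in U) (G z * phi z)].

Definition distr_grad (R : realType) (U : set (txv R)) (f : txv R -> R)
    (Df : txv R -> txv R) : Prop :=
  forall e, ([set et R] `|` @xv_dir R) e ->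
    distr_deriv U e f (fun z => dot7 (Df z) e).

(* Main.v *)
(** With eps = (-1)^j, the j-th segment is s |-> (t - delay + s, x + s eps v, eps v)
    for -p < s < q, where p = t_b(x, eps v) and q = t_b(x, -eps v) (q = 0 if
    j = 0); convexity makes the exits transversal, so that p, q and the delay
    are C^1 in (x, v).  For fixed s this map of (t, x, v) preserves Lebesgue
    measure and conjugates the derivation along e to a constant vector field,
    up to a multiple of the time derivative.  The weak derivatives of f may
    therefore be tested against phi chi_n, where phi is a test function and
    chi_n is a cutoff in theta = (s + p) / (p + q) vanishing near both ends.
    Since d_e chi_n = - gamma d_s chi_n with
    gamma = theta d_e(p + q) - d_e p, the derivative of chi_n is removed by
    integrating by parts along almost every segment, on which f is absolutely
    continuous with derivative u_s.  Letting n -> oo, the derivative of the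
    integral of u = f along the segment is the integral of
    u_e + gamma u_s + (d_e(p + q) / (p + q)) u, and the identity
    int (u / (p + q) - (1 - theta) u_s) ds = lim_(s -> -p) u gives the
    boundary term. *)
Require Import Defs.
From HB Require Import structures.
From mathcomp Require Import all_boot all_order all_algebra.
From mathcomp Require Import all_classical all_reals all_analysis.
From mathcomp Require Import measurable_realfun ring lra.

Set Implicit Arguments.
Unset Strict Implicit.
Unset Printing Implicit Defensive.

Import Order.TTheory GRing.Theory Num.Theory.
Import numFieldNormedType.Exports.

Local Open Scope classical_set_scope.
Local Open Scope ring_scope.

(** * Smooth functions *)

Section lines.
Context {R : realType} {V : normedModType R}.
Implicit Types (f : V -> R) (x v : V).

(** The weak derivatives of f are given against smooth tests only, while phi chi_n, carried to the
    point of the segment, is known only to be C^1. No mollification bridges the gap: the weak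
    derivative along an affine flow is first turned into an identity between values, f(A_r w) - f(w)
    = int_0^r g(A_s w) ds for almost every w, which can be tested against bounded measurable
    functions of compact support; dividing by r and letting r -> 0 recovers integration by parts for
    tests differentiable in one direction. The same identity, for free flight, gives absolute
    continuity along almost every segment. Since theta is affine in s, gamma interpolates linearly
    between - d_e p and d_e q, the e-derivatives of the two ends; it is bounded and independent of
    n. A limit of f is assumed at the end -p only, whence the weight 1 - theta, zero at q, in the
    last identity. Integrability up to the boundary is available only away from grazing;
    transversality makes the closed segments over a compact set sweep a compact set free of grazing
    points. *)

Lemma is_derive_cvgP f x v (df : R) :
  is_derive x v f df <->
  (h^-1 * (f (x + h *: v) - f x)) @[h --> (0 : R)^'] --> df.
Proof.
split=> [[dfx <-]|cdf].
  rewrite (_ : (fun h => _) = (fun h => h^-1 *: ((f \o shift x) (h *: v) - f x))).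
    exact: dfx.
  by apply/funext => h /=; rewrite [x + _]addrC.
have E : (fun h => h^-1 * (f (x + h *: v) - f x)) =
    (fun h => h^-1 *: ((f \o shift x) (h *: v) - f x)).
  by apply/funext => h /=; rewrite [x + _]addrC.
rewrite E in cdf; split; first by apply/cvg_ex; exists df.
by apply: cvg_lim.
Qed.

Lemma is_derive_line f x v (h df : R) :
  is_derive (x + h *: v) v f df -> is_derive h 1 (fun k => f (x + k *: v)) df.
Proof.
move=> /is_derive_cvgP H; split.
  apply/cvg_ex; exists df.
  apply: cvg_trans H; apply: near_eq_cvg; near=> k => /=.
  by rewrite [k *: 1]mulr1 [k + h]addrC scalerDl addrA.
apply: cvg_lim => //; apply: cvg_trans H; apply: near_eq_cvg; near=> k => /=.
by rewrite [k *: 1]mulr1 [k + h]addrC scalerDl addrA.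
Unshelve. all: by end_near. Qed.

Lemma derivable_is_derive f x v : derivable f x v -> is_derive x v f ('D_v f x).
Proof. by move=> H; split. Qed.

End lines.

Lemma is_derive1_cvgP {R : realType} (f : R -> R) (x df : R) :
  is_derive x 1 f df <-> (h^-1 * (f (x + h) - f x)) @[h --> (0 : R)^'] --> df.
Proof.
rewrite is_derive_cvgP.
have -> : (fun h : R => h^-1 * (f (x + h *: (1 : R)) - f x)) =
          (fun h => h^-1 * (f (x + h) - f x)).
  by apply/funext => h; rewrite [h *: _]mulr1.
by [].
Qed.

Section smooth_closure.
Context {R : realType} {V : normedModType R}.
Implicit Types (h g : V -> R).

(** Smoothness quantifies over all finite sequences of directions; it is proved by coinduction, by
    exhibiting a class of functions stable under every directional derivative. *)
Lemma smooth_coind (P : (V -> R) -> Prop) :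
  (forall h, P h ->
    [/\ continuous h, forall x d, derivable h x d & forall d, P ('D_d h)]) ->
  forall h, P h -> smooth h.
Proof.
move=> HP h Ph s hs; have : P hs.
  by rewrite /hs; elim: s {hs} => //= d s IH; have [] := HP _ IH.
by move=> /HP[].
Qed.

Lemma smooth_derive h d : smooth h -> smooth ('D_d h).
Proof.
move=> sh s; have := sh (rcons s d); by rewrite foldr_rcons.
Qed.

Lemma smooth_continuous h : smooth h -> continuous h.
Proof. by move=> /(_ [::])[]. Qed.

Lemma smooth_derivable h x d : smooth h -> derivable h x d.
Proof. by move=> /(_ [::])[_]. Qed.

(** The Leibniz rule leaves the class of products of smooth functions, but not that of their finite
    sums: this is the stable class behind [smoothM] and [smoothD]. *)
Inductive sum_of_products : (V -> R) -> Prop :=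
| SumOfProductsM h g : smooth h -> smooth g ->
    sum_of_products (fun x => h x * g x)
| SumOfProductsD h g : sum_of_products h -> sum_of_products g ->
    sum_of_products (fun x => h x + g x).

Lemma smooth_sum_of_products h : sum_of_products h -> smooth h.
Proof.
apply: smooth_coind => {}h; elim=> {h}.
  move=> h g sh sg; split.
  - by move=> x; apply: cvgM; apply: smooth_continuous.
  - by move=> x d; apply: derivableM; apply: smooth_derivable.
  - move=> d; rewrite (_ : 'D_d _ = fun x => h x * 'D_d g x + g x * 'D_d h x).
      apply: SumOfProductsD; apply: SumOfProductsM.
      + exact: sh.
      + exact: smooth_derive.
      + exact: sg.
      + exact: smooth_derive.
    by apply/funext => x; rewrite deriveM//; exact: smooth_derivable.
move=> h g _ [ch dh Ph] _ [cg dg Pg]; split.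
- by move=> x; exact: (continuousD (ch x) (cg x)).
- by move=> x d; apply: derivableD.
- move=> d; rewrite (_ : 'D_d _ = fun x => 'D_d h x + 'D_d g x).
    exact: SumOfProductsD.
  by apply/funext => x; rewrite deriveD.
Qed.

Lemma smoothM h g : smooth h -> smooth g -> smooth (fun x => h x * g x).
Proof. by move=> sh sg; apply/smooth_sum_of_products/SumOfProductsM. Qed.

Lemma smooth_cst (c : R) : smooth (fun _ : V => c).
Proof.
apply: (@smooth_coind (fun h => exists c, h = cst c)); last by exists c.
move=> _ [b ->]; split; first by move=> x; exact: cvg_cst.
  by move=> x d; exact: derivable_cst.
by move=> d; exists 0; apply/funext => x; rewrite derive_cst.
Qed.

Lemma smoothZ (c : R) h : smooth h -> smooth (fun x => c * h x).
Proof. by apply: smoothM; exact: smooth_cst. Qed.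

Lemma smoothD h g : smooth h -> smooth g -> smooth (fun x => h x + g x).
Proof.
move=> sh sg; have one : smooth (fun _ : V => 1 : R) by exact: smooth_cst.
have := smooth_sum_of_products (SumOfProductsD (SumOfProductsM sh one)
  (SumOfProductsM sg one)).
by congr smooth; apply/funext => x; rewrite !mulr1.
Qed.

Lemma smooth_sum n (F : 'I_n -> V -> R) : (forall i, smooth (F i)) ->
  smooth (fun x => \sum_(i < n) F i x).
Proof.
elim: n F => [|n IH] F sF.
  rewrite (_ : (fun x => _) = (fun _ => 0)); first exact: smooth_cst.
  by apply/funext => x; rewrite big_ord0.
rewrite (_ : (fun x => _) = (fun x => \sum_(i < n) F (widen_ord (leqnSn n) i) x +
   F ord_max x)).
  by apply: smoothD => //; exact: IH.
by apply/funext => x; rewrite big_ord_recr.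
Qed.

End smooth_closure.

Lemma is_derive_affine {R : realType} {V V' : normedModType R} (h : V' -> R)
    (T : V -> V') (L : V) (L' : V') x :
  (forall k : R, T (x + k *: L) = T x + k *: L') -> derivable h (T x) L' ->
  is_derive x L (fun x => h (T x)) ('D_L' h (T x)).
Proof.
move=> TL /derivable_is_derive/is_derive_cvgP H; apply/is_derive_cvgP.
by under eq_fun do rewrite TL.
Qed.

(** The composites with the fixed map [T] form the stable class: the derivative along d is the
    derivative along [L d], composed with [T]. *)
Lemma smooth_affine {R : realType} {V V' : normedModType R} (h : V' -> R)
    (T L : V -> V') :
  continuous T -> (forall x d (k : R), T (x + k *: d) = T x + k *: L d) ->
  smooth h -> smooth (fun x => h (T x)).
Proof.
move=> cT TL sh.
apply: (@smooth_coind _ _ (fun k => exists2 g : V' -> R, smooth g & k = g \o T)).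
  move=> _ [g sg ->]; split.
  - move=> x; apply: continuous_comp; first exact: cT.
    exact: smooth_continuous.
  - move=> x d; have [] := @is_derive_affine _ _ _ g T d (L d) x (TL x d) _.
      by exact: smooth_derivable.
    by [].
  - move=> d; exists ('D_(L d) g); first exact: smooth_derive.
    apply/funext => x; have [] := @is_derive_affine _ _ _ g T d (L d) x (TL x d) _.
      by exact: smooth_derivable.
    by [].
by exists h.
Qed.

(** * The smooth function exp(-1/x), extended by zero *)

Section flat_bump.
Context {R : realType}.
Implicit Types (p : {poly R}) (x y : R).

(** The class containing exp(-1/x) that is stable under derivation: [p] is replaced by X^2 (p -
    p'). *)
Definition flat_poly p x := if 0 < x then p.[x^-1] * expR (- x^-1) else 0.

Definition flat x := flat_poly 1 x.

(** With m = n + 1, y / m <= exp(y / m); raise this to the power n and use n / m <= 1. Taking n + 1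
    instead of n avoids a separate case n = 0. *)
Lemma exp_dominates_monomial n y : 0 < y ->
  y ^+ n * expR (- y) <= n.+1%:R ^+ n.
Proof.
move=> y0; rewrite expRN ler_pdivrMr ?expR_gt0//.
have yn : y <= n.+1%:R * expR (y / n.+1%:R).
  rewrite mulrC -ler_pdivrMr//; apply: le_trans (expR_ge1Dx _).
  by rewrite lerDr.
apply: le_trans (_ : (n.+1%:R * expR (y / n.+1%:R)) ^+ n <= _).
  by apply: lerXn2r => //; rewrite nnegrE ?(ltW y0)// mulr_ge0// expR_ge0.
rewrite exprMn ler_pM2l ?exprn_gt0// -expRM_natl ler_expR mulr_natl.
rewrite -mulrnAl ler_pdivrMr// -mulr_natr ler_pM2l// ler_nat //.
Qed.

Lemma exp_dominates_poly p :
  exists C : R, forall y, 0 < y -> `|p.[y]| * expR (- y) <= C.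
Proof.
exists (\sum_(i < size p) `|p`_i| * i.+1%:R ^+ i) => y y0.
rewrite horner_coef; apply: (@le_trans _ _ ((\sum_(i < size p) `|p`_i * y ^+ i|) * expR (- y))).
  by rewrite ler_wpM2r ?expR_ge0 ?ler_norm_sum.
rewrite mulr_suml ler_sum// => i _.
rewrite normrM -mulrA ler_wpM2l// ger0_norm ?exprn_ge0 ?(ltW y0)//.
exact: exp_dominates_monomial.
Qed.

Lemma is_derive_flat_poly p x :
  is_derive x 1 (flat_poly p) (flat_poly ('X^2 * (p - p^`())) x).
Proof.
have [x0|x0|<-] := ltgtP 0 x.
- have D : is_derive x 1 (fun z => p.[z^-1] * expR (- z^-1))
     (flat_poly ('X^2 * (p - p^`())) x).
    have x0' : x != 0 by rewrite gt_eqF.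
    have dV : is_derive x 1 (fun z : R => z^-1) (- x ^- 2).
      apply: is_derive_eq; first by apply: is_deriveV.
      by rewrite /GRing.scale/= mulr1.
    have dp : is_derive x 1 (fun z => p.[z^-1]) (p^`().[x^-1] * - x ^- 2).
      by apply: (@is_derive1_comp _ (horner p)).
    have dN : is_derive x 1 (fun z : R => - z^-1) (x ^- 2).
      by rewrite -[X in is_derive _ _ _ X]opprK; apply: is_deriveN.
    have de : is_derive x 1 (fun z => expR (- z^-1)) (expR (- x^-1) * x ^- 2).
      by apply: (@is_derive1_comp _ expR).
    apply: is_derive_eq (is_deriveM dp de) _.
    rewrite /flat_poly x0 hornerM hornerXn hornerD hornerN /GRing.scale/=.
    by rewrite exprVn; ring.
  apply: near_eq_is_derive D; near=> z.
  by rewrite /flat_poly ifT//; near: z; exact: lt_nbhsr.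
- rewrite /flat_poly ltNge (ltW x0)/=.
  apply: near_eq_is_derive (is_derive_cst (0:R) _ _); near=> z.
  have z0 : z <= 0 by near: z; exact: (cvgr_le _ cvg_id).
  by rewrite ltNge z0.
- rewrite [X in is_derive _ _ _ X]/flat_poly ltxx; apply/is_derive_cvgP.
  (* The bound is taken for X^2 p: the difference quotient at h is h times h^-2 p(1/h) exp(-1/h),
     hence at most C h. *)
  have [C HC] := exp_dominates_poly ('X^2 * p).
  have C0 : 0 <= C.
    by apply: le_trans (HC 1 ltr01); rewrite mulr_ge0 ?expR_ge0.
  apply/cvgr0Pnorm_le => _/posnumP[e].
  have eC : 0 < e%:num / (C + 1) by rewrite divr_gt0// ltr_wpDl.
  near=> h; rewrite add0r [h *: 1]mulr1 [flat_poly p 0]/flat_poly ltxx subr0.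
  rewrite /flat_poly; case: ifPn => [h0|_]; last by rewrite mulr0 normr0.
  rewrite normrM [X in _ * X]normrM (ger0_norm (expR_ge0 _)).
  have := HC _ (etrans (invr_gt0 h) h0); rewrite hornerM hornerXn normrM.
  rewrite normrX (gtr0_norm (etrans (invr_gt0 h) h0)) => Hh.
  have -> : h^-1 * (`|p.[h^-1]| * expR (- h^-1)) =
     h * (h^-1 ^+ 2 * `|p.[h^-1]| * expR (- h^-1)).
    by field; rewrite gt_eqF.
  apply: le_trans (_ : h * C <= _); first by rewrite ler_pM2l.
  apply: le_trans (_ : h * (C + 1) <= _); first by rewrite ler_pM2l// lerDl.
  rewrite -ler_pdivlMr ?ltr_wpDl//; apply: ltW; apply: le_lt_trans (ler_norm _) _.
  by near: h; apply: dnbhs0_lt.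
Unshelve. all: by end_near. Qed.

Lemma is_derive_dir (f : R -> R) x (d df : R) :
  is_derive x 1 f df -> is_derive x d f (d * df).
Proof.
move=> [/derivable1_diffP df1 <-]; split; first exact: diff_derivable.
rewrite !deriveE// -[in LHS](mulr1 d) -[d * 1]/(d *: (1 : R)).
by rewrite linearZ.
Qed.

Lemma smooth_flat : smooth flat.
Proof.
apply: (@smooth_coind _ _ (fun k => exists p, k = flat_poly p)); last by exists 1.
have D p (x d : R) : is_derive x d (flat_poly p)
    (flat_poly (d *: ('X^2 * (p - p^`()))) x).
  have := is_derive_dir d (is_derive_flat_poly p x); rewrite /flat_poly.
  by case: ifP => // _; rewrite ?mulr0// hornerZ mulrA.
move=> _ [p ->]; split.
- move=> x; have [dF _] := is_derive_flat_poly p x.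
  by apply: differentiable_continuous; apply/derivable1_diffP.
- by move=> x d; have [] := D p x d.
- move=> d; exists (d *: ('X^2 * (p - p^`()))).
  by apply/funext => x; have [] := D p x d.
Qed.

Lemma flat_ge0 x : 0 <= flat x.
Proof.
rewrite /flat /flat_poly; case: ifP => // _.
by rewrite hornerC mul1r expR_ge0.
Qed.

Lemma flat_le1 x : flat x <= 1.
Proof.
rewrite /flat /flat_poly; case: ifPn => // x0.
by rewrite hornerC mul1r -expR0 ler_expR oppr_le0 invr_ge0 ltW.
Qed.

Lemma flat_gt0 x : (0 < flat x) = (0 < x).
Proof.
rewrite /flat /flat_poly; case: (ltP 0 x) => x0.
  by rewrite hornerC mul1r expR_gt0.
by rewrite ltxx.
Qed.

Lemma flat_eq0 x : x <= 0 -> flat x = 0.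
Proof. by move=> x0; rewrite /flat /flat_poly ltNge x0. Qed.

Lemma continuous_flat : continuous flat.
Proof. exact: smooth_continuous smooth_flat. Qed.

Lemma cvg_flat_pinfty : flat x @[x --> +oo] --> (1 : R).
Proof.
have : expR (- x^-1) @[x --> +oo] --> expR (- (0 : R)).
  apply: (@continuous_cvg _ _ _ _ _ _ expR); first exact: continuous_expR.
  apply: cvgN; have [_] := @gtr0_cvgV0 R R +oo _ id (nbhs_pinfty_gt (num_real 0)).
  by apply; exact: cvg_id.
rewrite oppr0 expR0; apply: cvg_trans; apply: near_eq_cvg; near=> x.
have x0 : 0 < x by [].
by rewrite /flat /flat_poly x0 hornerC mul1r.
Unshelve. all: by end_near. Qed.

End flat_bump.

(** * Real-valued integrable functions *)

Section real_integral.
Context d (T : measurableType d) (R : realType).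
Variable mu : {measure set T -> \bar R}.
Implicit Types (f g h : T -> R).

Lemma ae_imp (P Q : T -> Prop) : (forall x, P x -> Q x) ->
  {ae mu, forall x, P x} -> {ae mu, forall x, Q x}.
Proof. by move=> PQ; apply: filterS. Qed.

Lemma ae_imp2 (P Q S : T -> Prop) : (forall x, P x -> Q x -> S x) ->
  {ae mu, forall x, P x} -> {ae mu, forall x, Q x} -> {ae mu, forall x, S x}.
Proof. by move=> PQ; apply: filterS2. Qed.

(** Integrals are taken over the whole space; restriction to a subset is extension by zero
    ([Lone_on]). *)
Definition Lone f := mu.-integrable setT (EFin \o f).

Lemma Lone_meas f : Lone f -> measurable_fun setT f.
Proof. by move=> /measurable_int/measurable_EFinP. Qed.

Lemma Lone_le f g : measurable_fun setT f -> (forall x, `|f x| <= `|g x|) ->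
  Lone g -> Lone f.
Proof.
move=> mf fg; apply: le_integrable => //; first exact/measurable_EFinP.
by move=> x _; rewrite /= lee_fin.
Qed.

Lemma LoneD f g : Lone f -> Lone g -> Lone (fun x => f x + g x).
Proof.
move=> lf lg; have := integrableD measurableT lf lg.
by apply: eq_integrable => // x _.
Qed.

Lemma LoneZ k f : Lone f -> Lone (fun x => k * f x).
Proof.
move=> lf; have := integrableZl measurableT k lf.
by apply: eq_integrable => // x _.
Qed.

Lemma LoneN f : Lone f -> Lone (fun x => - f x).
Proof.
move=> lf; have := LoneZ (-1) lf.
by apply: eq_integrable => // x _ /=; rewrite mulN1r.
Qed.

Lemma LoneB f g : Lone f -> Lone g -> Lone (fun x => f x - g x).
Proof. by move=> lf lg; apply: LoneD => //; exact: LoneN. Qed.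

Lemma Lone0 : Lone (fun _ => 0).
Proof.
have := integrable0 mu setT; by apply: eq_integrable.
Qed.

Lemma Lone_norm f : Lone f -> Lone (fun x => `|f x|).
Proof. exact: integrable_norm. Qed.

Lemma LoneM f h M : measurable_fun setT h -> (forall x, `|h x| <= M) ->
  Lone f -> Lone (fun x => f x * h x).
Proof.
move=> mh hM lf; apply: (@Lone_le _ (fun x => M * f x)).
- by apply: measurable_funM => //; exact: Lone_meas.
- move=> x; rewrite !normrM mulrC ler_wpM2r//.
  by apply: le_trans (hM x) _; rewrite ler_norm.
- exact: LoneZ.
Qed.

Lemma Lone_on D f : measurable D ->
  mu.-integrable D (EFin \o f) <-> Lone (f \_ D).
Proof.
move=> mD; rewrite /Lone -restrict_EFin; exact: integrable_mkcond.
Qed.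

Lemma Lone_patch D f : measurable D -> Lone f -> Lone (f \_ D).
Proof.
move=> mD lf; apply: (iffLR (Lone_on f mD)).
exact: (integrableS measurableT mD (@subsetT _ _) lf).
Qed.

Lemma intD f g : Lone f -> Lone g ->
  \int[mu]_x (f x + g x) = \int[mu]_x f x + \int[mu]_x g x.
Proof. exact: RintegralD. Qed.

Lemma intB f g : Lone f -> Lone g ->
  \int[mu]_x (f x - g x) = \int[mu]_x f x - \int[mu]_x g x.
Proof. exact: RintegralB. Qed.

Lemma intZ k f : Lone f -> \int[mu]_x (k * f x) = k * \int[mu]_x f x.
Proof. exact: RintegralZl. Qed.

Lemma intN f : Lone f -> \int[mu]_x (- f x) = - \int[mu]_x f x.
Proof.
move=> lf; rewrite -[RHS]mulN1r -intZ//.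
by apply: eq_Rintegral => x _; rewrite mulN1r.
Qed.

Lemma int0 : \int[mu]_x (0 : R) = 0.
Proof. by rewrite /Rintegral integral0. Qed.

Lemma EFin_int f : Lone f -> (\int[mu]_x f x)%:E = (\int[mu]_x (f x)%:E)%E.
Proof. by move=> lf; rewrite fineK//; exact: integrable_fin_num. Qed.

Lemma int_le f g : Lone f -> Lone g -> (forall x, f x <= g x) ->
  \int[mu]_x f x <= \int[mu]_x g x.
Proof. by move=> lf lg fg; apply: le_Rintegral. Qed.

Lemma le_norm_int f : Lone f -> `|\int[mu]_x f x| <= \int[mu]_x `|f x|.
Proof. exact: le_normr_Rintegral. Qed.

Lemma ae_eq_int f g : measurable_fun setT f -> measurable_fun setT g ->
  {ae mu, forall x, f x = g x} -> \int[mu]_x f x = \int[mu]_x g x.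
Proof.
move=> mf mg fg; congr fine; apply: ae_eq_integral => //.
- exact/measurable_EFinP.
- exact/measurable_EFinP.
- by apply: filterS fg => x /= -> _.
Qed.

Lemma ae_eq_Lone f g : measurable_fun setT g ->
  {ae mu, forall x, f x = g x} -> Lone f -> Lone g.
Proof.
move=> mg fg /integrableP[mf lf]; apply/integrableP; split.
  exact/measurable_EFinP.
have mG : measurable_fun setT (EFin \o g) by exact/measurable_EFinP.
rewrite (_ : (\int[mu]_x _)%E = (\int[mu]_x `|(EFin \o f) x|)%E) //.
apply: ae_eq_integral => //; [exact: measurableT_comp|exact: measurableT_comp|].
by apply: filterS fg => x /= -> _.
Qed.

Lemma int_dct (f_ : nat -> T -> R) f g :
  (forall n, measurable_fun setT (f_ n)) -> measurable_fun setT f ->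
  {ae mu, forall x, f_ n x @[n --> \oo] --> f x} -> Lone g ->
  (forall n x, `|f_ n x| <= g x) ->
  Lone f /\ \int[mu]_x f_ n x @[n --> \oo] --> \int[mu]_x f x.
Proof.
move=> mf_ mf cf lg fg.
have [] := @dominated_convergence _ _ _ mu setT measurableT
  (fun n => EFin \o f_ n) (EFin \o f) (EFin \o g) _ _ _ lg _.
- by move=> n; exact/measurable_EFinP.
- exact/measurable_EFinP.
- apply: filterS cf => x /= cfx _.
  by apply: cvg_EFin cfx; exact: nearW.
- by apply: aeW => x n _ /=; rewrite lee_fin.
move=> lf _ cv; split => //; apply: fine_cvg.
by rewrite EFin_int.
Qed.

Lemma Lone_le_lty f : measurable_fun setT f ->
  (\int[mu]_x (`|f x|)%:E < +oo)%E -> Lone f.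
Proof. by move=> mf H; apply/integrableP; split; [exact/measurable_EFinP|]. Qed.

Lemma Lone_lty f : Lone f -> (\int[mu]_x (`|f x|)%:E < +oo)%E.
Proof. by move=> /integrableP[]. Qed.

Lemma int_sum n (F : 'I_n -> T -> R) : (forall i, Lone (F i)) ->
  Lone (fun w => \sum_(i < n) F i w) /\
  \int[mu]_w (\sum_(i < n) F i w) = \sum_(i < n) \int[mu]_w F i w.
Proof.
elim: n F => [|n IH] F lF.
  under eq_fun do rewrite big_ord0; rewrite big_ord0.
  by split; [exact: Lone0|exact: int0].
have [l1 i1] := IH (fun i => F (widen_ord (leqnSn n) i)) (fun i => lF _).
under eq_fun do rewrite big_ord_recr/=.
by split; [exact: LoneD|rewrite big_ord_recr/= intD// i1].
Qed.

Lemma int_lincomb n (k : R) (F0 : T -> R) (Fx Fv : 'I_n -> T -> R) (b : 'I_n -> R) :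
  Lone F0 -> (forall i, Lone (Fx i)) -> (forall i, Lone (Fv i)) ->
  \int[mu]_w (k * F0 w + \sum_(i < n) Fx i w + \sum_(i < n) b i * Fv i w) =
  k * \int[mu]_w F0 w + \sum_(i < n) \int[mu]_w Fx i w +
  \sum_(i < n) b i * \int[mu]_w Fv i w.
Proof.
move=> l0 lx lv; have [l1 i1] := int_sum lx.
have [l2 i2] := int_sum (fun i => LoneZ (b i) (lv i)).
have lk := LoneZ k l0.
rewrite intD//; last exact: LoneD.
rewrite intD// i1 i2 intZ//; congr (_ + _).
by apply: eq_bigr => i _; rewrite intZ.
Qed.

End real_integral.

(** * Fubini's theorem for real-valued integrals *)

Section real_fubini.
Context d1 d2 (T1 : measurableType d1) (T2 : measurableType d2) (R : realType).
Variables (m1 : {sigma_finite_measure set T1 -> \bar R})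
          (m2 : {sigma_finite_measure set T2 -> \bar R}).
Variable f : T1 * T2 -> R.
Hypothesis lf : Lone (sfprod m1 m2) f.

Let lf' : (m1 \x m2)%E.-integrable setT (EFin \o f). Proof. exact: lf. Qed.

Lemma ae_Lone1 : {ae m1, forall x, Lone m2 (fun y => f (x, y))}.
Proof. exact: (ae_integrable1 lf'). Qed.

Lemma ae_Lone2 : {ae m2, forall y, Lone m1 (fun x => f (x, y))}.
Proof. exact: (ae_integrable2 lf'). Qed.

(** The inner integral of Fubini's theorem is extended real and infinite only on a null set, so
    [fine] changes neither its integrability nor its integral. *)
Let fineL1 d (T : measurableType d) (m : {measure set T -> \bar R})
  (F : T -> \bar R) : m.-integrable setT F ->
  Lone m (fine \o F) /\ \int[m]_x fine (F x) = fine (\int[m]_x F x)%E.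
Proof.
move=> iF; have aeF : {ae m, forall x, F x = (fine (F x))%:E}.
  by apply: filterS (integrable_ae measurableT iF) => x /(_ I) /fineK ->.
have mF := measurable_int _ iF.
have mfF : measurable_fun setT (EFin \o (fine \o F)).
  by apply/measurable_EFinP; exact: measurableT_comp.
split.
  apply: le_integrable iF => //= x _.
  by case: (F x) => [r||] //=; rewrite normr0 leey.
congr fine; apply: ae_eq_integral => //.
by apply: filterS aeF => x /= <- _.
Qed.

Lemma Lone_fubini1 : Lone m1 (fun x => \int[m2]_y f (x, y)).
Proof. exact: (fineL1 (integrable_fubini_F lf')).1. Qed.

Let integrable_G : m2.-integrable setT (fubini_G m1 (EFin \o f)).
Proof.
have mf := measurable_int _ lf'.
apply/integrableP; split; first exact: measurable_fubini_G lf'.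
apply: le_lt_trans (iffLR (integrable21ltyP m1 m2 mf) lf').
apply: ge0_le_integral => //.
- by apply: measurableT_comp => //; exact: measurable_fubini_G lf'.
- apply: (measurable_fun_fubini_tonelli_G (abse \o (EFin \o f))) => //.
    exact: measurableT_comp.
  by move=> z; exact: abse_ge0.
move=> y _; apply: le_abse_integral => //.
by have := measurable_fun_pair1 y mf.
Qed.

Lemma Lone_fubini2 : Lone m2 (fun y => \int[m1]_x f (x, y)).
Proof. exact: (fineL1 (integrable_G)).1. Qed.

Lemma int_fubini1 : \int[m1]_x (\int[m2]_y f (x, y)) = \int[sfprod m1 m2]_z f z.
Proof.
rewrite [LHS](fineL1 (integrable_fubini_F lf')).2; congr fine.
exact: (integral12_prod_meas1 lf').
Qed.

Lemma int_fubini2 : \int[m2]_y (\int[m1]_x f (x, y)) = \int[sfprod m1 m2]_z f z.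
Proof.
rewrite [LHS](fineL1 (integrable_G)).2; congr fine.
exact: (integral21_prod_meas1 lf').
Qed.

End real_fubini.

(** * Separating families and test functions *)

Section separating.

(** The fundamental lemma of the calculus of variations, as a property of the family [k]. *)
Definition separating d (T : measurableType d) (R : realType)
    (mu : {measure set T -> \bar R}) (I : Type) (k : I -> T -> R) :=
  forall h, Lone mu h -> (forall i, \int[mu]_x (h x * k i x) = 0) ->
  {ae mu, forall x, h x = 0}.

Definition tens (R : realType) (T U I J : Type) (k : I -> T -> R)
    (k' : J -> U -> R) (ij : I * J) (x : T * U) : R :=
  k ij.1 x.1 * k' ij.2 x.2.

Definition unit_bounded (R : realType) (I T : Type) (k : I -> T -> R) :=
  forall i x, 0 <= k i x <= 1.

Lemma unit_bounded_tens (R : realType) (T U I J : Type) (k : I -> T -> R)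
  (k' : J -> U -> R) :
  unit_bounded k -> unit_bounded k' -> unit_bounded (tens k k').
Proof.
move=> uk uk' [i j] [x y]; rewrite /tens/=.
have /andP[a b] := uk i x; have /andP[c e] := uk' j y.
by rewrite mulr_ge0//= mulr_ile1.
Qed.

Lemma measurable_tens d1 d2 (T : measurableType d1) (U : measurableType d2)
  (R : realType) (I J : Type) (k : I -> T -> R) (k' : J -> U -> R) :
  (forall i, measurable_fun setT (k i)) ->
  (forall j, measurable_fun setT (k' j)) ->
  forall ij, measurable_fun setT (tens k k' ij).
Proof.
move=> mk mk' [i j]; apply: measurable_funM.
  exact: (measurableT_comp (mk i) measurable_fst).
exact: (measurableT_comp (mk' j) measurable_snd).
Qed.

Lemma ae_countable d (T : measurableType d) (R : realType)
    (mu : {measure set T -> \bar R}) (J : countType) (P : J -> T -> Prop) :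
  (forall j, {ae mu, forall x, P j x}) -> {ae mu, forall x, forall j, P j x}.
Proof.
move=> aeP; have : {ae mu, forall x, forall n,
    if unpickle n is Some j then P j x else True}.
  apply: (@ae_foralln _ _ _ _ (fun n x => if unpickle n is Some j then P j x else True)) => n.
  by case: unpickle => [j|]; [exact: aeP|exact: aeW].
by apply: filterS => x /= H j; have := H (pickle j); rewrite pickleK.
Qed.

Lemma int_norm_eq0 d (T : measurableType d) (R : realType)
    (mu : {measure set T -> \bar R}) (h : T -> R) :
  Lone mu h -> {ae mu, forall x, h x = 0} <-> \int[mu]_x `|h x| = 0.
Proof.
move=> lh; have mh := measurable_int _ lh.
have H := ae_eq_integral_abs mu measurableT mh.
split=> [h0|h0].
  have /H : ae_eq mu setT (EFin \o h) (cst 0%E).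
    by apply: filterS h0 => x /= -> _.
  by rewrite /Rintegral => ->.
have /H : (\int[mu]_x `|(EFin \o h) x|)%E = 0%E.
  by rewrite -(EFin_int (Lone_norm lh)) h0.
by apply: filterS => x /= /(_ I) [->].
Qed.

Section prod.
Context d1 d2 (T1 : measurableType d1) (T2 : measurableType d2) (R : realType).
Variables (m1 : {sigma_finite_measure set T1 -> \bar R})
          (m2 : {sigma_finite_measure set T2 -> \bar R}).

Lemma ae_prod0 (h : T1 * T2 -> R) : Lone (sfprod m1 m2) h ->
  {ae sfprod m1 m2, forall z, h z = 0} <->
  {ae m1, forall x, {ae m2, forall y, h (x, y) = 0}}.
Proof.
move=> lh; have lnh := Lone_norm lh.
have l1 := Lone_fubini1 lnh; have al1 := ae_Lone1 lh.
have E : {ae m1, forall x, (\int[m2]_y `|h (x, y)| = 0) <->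
    {ae m2, forall y, h (x, y) = 0}}.
  by apply: filterS al1 => x lx; rewrite -int_norm_eq0.
have nn x : `|\int[m2]_y `|h (x, y)| | = \int[m2]_y `|h (x, y)|.
  by rewrite ger0_norm// Rintegral_ge0.
rewrite int_norm_eq0// -int_fubini1//; split.
  under eq_Rintegral do rewrite -nn.
  move=> /(int_norm_eq0 l1); apply: filterS2 E => x + h0.
  by rewrite h0 => -[+ _]; exact.
move=> h0; under eq_Rintegral do rewrite -nn.
by apply/(int_norm_eq0 l1); apply: filterS2 E h0 => x [_]; exact.
Qed.

(** For fixed j the integral of h against [k' j] in the second variable is orthogonal to the first
    family, hence zero almost everywhere. J is countable, so one null set serves all j, and off it
    the second family applies to the slice of h. *)
Lemma separating_tens (I : Type) (J : countType) (k : I -> T1 -> R)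
    (k' : J -> T2 -> R) :
  unit_bounded k -> unit_bounded k' ->
  (forall i, measurable_fun setT (k i)) ->
  (forall j, measurable_fun setT (k' j)) ->
  separating m1 k -> separating m2 k' ->
  separating (sfprod m1 m2) (tens k k').
Proof.
move=> uk uk' mk mk' sk sk' h lh h0; apply/ae_prod0 => //.
have b1 i x : `|k i x| <= 1 by have /andP[a b] := uk i x; rewrite ger0_norm.
have b2 j y : `|k' j y| <= 1 by have /andP[a b] := uk' j y; rewrite ger0_norm.
have lhk j : Lone (sfprod m1 m2) (fun z => h z * k' j z.2).
  apply: (@LoneM _ _ _ _ _ _ 1) => //.
  exact: (measurableT_comp (mk' j) measurable_snd).
have H0 j : {ae m1, forall x, \int[m2]_y (h (x, y) * k' j y) = 0}.
  apply: sk => [|i]; first exact: (Lone_fubini1 (lhk j)).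
  rewrite -(h0 (i, j)).
  have lhkk : Lone (sfprod m1 m2) (fun z => h z * tens k k' (i, j) z).
    apply: (@LoneM _ _ _ _ _ _ 1) => //; first exact: measurable_tens.
    move=> x; have /andP[a b] := unit_bounded_tens uk uk' (i, j) x.
    by rewrite ger0_norm.
  rewrite -int_fubini1//; apply: ae_eq_int.
  - apply: measurable_funM => //.
    exact: (Lone_meas (Lone_fubini1 (lhk j))).
  - exact: (Lone_meas (Lone_fubini1 lhkk)).
  - apply: filterS (ae_Lone1 (lhk j)) => x lx /=.
    rewrite mulrC -intZ//; apply: eq_Rintegral => y _.
    by rewrite /tens/=; ring.
have := ae_countable H0; apply: filterS2 (ae_Lone1 lh) => x lx Hx.
exact: sk'.
Qed.

End prod.
End separating.

(** * Smooth approximations of half-lines *)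

Section rays.
Context {R : realType}.
Notation leb := (@lebesgue_measure R).

(** A smooth approximation of the indicator of a half-line, with a countable index as
    [separating_tens] requires of its second family. *)
Definition ray (nb : nat * rat) (x : R) : R :=
  flat (nb.1%:R * (ratr nb.2 - x)).

Lemma measurable_flat : measurable_fun setT (flat : R -> R).
Proof. by apply: continuous_measurable_fun; exact: continuous_flat. Qed.

Lemma measurable_ray nb : measurable_fun setT (ray nb).
Proof.
apply: (measurableT_comp measurable_flat).
by apply: measurable_funM => //; apply: measurable_funB.
Qed.

Lemma unit_bounded_ray : unit_bounded ray.
Proof. by move=> nb x; rewrite flat_ge0 flat_le1. Qed.

(** The [c n] approach b from below within 1 / (n + 1): then n (c n - x) <= 0 for x >= b, the end
    point included, while for x < b it tends to +oo because the error n / (n + 1) stays below 1. *)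
Lemma cvg_ray (b : R) : exists c : nat -> rat,
  forall x, ray (n, c n) x @[n --> \oo] --> (\1_`]-oo, b[ x : R).
Proof.
have /choice[c Hc] : forall n : nat, exists q : rat,
    b - n.+1%:R^-1 < ratr q < b.
  move=> n; have /rat_in_itvoo[q] : b - n.+1%:R^-1 < b.
    by rewrite ltrBlDr ltrDl invr_gt0.
  by rewrite in_itv/=; exists q.
exists c => x; have [xb|bx] := ltP x b; last first.
  rewrite indicE memNset/=; last by rewrite in_itv/= ltNge bx.
  apply: cvg_near_cst; near=> n; rewrite /ray /= flat_eq0//.
  by rewrite mulr_ge0_le0// subr_le0 (le_trans _ bx)// ltW//; have /andP[] := Hc n.
rewrite indicE mem_set/=; last by rewrite in_itv/=.
suff : (n%:R * (ratr (c n) - x) @[n --> \oo] --> +oo).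
  by move=> H; exact: (cvg_comp _ _ H cvg_flat_pinfty).
apply/cvgryPge => A; near=> n.
have /andP[cn _] := Hc n.
apply: (@le_trans _ _ (n%:R * (b - n.+1%:R^-1 - x))); last first.
  by rewrite ler_wpM2l// lerB// ltW.
have -> : n%:R * (b - n.+1%:R^-1 - x) = n%:R * (b - x) - n%:R / n.+1%:R by ring.
rewrite lerBrDr; apply: (@le_trans _ _ (A + 1)).
  by rewrite lerD2l ler_pdivrMr// mul1r ler_nat.
rewrite -ler_pdivrMr ?subr_gt0//; near: n; exact: nbhs_infty_ger.
Unshelve. all: by end_near. Qed.

(** Dominated convergence passes from rays to half-lines, a generating family of Borel sets stable
    under intersection. The sets on which h has integral zero form a Dynkin system, so h has
    integral zero on every Borel set. *)
Lemma separating_ray : separating leb ray.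
Proof.
move=> h lh h0; have mh := Lone_meas lh.
have lset A : measurable A -> Lone leb (fun x => h x * \1_A x).
  move=> mA; apply: (@LoneM _ _ _ _ _ _ 1) => // x.
  by rewrite indicE normr_nat; case: (_ \in _); rewrite ?lern1.
have int_set A : measurable A ->
    (\int[leb]_(x in A) (h x)%:E)%E = (\int[leb]_x (h x * \1_A x))%:E.
  move=> mA; rewrite EFin_int; last exact: lset.
  rewrite [LHS]integral_mkcond; apply: eq_integral => x _.
  by rewrite patchE indicE; case: ifPn => _; rewrite ?mulr1 ?mulr0.
have RAY b : \int[leb]_x (h x * \1_`]-oo, b[ x) = 0.
  have [c Hc] := cvg_ray b.
  have [|||||_] := @int_dct _ _ _ leb (fun n x => h x * ray (n, c n) x)
      (fun x => h x * \1_`]-oo, b[ x) (fun x => `|h x|).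
  - by move=> n; apply: measurable_funM => //; exact: measurable_ray.
  - by apply: measurable_funM => //; exact: measurable_indic.
  - by apply: aeW => x; apply: cvgM; [exact: cvg_cst|exact: Hc].
  - exact: Lone_norm.
  - move=> n x; rewrite normrM ler_piMr//.
    by have /andP[a e] := unit_bounded_ray (n, c n) x; rewrite ger0_norm.
  under eq_cvg do rewrite h0.
  by move=> /(cvg_unique _) /(_ (cvg_cst _)) ->.
have ALL A : measurable A -> \int[leb]_x (h x * \1_A x) = 0.
  have ge := RGenInftyO.measurableE R; rewrite ge.
  have int1 : \int[leb]_x (h x * \1_[set: R] x) = 0.
    have [|||||_] := @int_dct _ _ _ leb (fun n x => h x * \1_`]-oo, n%:R[ x)
      (fun x => h x * \1_[set: R] x) (fun x => `|h x|).
    - by move=> n; apply: measurable_funM => //; exact: measurable_indic.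
    - by apply: measurable_funM => //; exact: measurable_indic.
    - apply: aeW => x; apply: cvgM; first exact: cvg_cst.
      apply: cvg_near_cst; near=> n.
      rewrite !indicE in_setT mem_set//= in_itv/=; near: n; exact: nbhs_infty_gtr.
    - exact: Lone_norm.
    - move=> n x; rewrite normrM ler_piMr// indicE normr_nat.
      by case: (_ \in _); rewrite ?lern1.
    under eq_cvg do rewrite RAY.
    by move=> /(cvg_unique _) /(_ (cvg_cst _)) ->.
  apply: (@dynkin_induction _ _ _ (fun A => \int[leb]_x (h x * \1_A x) = 0) ge).
  - move=> _ _ [a ->] [b ->]; exists (Num.min a b).
    apply/seteqP; split => x /=; rewrite !in_itv/= lt_min.
      by move=> [-> ->].
    by move=> /andP[].
  - exact: int1.
  - by move=> _ [b ->]; exact: RAY.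
  - move=> S mS S0.
    have E : \int[leb]_x (h x * \1_[set: R] x) - \int[leb]_x (h x * \1_S x) =
             \int[leb]_x (h x * \1_(~` S) x).
      rewrite -intB; [|exact: lset|exact: lset].
      apply: eq_Rintegral => x _; rewrite -mulrBr !indicE in_setT in_setC.
      by case: (x \in S); rewrite /= ?subrr ?subr0.
    by rewrite -E int1 S0 subrr.
  - move=> F mF tF F0; apply: EFin_inj.
    rewrite -int_set; last exact: bigcupT_measurable.
    rewrite integral_bigcup//.
      by apply: eseries0 => i _ _; rewrite int_set// F0.
    apply: integrableS lh => //; exact: bigcupT_measurable.
have H : ae_eq leb setT (EFin \o h) (cst 0%E).
  apply: integral_ae_eq => // E _ mE.
  by rewrite integral0 int_set// ALL.
by apply: filterS H => x /= /(_ I) [].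
Unshelve. all: by end_near. Qed.
End rays.

(** * Smooth bumps with compact support *)

Section local_bumps.
Context {R : realType}.

Lemma smooth_tens (V V' : normedModType R) (I J : Type) (k : I -> V -> R)
    (k' : J -> V' -> R) :
  (forall i, smooth (k i)) -> (forall j, smooth (k' j)) ->
  forall ij, smooth (tens k k' ij).
Proof.
move=> sk sk' [i j]; apply: smoothM.
  apply: (@smooth_affine _ (V * V')%type V (k i) fst fst) => //.
  by move=> x; exact: cvg_fst.
apply: (@smooth_affine _ (V * V')%type V' (k' j) snd snd) => //.
by move=> x; exact: cvg_snd.
Qed.

(** A smooth counterpart of a base of relatively compact neighbourhoods. With a countable index it
    replaces second countability and sigma-compactness in what follows. *)
Definition local_bumps (V : normedModType R) (I : Type) (k : I -> V -> R) :=
  [/\ forall i, smooth (k i), unit_bounded k &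
    forall x O, nbhs x O -> exists i, 0 < k i x /\
      exists C, [/\ compact C, C `<=` O & forall y, ~ C y -> k i y = 0]].

Lemma local_bumps_tens (V V' : normedModType R) (I J : Type) (k : I -> V -> R)
    (k' : J -> V' -> R) :
  local_bumps k -> local_bumps k' -> local_bumps (tens k k').
Proof.
move=> [sk uk bk] [sk' uk' bk']; split.
- exact: smooth_tens.
- exact: unit_bounded_tens.
move=> [x y] O [[A B] /= [xA yB] ABO].
have [i [ki [C [cC CA C0]]]] := bk _ _ xA.
have [j [kj [D [cD DB D0]]]] := bk' _ _ yB.
exists (i, j); split; first exact: mulr_gt0.
exists (C `*` D); split.
- exact: compact_setX.
- by move=> [a b] [/= Ca Db]; apply: ABO; split; [exact: CA|exact: DB].
- move=> [a b] /not_andP[Ca|Db]; rewrite /tens/=.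
    by rewrite C0// mul0r.
  by rewrite D0// mulr0.
Qed.

Definition bump (ab : rat * rat) (x : R) : R :=
  flat (x - ratr ab.1) * flat (ratr ab.2 - x).

Lemma smooth_flat_affine (a b : R) : smooth (fun x => flat (a * x + b)).
Proof.
apply: (@smooth_affine _ R R flat (fun x => a * x + b) (fun x => a * x)).
- move=> x; apply: cvgD; last exact: cvg_cst.
  by apply: cvgM; [exact: cvg_cst|exact: cvg_id].
- by move=> x d k /=; rewrite /GRing.scale/=; ring.
- exact: smooth_flat.
Qed.

Lemma smooth_bump ab : smooth (bump ab).
Proof.
apply: smoothM.
- rewrite (_ : (fun x => _) = (fun x => flat (1 * x - ratr ab.1))).
    exact: smooth_flat_affine.
  by apply/funext => x; rewrite mul1r.
- rewrite (_ : (fun x => _) = (fun x => flat (-1 * x + ratr ab.2))).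
    exact: smooth_flat_affine.
  by apply/funext => x; rewrite mulN1r addrC.
Qed.

Lemma smooth_ray nb : smooth (@ray R nb).
Proof.
have := smooth_flat_affine (- nb.1%:R) (nb.1%:R * ratr nb.2).
rewrite (_ : (fun _ => _) = ray nb)//.
by apply/funext => x; rewrite /ray; congr flat; ring.
Qed.

Lemma local_bumps_bump : local_bumps bump.
Proof.
split; first exact: smooth_bump.
  move=> ab x; rewrite mulr_ge0 ?flat_ge0//=.
  by rewrite mulr_ile1 ?flat_ge0 ?flat_le1.
move=> x O /nbhs_ballP[e /= e0 xO].
have /rat_in_itvoo[a] : x - e < x by rewrite ltrBlDr ltrDl.
have /rat_in_itvoo[b] : x < x + e by rewrite ltrDl.
rewrite !in_itv/= => /andP[xb bx] /andP[ax xa]; exists (a, b).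
split; first by rewrite /bump mulr_gt0// flat_gt0 subr_gt0.
exists `[ratr a, ratr b]%classic; split.
- exact: segment_compact.
- move=> y /=; rewrite in_itv/= => /andP[ay yb]; apply: xO.
  rewrite /ball/= ltr_distlC; apply/andP; split.
    by apply: lt_le_trans ay.
  exact: le_lt_trans yb _.
- move=> y /=; rewrite in_itv/= /bump => /negP.
  rewrite negb_and -!ltNge => /orP[ya|yb].
    by rewrite flat_eq0 ?mul0r// subr_le0 ltW.
  by rewrite [X in _ * X]flat_eq0 ?mulr0// subr_le0 ltW.
Qed.

Definition fam3 (I : Type) (k : I -> R -> R) := tens (tens k k) k.
Definition fam7 (I : Type) (k : I -> R -> R) := tens (tens k (fam3 k)) (fam3 k).

Lemma smooth_fam7 (I : Type) (k : I -> R -> R) : (forall i, smooth (k i)) ->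
  forall i, smooth (fam7 k i : txv R -> R).
Proof.
move=> sk; have s3 : forall i, smooth (fam3 k i).
  by apply: smooth_tens => //; exact: smooth_tens.
by apply: smooth_tens => //; exact: smooth_tens.
Qed.

Lemma local_bumps_fam7 : local_bumps (fam7 bump : _ -> txv R -> R).
Proof.
have b1 := local_bumps_bump.
have b3 : local_bumps (fam3 bump).
  by apply: local_bumps_tens => //; exact: local_bumps_tens.
by apply: local_bumps_tens => //; exact: local_bumps_tens.
Qed.

Lemma measurable_bump ab : measurable_fun setT (bump ab).
Proof.
apply: measurable_funM; apply: (measurableT_comp measurable_flat);
  exact: measurable_funB.
Qed.

Lemma measurable_fam7 (I : Type) (k : I -> R -> R) :
  (forall i, measurable_fun setT (k i)) ->
  forall i, measurable_fun setT (fam7 k i : txv R -> R).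
Proof.
move=> mk; have m3 : forall i, measurable_fun setT (fam3 k i).
  by apply: measurable_tens => //; exact: measurable_tens.
by apply: measurable_tens => //; exact: measurable_tens.
Qed.

Lemma separating_fam7 : separating (@leb7 R) (fam7 (@ray R)).
Proof.
have u1 := @unit_bounded_ray R; have m1 := @measurable_ray R.
have s1 := @separating_ray R.
have u2 := unit_bounded_tens u1 u1.
have u3 : unit_bounded (fam3 (@ray R)) by exact: unit_bounded_tens.
have m2 : forall i, measurable_fun setT (tens (@ray R) (@ray R) i).
  exact: measurable_tens.
have m3 : forall i, measurable_fun setT (fam3 (@ray R) i) by exact: measurable_tens.
have s3 : separating (@leb3 R) (fam3 (@ray R)).
  by apply: separating_tens => //; exact: separating_tens.
apply: separating_tens => //.
- exact: unit_bounded_tens.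
- exact: measurable_tens.
- exact: separating_tens.
Qed.

(** The sigma-algebra on [txv] is the product one; O belongs to it as the countable union of the
    positivity sets of the bumps whose support lies in O. *)
Lemma open_measurable7 (O : set (txv R)) : open O -> measurable O.
Proof.
move=> oO; have [sk uk bk] := local_bumps_fam7.
pose good i := exists C, [/\ compact C, C `<=` O &
  forall y, ~ C y -> fam7 bump i y = 0 :> R].
rewrite (_ : O = \bigcup_i [set x | good i /\ 0 < fam7 bump i x]).
  apply: countable_bigcupT_measurable => [|i]; first exact: countableP.
  have [gi|ngi] := pselect (good i); last first.
    by rewrite (_ : [set x | _] = set0)//; apply/seteqP; split => x // -[].
  rewrite (_ : [set x | _] = (fam7 bump i @^-1` `]0, +oo[)); last first.
    by apply/seteqP; split => x /=; rewrite in_itv/= andbT; [move=> [] | split].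
  rewrite -[X in measurable X]setTI.
  by apply: measurable_fam7 => //; exact: measurable_bump.
apply/seteqP; split=> x.
  move=> Ox; have [|i [ki gi]] := bk x O; first by exact: open_nbhs_nbhs.
  by exists i.
move=> [i _ [[C [cC CO C0]] /= ki]]; apply: CO; apply: contrapT => /C0 E.
by rewrite E ltxx in ki.
Qed.

Lemma compact_measurable7 (K : set (txv R)) : compact K -> measurable K.
Proof.
move=> cK; have cl : closed K.
  by apply: compact_closed => //; exact: norm_hausdorff.
rewrite -[K]setCK; apply: measurableC; apply: open_measurable7.
exact: closed_openC.
Qed.

(** For a bump supported in O, its products with the rays are test functions, so h times the bump is
    integrable and orthogonal to a separating family. The countably many bumps leave no point of O
    uncovered. *)
Lemma vanishing_of_test (O : set (txv R)) (h : txv R -> R) : open O ->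
  (forall K, compact K -> K `<=` O -> Lone (@leb7 R) (h \_ K)) ->
  (forall phi, test_function O phi -> \int[@leb7 R]_z (h z * phi z) = 0) ->
  {ae @leb7 R, forall z, O z -> h z = 0}.
Proof.
move=> oO lh h0; have [sk uk bk] := local_bumps_fam7.
have mk := measurable_fam7 measurable_bump.
have mr := measurable_fam7 (@measurable_ray R).
have H i : {ae @leb7 R, forall z, (exists C, [/\ compact C, C `<=` O &
    forall y, ~ C y -> fam7 bump i y = 0 :> R]) -> h z * fam7 bump i z = 0}.
  have [[C [cC CO C0]]|nC] := pselect (exists C, [/\ compact C, C `<=` O &
    forall y, ~ C y -> fam7 bump i y = 0 :> R]); last by apply: aeW => z /nC.
  have E z : (h \_ C) z * fam7 bump i z = h z * fam7 bump i z.
    rewrite patchE; case: ifPn => // /negP; rewrite inE => /C0 ->.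
    by rewrite !mulr0.
  have : {ae @leb7 R, forall z, h z * fam7 bump i z = 0}.
    apply: separating_fam7.
      have := @LoneM _ _ _ (@leb7 R) (h \_ C) (fam7 bump i) 1 (mk i) _ (lh _ cC CO).
      under eq_fun do rewrite E.
      by apply => z; have /andP[a b] := uk i z; rewrite ger0_norm.
    move=> l; under eq_Rintegral do rewrite -mulrA.
    apply: h0; split; last first.
      by exists C; split => // z /C0 ->; rewrite mul0r.
    apply: smoothM; first exact: sk.
    by apply: smooth_fam7; exact: smooth_ray.
  by apply: ae_imp => z -> _.
have := ae_countable H; apply: ae_imp => z Hz Oz.
have [|i [ki gi]] := bk z O; first exact: open_nbhs_nbhs.
have /eqP := Hz i gi; rewrite mulf_eq0 => /orP[/eqP//|/eqP ki0].
by rewrite ki0 ltxx in ki.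
Qed.
End local_bumps.

(** * Measure-preserving maps *)

Section measure_preserving.

(** Stated with integrals of nonnegative functions rather than measures of preimages, the form in
    which Tonelli's theorem yields skew products ([preserves_prod]). *)
Definition preserves d (T : measurableType d) (R : realType)
    (mu : {measure set T -> \bar R}) (phi : T -> T) :=
  measurable_fun setT phi /\
  forall h : T -> \bar R, measurable_fun setT h -> (forall x, 0 <= h x)%E ->
    (\int[mu]_x h (phi x) = \int[mu]_x h x)%E.

Section theory.
Context d (T : measurableType d) (R : realType).
Variable mu : {measure set T -> \bar R}.

Lemma preserves_pushforward (phi : T -> T) : measurable_fun setT phi ->
  (forall A, measurable A -> pushforward mu phi A = mu A) -> preserves mu phi.
Proof.
move=> mphi H; split => // h mh h0.
rewrite -(@ge0_integral_pushforward _ _ _ _ _ _ mphi mu setT h)//.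
by apply: eq_measure_integral => A mA _; exact: H.
Qed.

Lemma preserves_id : preserves mu id.
Proof. by split => //; exact: measurable_id. Qed.

Lemma preserves_Lone (phi : T -> T) f : preserves mu phi -> Lone mu f ->
  Lone mu (fun x => f (phi x)).
Proof.
move=> [mphi H] lf; have mf := Lone_meas lf; apply: Lone_le_lty.
  exact: measurableT_comp mf mphi.
rewrite (H (fun x => (`|f x|)%:E))//; first exact: Lone_lty.
by apply/measurable_EFinP; exact: measurableT_comp.
Qed.

Lemma preserves_int (phi : T -> T) f : preserves mu phi -> Lone mu f ->
  \int[mu]_x f (phi x) = \int[mu]_x f x.
Proof.
move=> pp lf; have [mphi H] := pp; have mf := Lone_meas lf.
have lp : Lone mu (fun x => Num.max (f x) 0).
  apply: Lone_le lf; first exact: measurable_maxr.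
  by move=> x; case: (ltP (f x) 0) => h; rewrite ?normr0.
have ln : Lone mu (fun x => Num.max (- f x) 0).
  apply: Lone_le (LoneN lf); first by apply: measurable_maxr => //; exact: measurableT_comp.
  by move=> x; case: (ltP (- f x) 0) => h; rewrite ?normr0.
have E x : f x = Num.max (f x) 0 - Num.max (- f x) 0.
  by case: (ltP (f x) 0) => h; case: (ltP (- f x) 0) => k; lra.
have K g : Lone mu g -> (forall x, 0 <= g x) ->
    \int[mu]_x g (phi x) = \int[mu]_x g x.
  move=> lg g0; congr fine; rewrite (H (EFin \o g))//.
    exact: (measurable_int mu lg).
transitivity (\int[mu]_x (Num.max (f (phi x)) 0 - Num.max (- f (phi x)) 0)).
  by apply: eq_Rintegral => x _; exact: E.
rewrite intB; [|exact: (preserves_Lone pp lp)|exact: (preserves_Lone pp ln)].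
rewrite (K (fun x => Num.max (f x) 0))//; last by move=> x; rewrite le_max lexx orbT.
rewrite (K (fun x => Num.max (- f x) 0))//; last by move=> x; rewrite le_max lexx orbT.
by rewrite -intB//; apply: eq_Rintegral => x _; rewrite -E.
Qed.

Lemma preserves_ae (phi : T -> T) (P : T -> Prop) : preserves mu phi ->
  {ae mu, forall x, P x} -> {ae mu, forall x, P (phi x)}.
Proof.
move=> [mphi H] [N [mN N0 PN]]; exists (phi @^-1` N); split.
- by rewrite -[X in measurable X]setTI; exact: mphi.
- have mpN : measurable (phi @^-1` N).
    by rewrite -[X in measurable X]setTI; exact: mphi.
  rewrite -[phi @^-1` N]setIT -integral_indic// -(setIT N) in N0 *.
  rewrite -integral_indic// in N0; rewrite -[RHS]N0.
  rewrite -(H (fun x => (\1_N x)%:E))//; first by rewrite setIT.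
    exact/measurable_EFinP/measurable_indic.
- by move=> x /= nP; apply: PN => /= Px.
Qed.
End theory.

(** A skew product: with the second variable frozen the first component preserves [m1], so Tonelli
    with the inner integral over the first factor leaves an integral over the second factor, on
    which [b] acts. *)
Lemma preserves_prod d1 d2 (T1 : measurableType d1) (T2 : measurableType d2)
    (R : realType) (m1 : {sigma_finite_measure set T1 -> \bar R})
    (m2 : {sigma_finite_measure set T2 -> \bar R})
    (a : T1 * T2 -> T1) (b : T2 -> T2) :
  measurable_fun setT a -> (forall y, preserves m1 (fun x => a (x, y))) ->
  preserves m2 b ->
  preserves (sfprod m1 m2) (fun z => (a z, b z.2)).
Proof.
move=> ma pa [mb pb].
have mab : measurable_fun setT (fun z : T1 * T2 => (a z, b z.2)).
  apply: measurable_fun_pair => //.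
  exact: (measurableT_comp mb measurable_snd).
split => // h mh h0.
rewrite [LHS](fubini_tonelli2 (fun z => h (a z, b z.2))); last first.
- by move=> x; exact: h0.
- exact: measurableT_comp mh mab.
rewrite [RHS](fubini_tonelli2 h); [|exact: mh|exact: h0].
rewrite -(pb (fubini_G m1 h)).
- apply: eq_integral => y _; rewrite /fubini_G.
  have [_ Hy] := pa y; apply: (Hy (fun x => h (x, b y))) => //.
  exact: (measurable_fun_pair1 _ mh).
- exact: measurable_fun_fubini_tonelli_G.
- by move=> y; apply: integral_ge0.
Qed.

Section lebesgue.
Context {R : realType}.
Notation leb := (@lebesgue_measure R).

Lemma preserves_shift (c : R) : preserves leb (fun x => x + c).
Proof.
have mc : measurable_fun setT (fun x : measurableTypeR R => (x + c : measurableTypeR R)).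
  by apply: measurable_funD.
apply: preserves_pushforward => // A mA.
apply/esym/lebesgue_measure_unique => //= _ [[x y]] _ <-.
rewrite /pushforward/= (_ : _ @^-1` _ = `]x - c, y - c]%classic).
  rewrite !lebesgue_measure_itv/= !lte_fin ltrD2r; case: ifP => // _.
  by rewrite -!EFinB; congr EFin; ring.
by apply/seteqP; split => z /=; rewrite !in_itv/= ltrBlDr lerBrDr.
Qed.

Lemma preserves_opp : preserves leb -%R.
Proof.
apply: preserves_pushforward; first exact: oppr_measurable.
by move=> A mA; exact: lebesgue_measureN.
Qed.

End lebesgue.
End measure_preserving.

Section measure_preserving7.
Context {R : realType}.

Lemma preserves_comp d (T : measurableType d) (mu : {measure set T -> \bar R})
  (f g : T -> T) : preserves mu f -> preserves mu g -> preserves mu (f \o g).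
Proof.
move=> [mf Hf] [mg Hg]; split; first exact: measurableT_comp.
move=> h mh h0; rewrite -(Hf h)//; apply: (Hg (h \o f)).
  exact: measurableT_comp.
by move=> x; exact: h0.
Qed.

Lemma measurable_fun_addR3 d (T : measurableType d) (f g : T -> R3 R) :
  measurable_fun setT f -> measurable_fun setT g ->
  measurable_fun setT (fun x => f x + g x).
Proof.
move=> /measurable_fun_pairP[/measurable_fun_pairP[f1 f2] f3].
move=> /measurable_fun_pairP[/measurable_fun_pairP[g1 g2] g3].
apply: measurable_fun_pair; last exact: measurable_funD.
by apply: measurable_fun_pair; exact: measurable_funD.
Qed.

Lemma measurable_fun_scaleR3 d (T : measurableType d) (k : T -> R) (f : T -> R3 R) :
  measurable_fun setT k -> measurable_fun setT f ->
  measurable_fun setT (fun x => k x *: f x).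
Proof.
move=> mk /measurable_fun_pairP[/measurable_fun_pairP[f1 f2] f3].
apply: measurable_fun_pair; last exact: measurable_funM.
by apply: measurable_fun_pair; exact: measurable_funM.
Qed.

Lemma preserves_map3 (a b c : R -> R) :
  preserves lebesgue_measure a -> preserves lebesgue_measure b ->
  preserves lebesgue_measure c ->
  preserves (@leb3 R) (fun x => (a x.1.1, b x.1.2, c x.2)).
Proof.
move=> pa pb pc; have [ma _] := pa; have [mb _] := pb.
have m1 : measurable_fun setT (fun z : (R * R) * R => (a z.1.1, b z.1.2)).
  apply: measurable_fun_pair.
    by apply: (measurableT_comp ma); apply: measurableT_comp.
  by apply: (measurableT_comp mb); apply: measurableT_comp.
have pab : preserves (sfprod (@lebesgue_measure R) (@lebesgue_measure R))
    (fun z => (a z.1, b z.2)).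
  have m0 : measurable_fun setT (fun z : R * R => a z.1).
    exact: measurableT_comp.
  exact: (@preserves_prod _ _ _ _ R lebesgue_measure lebesgue_measure _ _ m0
    (fun=> pa) pb).
exact: (@preserves_prod _ _ _ _ _ (sfprod lebesgue_measure lebesgue_measure)
  lebesgue_measure _ _ m1 (fun=> pab) pc).
Qed.

Lemma preserves_shift3 (c : R3 R) : preserves (@leb3 R) (fun x => x + c).
Proof.
case: c => [[c1 c2] c3].
exact: (preserves_map3 (preserves_shift c1) (preserves_shift c2) (preserves_shift c3)).
Qed.

Lemma preserves_opp3 : preserves (@leb3 R) (fun x => - x).
Proof.
exact: (preserves_map3 (@preserves_opp R) (@preserves_opp R) (@preserves_opp R)).
Qed.

(** Applied both to the affine flows and to the segment maps [ride]. It is a skew product twice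
    over: t is translated by a function of (x, v), x by a function of v, and v is moved by
    [beta]. *)
Lemma preserves_shear (tau : R3 R * R3 R -> R) (zeta beta : R3 R -> R3 R) :
  measurable_fun setT tau -> measurable_fun setT zeta ->
  preserves (@leb3 R) beta ->
  preserves (@leb7 R)
    (fun z => (z.1.1 + tau (z.1.2, z.2), z.1.2 + zeta z.2, beta z.2)).
Proof.
move=> mtau mzeta pb.
have mx : measurable_fun setT (fun z : txv R => (z.1.2, z.2)).
  by apply: measurable_fun_pair => //; exact: measurableT_comp.
have m1 : measurable_fun setT (fun z : txv R =>
    (z.1.1 + tau (z.1.2, z.2), z.1.2 + zeta z.2)).
  apply: measurable_fun_pair.
    apply: measurable_funD; first exact: measurableT_comp.
    exact: (measurableT_comp mtau mx).
  apply: measurable_fun_addR3; first exact: measurableT_comp.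
  exact: (measurableT_comp mzeta).
have p1 v : preserves (sfprod (@lebesgue_measure R) (@leb3 R))
    (fun z => (z.1 + tau (z.2, v), z.2 + zeta v)).
  have m0 : measurable_fun setT (fun z : R * R3 R => z.1 + tau (z.2, v)).
    apply: measurable_funD => //.
    by apply: (measurableT_comp mtau); apply: measurable_fun_pair.
  exact: (@preserves_prod _ _ _ _ R lebesgue_measure (@leb3 R) _ _ m0
    (fun x => preserves_shift (tau (x, v))) (preserves_shift3 (zeta v))).
exact: (@preserves_prod _ _ _ _ _ (sfprod lebesgue_measure (@leb3 R))
  (@leb3 R) _ _ m1 p1 pb).
Qed.

End measure_preserving7.

(** * Weak derivatives along affine flows *)

Section directional.
Context {R : realType} {V : normedModType R}.
Implicit Types (phi : V -> R).

(** Increments of unknown sign, possibly zero, have to be handled in [is_derive_curve], whence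
    absolute values instead of an interval for c. *)
Lemma MVT_line (F F' : R -> R) (r : R) : (forall x : R, is_derive x (1 : R) F (F' x)) ->
  exists c, `|c| <= `|r| /\ F r - F 0 = r * F' c.
Proof.
move=> dF.
have cF a b : {within `[a, b], continuous F}.
  apply: continuous_subspaceT => x; apply: differentiable_continuous.
  by apply/derivable1_diffP; have [] := dF x.
have [r0|r0|<-] := ltgtP 0 r.
- have [c + E] := MVT r0 (fun x _ => dF x) (cF 0 r).
  rewrite in_itv/= => /andP[c0 cr].
  exists c; rewrite !gtr0_norm//; split; first exact: ltW.
  by rewrite E subr0 mulrC.
- have [c + E] := MVT r0 (fun x _ => dF x) (cF r 0).
  rewrite in_itv/= => /andP[c0 cr].
  exists c; rewrite !ltr0_norm//; split; first by rewrite lerN2 ltW.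
  by rewrite -[LHS]opprB E; ring.
- by exists 0; rewrite subrr mul0r.
Qed.

(** A chain rule for functions having only directional derivatives. The increment is split at z + r
    a: the first part is the quotient defining the a-derivative, the second comes from the mean
    value theorem along b and converges by continuity of the b-derivative. *)
Lemma is_derive_curve phi (z a b : V) (rho : R -> R) (rho' : R) :
  derivable phi z a -> (forall y, derivable phi y b) ->
  {for z, continuous ('D_b phi)} -> rho 0 = 0 -> is_derive (0 : R) (1 : R) rho rho' ->
  is_derive (0 : R) (1 : R) (fun r => phi (z + r *: a + rho r *: b))
    ('D_a phi z + rho' * 'D_b phi z).
Proof.
move=> da db cb rho0 drho; apply/is_derive1_cvgP.
have crho : rho r @[r --> (0 : R)] --> (0 : R).
  rewrite -[X in _ --> X]rho0; have [dr _] := drho.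
  by move/derivable1_diffP/differentiable_continuous : dr; exact.
have Fb y (c : R) : is_derive c (1 : R) (fun s => phi (y + s *: b)) ('D_b phi (y + c *: b)).
  exact: (is_derive_line (derivable_is_derive (db _))).
have /choice[xi Hxi] : forall r, exists c, `|c| <= `|rho r| /\
    phi (z + r *: a + rho r *: b) - phi (z + r *: a) =
    rho r * 'D_b phi (z + r *: a + c *: b).
  move=> r; have [c [c1 c2]] := MVT_line (rho r) (Fb (z + r *: a)).
  by exists c; split => //; rewrite -c2 scale0r addr0.
have E (h : R) : h^-1 * (phi (z + (0 + h) *: a + rho (0 + h) *: b) -
      phi (z + 0 *: a + rho 0 *: b)) =
    h^-1 * (phi (z + h *: a) - phi z) +
    (h^-1 * (rho (0 + h) - rho 0)) * 'D_b phi (z + h *: a + xi h *: b).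
  rewrite rho0 !scale0r !addr0 !add0r subr0.
  rewrite -[_ * rho h * _]mulrA; have [_ <-] := Hxi h; ring.
under eq_cvg do rewrite E.
have c0 : h @[h --> (0 : R)^'] --> (0 : R) by apply: cvg_within_filter; exact: cvg_id.
apply: cvgD.
  by have /is_derive_cvgP := derivable_is_derive da.
apply: cvgM.
  by have /is_derive1_cvgP := drho.
have xi0 : xi h @[h --> (0 : R)^'] --> (0 : R).
  apply/cvgr0Pnorm_lt => e e0.
  have : \forall h \near (0 : R)^', `|rho h| < e.
    by apply: cvg_within; move/cvgr0Pnorm_lt : crho => /(_ e e0).
  by apply: filterS => h; have [+ _] := Hxi h; exact: le_lt_trans.
have L : z + h *: a + xi h *: b @[h --> (0 : R)^'] --> z + (0 : R) *: a + (0 : R) *: b.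
  apply: cvgD; last exact: cvgZr_tmp.
  by apply: cvgD; [exact: cvg_cst|exact: cvgZr_tmp].
rewrite !scale0r !addr0 in L.
exact: (cvg_comp (fun h => z + h *: a + xi h *: b) ('D_b phi) L cb).
Qed.

Lemma derivable_dirD phi z a b :
  derivable phi z a -> (forall y, derivable phi y b) ->
  {for z, continuous ('D_b phi)} ->
  is_derive z (a + b) phi ('D_a phi z + 'D_b phi z).
Proof.
move=> da db cb; have := is_derive_curve da db cb erefl (is_derive_id _ _).
move=> /is_derive1_cvgP H; apply/is_derive_cvgP; rewrite mul1r in H.
have -> : (fun h : R => h^-1 * (phi (z + h *: (a + b)) - phi z)) =
  (fun h : R => h^-1 * (phi (z + (0 + h) *: a + id (0 + h) *: b) -
     phi (z + (0 : R) *: a + id (0 : R) *: b))); last by [].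
by apply/funext => h; rewrite /= !scale0r !addr0 add0r scalerDr addrA.
Qed.

Lemma derivable_dirZ phi z a (c : R) : derivable phi z a ->
  is_derive z (c *: a) phi (c * 'D_a phi z).
Proof.
move=> da; have : is_derive (0 : R) (1 : R) (fun s => phi (z + s *: a)) ('D_a phi z).
  by apply: is_derive_line; rewrite scale0r addr0; exact: derivable_is_derive.
move=> /(is_derive_dir c)/is_derive_cvgP H; apply/is_derive_cvgP.
have -> : (fun h : R => h^-1 * (phi (z + h *: (c *: a)) - phi z)) =
  (fun h : R => h^-1 * (phi (z + (0 + h *: (c : R)) *: a) -
     phi (z + (0 : R) *: a))); last by [].
by apply/funext => h; rewrite /= scale0r addr0 add0r scalerA.
Qed.

Lemma smooth_dirD phi a b z : smooth phi ->
  'D_(a + b) phi z = 'D_a phi z + 'D_b phi z.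
Proof.
move=> sphi.
have [] // := @derivable_dirD phi z a b _ _ _.
- exact: smooth_derivable.
- by move=> y; exact: smooth_derivable.
- by apply: smooth_continuous; exact: smooth_derive.
Qed.

Lemma smooth_dirZ phi (c : R) a z : smooth phi ->
  'D_(c *: a) phi z = c * 'D_a phi z.
Proof.
move=> sphi.
have [] // := @derivable_dirZ phi z a c _.
exact: smooth_derivable.
Qed.

Lemma smooth_dir_sum n (c : 'I_n -> R) (a : 'I_n -> V) phi z :
  smooth phi ->
  'D_(\sum_(i < n) c i *: a i) phi z = \sum_(i < n) c i * 'D_(a i) phi z.
Proof.
move=> sphi; elim: n c a => [|n IH] c a; first by rewrite !big_ord0 derive0.
by rewrite !big_ord_recr/= smooth_dirD// smooth_dirZ// IH.
Qed.

Lemma derive_lincomb n (c : 'I_n -> R) (F : 'I_n -> V -> R) v z :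
  (forall i, smooth (F i)) ->
  'D_v (fun y => \sum_(i < n) c i * F i y) z = \sum_(i < n) c i * 'D_v (F i) z.
Proof.
move=> sF; elim: n c F sF => [|n IH] c F sF.
  rewrite big_ord0 (_ : (fun y => _) = cst 0) ?derive_cst//.
  by apply/funext => y; rewrite big_ord0.
rewrite big_ord_recr/= -IH//.
rewrite (_ : (fun y => _) = (fun y => \sum_(i < n) c (widen_ord (leqnSn n) i) *
  F (widen_ord (leqnSn n) i) y) + (c ord_max \*: F ord_max)); last first.
  by apply/funext => y; rewrite big_ord_recr.
rewrite deriveD.
- rewrite deriveZ//; exact: smooth_derivable.
- by apply: smooth_derivable; apply: smooth_sum => i; exact: smoothZ.
- by apply: derivableZ; exact: smooth_derivable.
Qed.

End directional.

(** * Local integrability and test functions *)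

Section local_integrability.
Context {R : realType}.
Notation W := (txv R).
Notation mu := (@leb7 R).
Implicit Types (U K : set W) (f g h psi : W -> R).

Lemma continuous_measurable7 f : continuous f -> measurable_fun setT f.
Proof.
move=> cf; apply: (measurability _ (RGenInftyO.measurableE R)) => //.
move=> _ [_ [x ->] <-]; rewrite setTI; apply: open_measurable7.
by apply: open_comp => // y _; exact: cf.
Qed.

Lemma compact_bounded K f : compact K -> {within K, continuous f} ->
  exists M, forall w, K w -> `|f w| <= M.
Proof.
move=> cK cf; have [->|/set0P K0] := eqVneq K set0; first by exists 0.
have cn : {within K, continuous (fun w => `|f w|)}.
  by move=> w; apply: continuous_comp; [exact: cf|exact: norm_continuous].
have [w [_ Hw]] := compact_EVT_max K0 cK cn.
by exists `|f w| => v Kv; apply: Hw; exact: mem_set.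
Qed.

Lemma compact_support_bounded K psi : compact K -> continuous psi ->
  (forall w, ~ K w -> psi w = 0) -> exists M, forall w, `|psi w| <= M.
Proof.
move=> cK cpsi psi0.
have [M HM] := compact_bounded cK (continuous_subspaceT cpsi).
exists (Num.max M 0) => w; have [Kw|/psi0 ->] := pselect (K w).
  by rewrite le_max HM.
by rewrite normr0 le_max lexx orbT.
Qed.

Definition locint U h := forall K, compact K -> K `<=` U -> Lone mu (h \_ K).

Lemma Lone_cut h K psi M : Lone mu (h \_ K) -> measurable_fun setT psi ->
  (forall w, `|psi w| <= M) -> (forall w, ~ K w -> psi w = 0) ->
  Lone mu (fun w => h w * psi w).
Proof.
move=> lh mpsi bpsi psi0.
have -> : (fun w => h w * psi w) = (fun w => (h \_ K) w * psi w).
  apply/funext => w; rewrite patchE; case: ifPn => // /negP; rewrite inE.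
  by move=> /psi0 ->; rewrite !mulr0.
exact: LoneM lh.
Qed.

Lemma test_function_smooth U psi : test_function U psi -> smooth psi.
Proof. by case. Qed.

Lemma Lone_test U h psi : locint U h -> test_function U psi ->
  Lone mu (fun w => h w * psi w).
Proof.
move=> lh [spsi [K [cK KU psi0]]].
have cpsi := smooth_continuous spsi.
have [M HM] := compact_support_bounded cK cpsi psi0.
apply: (Lone_cut (lh K cK KU)) HM psi0; exact: continuous_measurable7.
Qed.

Lemma test_functionD U psi d : open U -> test_function U psi ->
  test_function U ('D_d psi).
Proof.
move=> oU [spsi [K [cK KU psi0]]]; split; first exact: smooth_derive.
exists K; split => // w nKw.
have oK : open (~` K).
  by apply: closed_openC; apply: compact_closed => //; exact: norm_hausdorff.
rewrite (@near_eq_derive _ _ _ _ (cst 0)) ?derive_cst//.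
have : nbhs w (~` K) by exact: open_nbhs_nbhs.
by apply: filterS => y /psi0 ->.
Qed.

Lemma test_functionM U psi c : smooth c -> test_function U psi ->
  test_function U (fun w => c w * psi w).
Proof.
move=> sc [spsi [K [cK KU psi0]]]; split; first exact: smoothM.
by exists K; split => // w /psi0 ->; rewrite mulr0.
Qed.

Lemma distr_deriv_patch U e f g : open U -> distr_deriv U e f g ->
  [/\ locint U (f \_ U), locint U (g \_ U) &
    forall phi, test_function U phi ->
      \int[mu]_w ((f \_ U) w * 'D_e phi w) = - \int[mu]_w ((g \_ U) w * phi w)].
Proof.
move=> oU [lf lg fg].
have P h : integrable_on_compacts U U h -> locint U (h \_ U).
  move=> lh K cK KU; have := lh K cK KU.
  rewrite setIidl// Lone_on; last exact: compact_measurable7.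
  have -> // : (h \_ U) \_ K = h \_ K.
  apply/funext => w; rewrite !patchE; case: ifPn => // /set_mem/KU Uw.
  by rewrite mem_set.
have Q h k : \int[mu]_(w in U) (h w * k w) = \int[mu]_w ((h \_ U) w * k w).
  rewrite Rintegral_mkcond; apply: eq_Rintegral => w _.
  by rewrite !patchE; case: ifP => // _; rewrite mul0r.
split; [exact: P|exact: P|move=> phi tphi].
by have := fg phi tphi; rewrite !Q.
Qed.

End local_integrability.

Section affine_fields.
Context {R : realType}.
Notation W := (txv R).
Notation mu := (@leb7 R).
Implicit Types (w d X : W) (lambda : R).

Lemma coord3D (x y : R3 R) i : coord3 (x + y) i = coord3 x i + coord3 y i.
Proof. by rewrite /coord3; case: i => [[|[|[|]]]]. Qed.

Lemma coord3Z (k : R) (x : R3 R) i : coord3 (k *: x) i = k * coord3 x i.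
Proof. by rewrite /coord3; case: i => [[|[|[|]]]]. Qed.

Lemma coord3_e3 i k : coord3 (e3 R i) k = (i == k)%:R.
Proof.
by rewrite /coord3/=; case: i => [[|[|[|]]]] //= ?; case: k => [[|[|[|]]]].
Qed.

Lemma sum_coord3 (x : R3 R) : x = \sum_(i < 3) coord3 x i *: e3 R i.
Proof.
case: x => [[a b] c]; rewrite !big_ord_recr big_ord0/= add0r /coord3 /e3/=.
congr (_, _, _); rewrite /=; rewrite /GRing.scale/=; ring.
Qed.

Lemma continuous_coord3 i : continuous (@coord3 R ^~ i).
Proof.
have c1 : continuous (fun x : R3 R => x.1.1).
  by move=> x; apply: (@continuous_comp _ _ _ fst fst); exact: cvg_fst.
have c2 : continuous (fun x : R3 R => x.1.2).
  move=> x; apply: (@continuous_comp _ _ _ fst snd); first exact: cvg_fst.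
  exact: cvg_snd.
have c3 : continuous (fun x : R3 R => x.2) by move=> x; exact: cvg_snd.
by case: i => [[|[|[|]]]] //= ?; rewrite /coord3.
Qed.

(* When lambda d_v = 0 this field is constant along its own flow [aflow], which
   is then affine and preserves Lebesgue measure. *)
Definition afield d lambda w : W := (d.1.1, d.1.2 + lambda *: w.2, d.2).
Definition aflow d lambda (r : R) w : W := w + r *: afield d lambda w.

Lemma sum_txv X : X = X.1.1 *: et R + \sum_(i < 3) coord3 X.1.2 i *: ex R i +
  \sum_(i < 3) coord3 X.2 i *: ev R i.
Proof.
case: X => [[a x] v]; rewrite /= {1}(sum_coord3 x) {1}(sum_coord3 v).
rewrite !big_ord_recr !big_ord0 /= !add0r /et /ex /ev.
by congr (_, _, _); rewrite /=; rewrite ?scaler0 ?addr0 ?add0r// [a *: _]mulr1.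
Qed.

Lemma dot7_et w : dot7 w (et R) = w.1.1.
Proof.
rewrite /dot7 /et /dot3 /= mulr1 !big_ord_recr !big_ord0 /=.
by rewrite !mulr0 !addr0.
Qed.

Lemma dot3_e3 (x : R3 R) i : dot3 x (e3 R i) = coord3 x i.
Proof.
rewrite /dot3 (bigD1 i)//= coord3_e3 eqxx mulr1 big1 ?addr0// => k ki.
by rewrite coord3_e3 eq_sym (negbTE ki) mulr0.
Qed.

Lemma dot3_0 (x : R3 R) : dot3 x 0 = 0.
Proof. by rewrite /dot3 big1// => i _; rewrite /coord3; case: i => [[|[|[|]]]] //= ?; rewrite mulr0. Qed.

Lemma dot7_ex w i : dot7 w (ex R i) = coord3 w.1.2 i.
Proof. by rewrite /dot7 /ex/= mulr0 add0r dot3_e3 dot3_0 addr0. Qed.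

Lemma dot7_ev w i : dot7 w (ev R i) = coord3 w.2 i.
Proof. by rewrite /dot7 /ev/= mulr0 add0r dot3_e3 dot3_0 add0r. Qed.

Lemma dot7_sum w X : dot7 w X = X.1.1 * dot7 w (et R) +
  \sum_(i < 3) coord3 X.1.2 i * dot7 w (ex R i) +
  \sum_(i < 3) coord3 X.2 i * dot7 w (ev R i).
Proof.
rewrite {1}/dot7 dot7_et /dot3 mulrC; congr (_ + _ + _);
  by apply: eq_bigr => i _; rewrite mulrC ?dot7_ex ?dot7_ev.
Qed.

Lemma smooth_derive_sum X (phi : W -> R) w : smooth phi -> 'D_X phi w =
  X.1.1 * 'D_(et R) phi w + \sum_(i < 3) coord3 X.1.2 i * 'D_(ex R i) phi w +
  \sum_(i < 3) coord3 X.2 i * 'D_(ev R i) phi w.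
Proof.
by move=> sphi; rewrite {1}(sum_txv X) !smooth_dirD// smooth_dirZ// !smooth_dir_sum.
Qed.

Lemma smooth_id : smooth (@id R).
Proof.
apply: (@smooth_coind _ _ (fun h : R -> R => h = id \/ exists c, h = cst c)); last by left.
move=> _ [->|[c ->]]; split.
- by move=> x; exact: cvg_id.
- by move=> x d; exact: derivable_id.
- by move=> d; right; exists d; apply/funext => x; rewrite derive_id.
- by move=> x; exact: cvg_cst.
- by move=> x d; exact: derivable_cst.
- by move=> d; right; exists 0; apply/funext => x; rewrite derive_cst.
Qed.

Lemma continuous_afield_coord d lambda i :
  continuous (fun w => coord3 (afield d lambda w).1.2 i).
Proof.
under eq_fun do rewrite coord3D coord3Z.
move=> w; apply: cvgD; first exact: cvg_cst.
apply: cvgM; first exact: cvg_cst.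
apply: (@continuous_comp _ _ _ snd (@coord3 R ^~ i)); first exact: cvg_snd.
exact: continuous_coord3.
Qed.

Lemma smooth_afield_coord d lambda i :
  smooth (fun w => coord3 (afield d lambda w).1.2 i).
Proof.
apply: (@smooth_affine _ W R id _ (fun d' => lambda * coord3 d'.2 i)).
- exact: continuous_afield_coord.
- move=> w d' k; rewrite /= !coord3D !coord3Z coord3D coord3Z.
  by rewrite /GRing.scale/=; ring.
- exact: smooth_id.
Qed.

(** The coefficient depends on v only, so it commutes with the x-derivatives: the field is
    divergence free. *)
Lemma derive_afield_coord d lambda i (phi : W -> R) w : smooth phi ->
  'D_(ex R i) (fun w => coord3 (afield d lambda w).1.2 i * phi w) w =
  coord3 (afield d lambda w).1.2 i * 'D_(ex R i) phi w.
Proof.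
move=> sphi; have [_ E] : is_derive w (ex R i)
    (fun w => coord3 (afield d lambda w).1.2 i) 0.
  apply/is_derive_cvgP; apply: cvg_near_cst; apply: nearW => h.
  by rewrite /= scaler0 addr0 subrr mulr0.
rewrite deriveM ?E; [|exact: smooth_derivable (smooth_afield_coord _ _ _)|exact: smooth_derivable].
by rewrite scaler0 addr0.
Qed.

Lemma derive_afield d lambda (phi : W -> R) w : smooth phi ->
  'D_(afield d lambda w) phi w = d.1.1 * 'D_(et R) phi w +
    \sum_(i < 3) 'D_(ex R i) (fun w => coord3 (afield d lambda w).1.2 i * phi w) w +
    \sum_(i < 3) coord3 d.2 i * 'D_(ev R i) phi w.
Proof.
move=> sphi; rewrite (smooth_derive_sum _ _ sphi); congr (_ + _ + _).
by apply: eq_bigr => i _; rewrite (derive_afield_coord _ _ _ _ sphi).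
Qed.

Let distrib (a k t : R) (x y b : 'I_3 -> R) :
  a * (k * t + \sum_(i < 3) x i + \sum_(i < 3) b i * y i) =
  k * (a * t) + \sum_(i < 3) a * x i + \sum_(i < 3) b i * (a * y i).
Proof.
rewrite 2!mulrDr !mulr_sumr mulrCA; congr (_ + _).
by apply: eq_bigr => i _; rewrite mulrCA.
Qed.

(** The coefficients varying with v are moved into the test functions; the field being divergence
    free, no zero-order term appears. *)
Lemma weak_afield U (f : W -> R) (Df : W -> W) d lambda (phi : W -> R) :
  open U -> distr_grad U f Df -> test_function U phi ->
  \int[mu]_w ((f \_ U) w * 'D_(afield d lambda w) phi w) =
  - \int[mu]_w (((fun w => dot7 (Df w) (afield d lambda w)) \_ U) w * phi w).
Proof.
move=> oU Hg tphi; have sphi := test_function_smooth tphi.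
have P e : ([set et R] `|` @xv_dir R) e ->
    [/\ locint U (f \_ U), locint U ((fun w => dot7 (Df w) e) \_ U) &
    forall phi, test_function U phi ->
      \int[mu]_w ((f \_ U) w * 'D_e phi w) =
      - \int[mu]_w (((fun w => dot7 (Df w) e) \_ U) w * phi w)].
  by move=> /Hg; exact: distr_deriv_patch.
have Pt := P _ (or_introl erefl).
have Px i := P (ex R i) (or_intror (ex_intro _ i (or_introl erefl))).
have Pv i := P (ev R i) (or_intror (ex_intro _ i (or_intror erefl))).
have [lf lt It] := Pt.
pose c i w := coord3 (afield d lambda w).1.2 i.
have tc i : test_function U (fun w => c i w * phi w).
  by apply: test_functionM => //; exact: smooth_afield_coord.
have lD e : Lone mu (fun w => (f \_ U) w * 'D_e phi w).
  by apply: (Lone_test lf); exact: test_functionD.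
have lDc i : Lone mu (fun w => (f \_ U) w * 'D_(ex R i) (fun w => c i w * phi w) w).
  by apply: (Lone_test lf); exact: test_functionD.
transitivity (\int[mu]_w (d.1.1 * ((f \_ U) w * 'D_(et R) phi w) +
   \sum_(i < 3) ((f \_ U) w * 'D_(ex R i) (fun w => c i w * phi w) w) +
   \sum_(i < 3) (coord3 d.2 i * ((f \_ U) w * 'D_(ev R i) phi w)))).
  by apply: eq_Rintegral => w _; rewrite (derive_afield _ _ _ sphi) distrib.
rewrite (int_lincomb _ _ (lD (et R)) lDc (fun i => lD (ev R i))).
have lt1 : Lone mu (fun w => ((fun w => dot7 (Df w) (et R)) \_ U) w * phi w).
  exact: Lone_test lt tphi.
have lx1 i : Lone mu (fun w => ((fun w => dot7 (Df w) (ex R i)) \_ U) w * (c i w * phi w)).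
  by have [_ lx _] := Px i; exact: Lone_test lx (tc i).
have lv1 i : Lone mu (fun w => ((fun w => dot7 (Df w) (ev R i)) \_ U) w * phi w).
  by have [_ lv _] := Pv i; exact: Lone_test lv tphi.
have -> : \int[mu]_w (((fun w => dot7 (Df w) (afield d lambda w)) \_ U) w * phi w) =
    \int[mu]_w (d.1.1 * (((fun w => dot7 (Df w) (et R)) \_ U) w * phi w) +
     \sum_(i < 3) (((fun w => dot7 (Df w) (ex R i)) \_ U) w * (c i w * phi w)) +
     \sum_(i < 3) (coord3 d.2 i * (((fun w => dot7 (Df w) (ev R i)) \_ U) w * phi w))).
  apply: eq_Rintegral => w _.
  have E h : (h \_ U) w = (\1_U w : R) * h w.
    by rewrite patchE indicE; case: ifP => _; rewrite ?mul1r ?mul0r.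
  under eq_bigr do rewrite E; under [X in _ + X]eq_bigr do rewrite E.
  rewrite !E dot7_sum 2!mulrDr 2!mulrDl !mulr_sumr !mulr_suml.
  congr (_ + _ + _); first by rewrite mulrCA -!mulrA mulrCA.
    by apply: eq_bigr => i _; rewrite /c; ring.
  by apply: eq_bigr => i _; ring.
rewrite (int_lincomb _ _ lt1 lx1 lv1) !opprD; congr (_ + _ + _).
- by rewrite (It _ tphi) mulrN.
- rewrite -sumrN; apply: eq_bigr => i _; have [_ _ Ix] := Px i.
  exact: (Ix (fun w => c i w * phi w) (tc i)).
- rewrite -sumrN; apply: eq_bigr => i _; have [_ _ Iv] := Pv i.
  by rewrite (Iv _ tphi) mulrN.
Qed.

End affine_fields.

Section flow_integrability.
Context d (T : measurableType d) (R : realType).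
Variable mu : {sigma_finite_measure set T -> \bar R}.
Notation leb := (@lebesgue_measure R).

(** By preservation of measure the inner integral of |h (Phi (s, w))| does not depend on s, so
    Tonelli gives a product of two finite integrals. *)
Lemma Lone_flow (chi : R -> R) (Phi : R * T -> T) (h : T -> R) :
  Lone leb chi -> measurable_fun setT Phi ->
  (forall s, preserves mu (fun w => Phi (s, w))) -> Lone mu h ->
  Lone (sfprod leb mu) (fun z => chi z.1 * h (Phi z)).
Proof.
move=> lchi mPhi pPhi lh; have mh := Lone_meas lh; have mchi := Lone_meas lchi.
have mF : measurable_fun setT (fun z : R * T => chi z.1 * h (Phi z)).
  apply: measurable_funM; first exact: measurableT_comp.
  exact: measurableT_comp mh mPhi.
apply/(integrable12ltyP leb mu); first exact/measurable_EFinP.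
set C := (\int[mu]_w (`|h w|)%:E)%E.
have Clty : (C < +oo)%E := Lone_lty lh.
have C0 : (0 <= C)%E by apply: integral_ge0 => w _; rewrite lee_fin.
have Cfin : C \is a fin_num by rewrite ge0_fin_numE.
have E s : (\int[mu]_w (`|chi s * h (Phi (s, w))|%R)%:E)%E =
    (`|chi s| * fine C)%:E.
  rewrite EFinM fineK// /C; have [_ Hs] := pPhi s.
  rewrite -(Hs (fun w => (`|h w|)%:E)).
  - rewrite -ge0_integralZl//.
    + by apply: eq_integral => w _; rewrite normrM EFinM.
    + apply/measurable_EFinP; apply: measurableT_comp => //.
      apply: (measurableT_comp mh); exact: (measurable_fun_pair2 _ mPhi).
  - by apply/measurable_EFinP; exact: measurableT_comp.
  - by move=> w; rewrite lee_fin.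
apply: (@le_lt_trans _ _ (\int[leb]_s (`|chi s| * fine C)%:E)%E).
  rewrite le_eqVlt; apply/orP; left; apply/eqP.
  by apply: eq_integral => s _; exact: E.
have lC : Lone leb (fun s => fine C * chi s) by exact: LoneZ.
apply: le_lt_trans (Lone_lty lC); apply: ge0_le_integral => //=.
- by move=> s _; rewrite lee_fin mulr_ge0// fine_ge0.
- apply/measurable_EFinP; apply: measurable_funM => //.
  exact: measurableT_comp.
- apply/measurable_EFinP; apply: measurableT_comp => //.
  exact: measurable_funM.
- move=> s _; rewrite lee_fin normrM mulrC ler_wpM2r//.
  by rewrite ger0_norm// fine_ge0.
Qed.

End flow_integrability.

Section ftc.
Context {R : realType}.
Notation leb := (@lebesgue_measure R).

Lemma Lone_indic_itv (a b : R) : Lone leb \1_`[a, b].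
Proof. exact: (integrable_indic_itv a b true false). Qed.

Lemma int_indic_derive (F F' : R -> R) (a b : R) : a <= b ->
  (forall x : R, is_derive x (1 : R) F (F' x)) -> continuous F' ->
  \int[leb]_x (\1_`[a, b] x * F' x) = F b - F a.
Proof.
move=> ab dF cF'.
have E : \int[leb]_x (\1_`[a, b] x * F' x) = \int[leb]_(x in `[a, b]) F' x.
  rewrite [RHS]Rintegral_mkcond; apply: eq_Rintegral => x _.
  by rewrite patchE indicE; case: ifP => _; rewrite ?mul1r ?mul0r.
rewrite E; have [<-|ab'] := eqVneq a b.
  by rewrite subrr set_itv1 Rintegral_set1.
rewrite /Rintegral (@continuous_FTC2 _ F' F).
- by rewrite -EFinB.
- by rewrite lt_neqAle ab' ab.
- exact: continuous_subspaceT.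
- have cF x : F @ x --> F x.
    by apply: differentiable_continuous; apply/derivable1_diffP; have [] := dF x.
  split.
  + by move=> x _; have [] := dF x.
  + by apply: cvg_at_right_filter; exact: cF.
  + by apply: cvg_at_left_filter; exact: cF.
- by move=> x _; rewrite derive1E; have [] := dF x.
Qed.

End ftc.

Section scaling.
Context d (T : measurableType d) (R : realType).
Variable mu : {measure set T -> \bar R}.

(** The extended integral is infinite, the case of two infinite parts included, and [fine] sends it
    to 0. Thanks to this default value scalars factor out of integrals of merely measurable
    functions ([intZ_meas]). *)
Lemma int_not_Lone (f : T -> R) : measurable_fun setT f -> ~ Lone mu f ->
  \int[mu]_x f x = 0.
Proof.
move=> mf nf; rewrite /Rintegral integralE.
have mF : measurable_fun setT (EFin \o f) by exact/measurable_EFinP.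
have p0 : (0 <= \int[mu]_x (EFin \o f)^\+ x)%E by apply: integral_ge0.
have n0 : (0 <= \int[mu]_x (EFin \o f)^\- x)%E by apply: integral_ge0.
have [|pfin] := eqVneq (\int[mu]_x (EFin \o f)^\+ x)%E +oo%E.
  by move=> ->; case: (\int[mu]_x (EFin \o f)^\- x)%E n0 => // [s| |].
have [|nfin] := eqVneq (\int[mu]_x (EFin \o f)^\- x)%E +oo%E.
  by move=> ->; case: (\int[mu]_x (EFin \o f)^\+ x)%E p0 => // [s| |].
case: nf; apply/integrableP; split => //.
rewrite (_ : (\int[mu]_x _)%E =
  (\int[mu]_x ((EFin \o f)^\+ x + (EFin \o f)^\- x))%E); last first.
  by apply: eq_integral => x _; exact: (congr1 (fun h => h x) (fune_abse (EFin \o f))).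
rewrite ge0_integralD//; [|exact: measurable_funepos|exact: measurable_funeneg].
by rewrite lte_add_pinfty// ltey.
Qed.

Lemma intZ_meas (k : R) (f : T -> R) : measurable_fun setT f ->
  \int[mu]_x (k * f x) = k * \int[mu]_x f x.
Proof.
move=> mf; have [->|k0] := eqVneq k 0.
  by under eq_Rintegral do rewrite mul0r; rewrite int0 mul0r.
have [lf|nf] := pselect (Lone mu f); first exact: intZ.
rewrite (int_not_Lone mf nf) mulr0; apply: int_not_Lone.
  exact: measurable_funM.
move=> /(LoneZ k^-1); under eq_fun do rewrite mulKf//.
exact: nf.
Qed.

End scaling.

Lemma indic_itvcc (R : realType) (a b s : R) :
  \1_`[a, b] s = (a <= s <= b)%R%:R :> R.
Proof. by rewrite indicE mem_setE in_itv. Qed.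

(** * From weak derivatives to increments along a flow *)

Section flow_duality.
Context d (T : measurableType d) (R : realType).
Variable mu : {sigma_finite_measure set T -> \bar R}.
Notation leb := (@lebesgue_measure R).
Variables (A : R -> T -> T) (f g phi dphi : T -> R) (r M : R).
Hypotheses (mA : measurable_fun setT (fun z : R * T => A z.1 z.2))
  (pA : forall s, preserves mu (A s))
  (AK : forall s w, A (- s) (A s w) = w)
  (lf : Lone mu f) (lg : Lone mu g)
  (mphi : measurable_fun setT phi) (bphi : forall w, `|phi w| <= M)
  (mdphi : measurable_fun setT dphi) (bdphi : forall w, `|dphi w| <= M)
  (weak : forall s, 0 <= s <= r ->
     \int[mu]_w (f w * dphi (A (- s) w)) = - \int[mu]_w (g w * phi (A (- s) w)))
  (ftc : forall w, \int[leb]_s (\1_`[0, r] s * dphi (A (- s) w)) =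
     phi w - phi (A (- r) w)).

Let mA1 s : measurable_fun setT (A s). Proof. by have [] := pA s. Qed.

Let mA2 : measurable_fun setT (fun z : R * T => A (- z.1) z.2).
Proof.
rewrite [X in measurable_fun _ X](_ : _ =
  (fun z : R * T => A z.1 z.2) \o (fun z : R * T => (- z.1, z.2)))//.
apply: measurableT_comp => //; apply: measurable_fun_pair => //.
exact: measurableT_comp.
Qed.

Let lchi : Lone leb \1_`[0, r]. Proof. exact: Lone_indic_itv. Qed.

Lemma flow_kernel_Lone :
  Lone (sfprod leb mu) (fun z => \1_`[0, r] z.1 * g (A z.1 z.2)).
Proof. exact: (@Lone_flow _ _ _ mu _ (fun z => A z.1 z.2)). Qed.

Lemma flow_average_Lone :
  Lone mu (fun w => \int[leb]_s (\1_`[0, r] s * g (A s w))).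
Proof. exact: (Lone_fubini2 flow_kernel_Lone). Qed.

(** Preservation of measure moves [A r] and [A s] from f and g to phi. By Fubini and [weak] the
    g-term becomes the integral of f against the time integral of [dphi], which [ftc] evaluates as
    phi w - phi (A (- r) w); this cancels the f-terms. *)
Lemma flow_duality : \int[mu]_w ((f (A r w) - f w -
  \int[leb]_s (\1_`[0, r] s * g (A s w))) * phi w) = 0.
Proof.
have lfr : Lone mu (fun w => f (A r w)) by exact: preserves_Lone.
have lk := flow_kernel_Lone.
have lI := Lone_fubini2 lk; rewrite /= in lI.
have L1 : Lone mu (fun w => f (A r w) * phi w) by exact: (LoneM mphi bphi).
have L2 : Lone mu (fun w => f w * phi w) by exact: (LoneM mphi bphi).
have L3 : Lone mu (fun w => (\int[leb]_s (\1_`[0, r] s * g (A s w))) * phi w).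
  exact: (LoneM mphi bphi).
transitivity (\int[mu]_w ((f (A r w) * phi w - f w * phi w) -
   (\int[leb]_s (\1_`[0, r] s * g (A s w))) * phi w)).
  by apply: eq_Rintegral => w _; rewrite !mulrBl.
rewrite intB//; last exact: LoneB.
rewrite intB//.
have mphis s : measurable_fun setT (fun w => phi (A (- s) w)).
  exact: measurableT_comp.
have L4 : Lone mu (fun w => f w * phi (A (- r) w)).
  by apply: (@LoneM _ _ _ _ _ _ M) => //.
have -> : \int[mu]_w (f (A r w) * phi w) = \int[mu]_w (f w * phi (A (- r) w)).
  rewrite -(preserves_int (pA r) L4); apply: eq_Rintegral => w _.
  by rewrite AK.
have lgp : Lone (sfprod leb mu)
    (fun z => (\1_`[0, r] z.1 * g (A z.1 z.2)) * phi z.2).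
  by apply: (@LoneM _ _ _ _ _ _ M) => //; exact: measurableT_comp.
have lfd : Lone (sfprod leb mu)
    (fun z => (\1_`[0, r] z.1 * f z.2) * dphi (A (- z.1) z.2)).
  apply: (@LoneM _ _ _ _ _ _ M) => //; first exact: measurableT_comp.
  apply: (@Lone_flow _ _ _ mu _ snd) => // s.
  exact: preserves_id.
have -> : \int[mu]_w (\int[leb]_s (\1_`[0, r] s * g (A s w)) * phi w) =
    \int[leb]_s (- (\int[mu]_w (\1_`[0, r] s * f w * dphi (A (- s) w)))).
  transitivity (\int[mu]_w \int[leb]_s ((\1_`[0, r] s * g (A s w)) * phi w)).
    apply: eq_Rintegral => w _; rewrite mulrC -intZ_meas.
      by apply: eq_Rintegral => s _; rewrite mulrC.
    exact: (measurable_fun_pair1 w (Lone_meas lk)).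
  rewrite (int_fubini2 lgp) -(int_fubini1 lgp)/=; apply: eq_Rintegral => s _.
  rewrite indic_itvcc.
  case: (boolP ((0 : R) <= s <= r)) => sr /=.
    transitivity (\int[mu]_w (g w * phi (A (- s) w))).
      have L5 : Lone mu (fun w => g w * phi (A (- s) w)).
        by apply: (@LoneM _ _ _ _ _ _ M) => //.
      rewrite -(preserves_int (pA s) L5); apply: eq_Rintegral => w _.
      by rewrite AK mul1r.
    apply/eqP; rewrite -eqr_oppLR -weak//.
    by apply/eqP; apply: eq_Rintegral => w _; rewrite mul1r.
  under eq_Rintegral do rewrite !mul0r; under [in RHS]eq_Rintegral do rewrite !mul0r.
  by rewrite int0 oppr0.
rewrite intN; last exact: (Lone_fubini1 lfd).
rewrite (int_fubini1 lfd) -(int_fubini2 lfd)/= opprK.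
have -> : \int[mu]_w (\int[leb]_s (\1_`[0, r] s * f w * dphi (A (- s) w))) =
    \int[mu]_w (f w * phi w - f w * phi (A (- r) w)).
  apply: eq_Rintegral => w _; rewrite -mulrBr -ftc -intZ_meas.
    by apply: eq_Rintegral => s _; ring.
  apply: measurable_funM; first exact: measurable_indic.
  apply: (measurableT_comp mdphi); exact: (measurable_fun_pair1 w mA2).
by rewrite intB//; ring.
Qed.

End flow_duality.

Lemma cvg_to_pair (T : Type) (F : set_system T) (U V : topologicalType)
    (f : T -> U) (g : T -> V) (a : U) (b : V) : Filter F ->
  f x @[x --> F] --> a -> g x @[x --> F] --> b ->
  (f x, g x) @[x --> F] --> (a, b).
Proof. by move=> FF fa gb; exact: cvg_pair fa gb. Qed.

Lemma lmod_shuffle (R : comRingType) (V : lmodType R) (k r l : R)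
    (x D v b c : V) :
  x + k *: b + r *: (D + l *: (v + k *: c)) =
  x + r *: (D + l *: v) + k *: (b + (r * l) *: c).
Proof.
rewrite !scalerDr !scalerA -!addrA [k * _]mulrC; congr (_ + _).
exact: etrans (addrCA _ _ _) (congr1 _ (addrCA _ _ _)).
Qed.

Section affine_flow.
Context {R : realType}.
Notation W := (txv R).
Notation mu := (@leb7 R).
Notation leb := (@lebesgue_measure R).
Variables (d : W) (lambda : R).
Hypothesis hd : lambda *: d.2 = 0.
Notation X := (afield d lambda).
Notation A := (aflow d lambda).

Lemma afield_flow r w : X (A r w) = X w.
Proof.
rewrite /aflow /afield/= scalerDr [lambda *: (r *: d.2)]scalerA [lambda * r]mulrC.
by rewrite -[(r * lambda) *: d.2]scalerA hd scaler0 addr0.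
Qed.

Lemma aflowD r s w : A r (A s w) = A (r + s) w.
Proof. by rewrite {1}/aflow afield_flow /aflow scalerDl addrA addrAC. Qed.

Lemma aflow0 w : A 0 w = w. Proof. by rewrite /aflow scale0r addr0. Qed.

Lemma aflowK r w : A (- r) (A r w) = w.
Proof. by rewrite aflowD addNr aflow0. Qed.

Lemma aflowNK r w : A r (A (- r) w) = w.
Proof. by rewrite aflowD subrr aflow0. Qed.

Lemma continuous_afield : continuous X.
Proof.
move=> w; apply: cvg_to_pair; last exact: cvg_cst.
apply: cvg_to_pair; first exact: cvg_cst.
apply: cvgD; first exact: cvg_cst.
by apply: cvgZl_tmp; exact: cvg_snd.
Qed.

Lemma continuous_aflow : continuous (fun z : R * W => A z.1 z.2).
Proof.
move=> z; apply: cvgD; first exact: cvg_snd.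
apply: cvgZ; first exact: cvg_fst.
by apply: continuous_comp; [exact: cvg_snd|exact: continuous_afield].
Qed.

Lemma continuous_aflow2 r : continuous (A r).
Proof.
move=> w; apply: cvgD; first exact: cvg_id.
by apply: cvgZl_tmp; exact: continuous_afield.
Qed.

Lemma preserves_aflow r : preserves mu (A r).
Proof.
have := @preserves_shear R (fun=> r * d.1.1) (fun v => r *: (d.1.2 + lambda *: v))
  (fun v => v + r *: d.2) (measurable_cst _) _ (preserves_shift3 _).
apply; apply: measurable_fun_scaleR3 => //; apply: measurable_fun_addR3 => //.
exact: measurable_fun_scaleR3.
Qed.

Lemma measurable_aflow : measurable_fun setT (fun z : R * W => A z.1 z.2).
Proof.
have mz (T := (R * W)%type) : [/\ measurable_fun setT (fun z : T => z.2.1.1),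
   measurable_fun setT (fun z : T => z.2.1.2) & measurable_fun setT (fun z : T => z.2.2)].
  split; do ?[apply: measurableT_comp => //].
have [m1 m2 m3] := mz.
apply: measurable_fun_pair; last first.
  by apply: measurable_fun_addR3 => //; exact: measurable_fun_scaleR3.
apply: measurable_fun_pair.
  by apply: measurable_funD => //; exact: measurable_funM.
apply: measurable_fun_addR3 => //; apply: measurable_fun_scaleR3 => //.
by apply: measurable_fun_addR3 => //; exact: measurable_fun_scaleR3.
Qed.

Lemma aflow_affine r w e k :
  A r (w + k *: e) = A r w + k *: (e.1.1, e.1.2 + (r * lambda) *: e.2, e.2).
Proof.
case: w => [[t x] v]; case: e => [[a b] c]; rewrite /aflow /afield/=.
apply: injective_projections; last exact: addrAC.
apply: injective_projections; first exact: addrAC.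
exact: lmod_shuffle.
Qed.

Lemma compact_flow_image (r : R) K : compact K ->
  compact ((fun z : R * W => A z.1 z.2) @` (`[0, r]%classic `*` K)).
Proof.
move=> cK; apply: continuous_compact.
  exact: (continuous_subspaceT continuous_aflow).
by apply: compact_setX => //; exact: segment_compact.
Qed.

Definition flow_domain (U : set W) (r : R) : set W :=
  [set w | forall s, 0 <= s <= r -> U (A s w)].

(** The tube lemma: [0, r] is compact and the flow jointly continuous. *)
Lemma open_flow_domain U r : open U -> open (flow_domain U r).
Proof.
move=> oU; rewrite openE => w Hw.
have cov := (@compact_near_coveringP _ `[0, r]%classic).1 (@segment_compact _ 0 r)
  W (nbhs w) (fun w' s => U (A s w')) _.
have H : nbhs w (fun w' => `[0, r]%classic `<=` (fun s => U (A s w'))).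
  apply: cov => s; rewrite /= in_itv/= => s0r.
  have Us : nbhs (A s w) U by apply: open_nbhs_nbhs; split => //; exact: Hw.
  have [[P Q] /= [sP wQ] PQ] := @continuous_aflow (s, w) U Us.
  by exists (P, Q).
apply: filterS H => w' Hw' s s0r; apply: Hw'; by rewrite /= in_itv.
Qed.

Lemma flow_image_sub U r K : K `<=` flow_domain U r ->
  (fun z : R * W => A z.1 z.2) @` (`[0, r]%classic `*` K) `<=` U.
Proof.
by move=> KU _ [[s w] [/= + Kw] <-]; rewrite in_itv/=; exact: KU.
Qed.

(** [aflow] is affine, and its linear part fixes the value of the field, which is constant along the
    flow; hence derivation along the field commutes with the flow. *)
Lemma derive_flow (phi : W -> R) r w : smooth phi ->
  'D_(X w) (fun w => phi (A r w)) w = 'D_(X (A r w)) phi (A r w).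
Proof.
move=> sphi.
have [||_ ->] := @is_derive_affine _ _ _ phi (A r) (X w) (X w) w.
- move=> k; rewrite aflow_affine /=; congr (_ + k *: _).
  by rewrite -scalerA hd scaler0 addr0.
- exact: smooth_derivable.
- by rewrite afield_flow.
Qed.

Lemma test_function_flow U r s phi : 0 <= s <= r ->
  test_function (flow_domain U r) phi ->
  test_function U (fun w => phi (A (- s) w)).
Proof.
move=> /andP[s0 sr] [sphi [K [cK KU phi0]]]; split.
  apply: (smooth_affine _ (fun w e k => aflow_affine (- s) w e k)) => //.
  exact: continuous_aflow2.
exists (A s @` K); split.
- by apply: continuous_compact => //; exact: (continuous_subspaceT (@continuous_aflow2 s)).
- by move=> _ [w Kw <-]; apply: (KU w Kw); rewrite s0.
- move=> w nK; apply: phi0 => KA; apply: nK; exists (A (- s) w) => //.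
  exact: aflowNK.
Qed.

End affine_flow.

Section dot7_integrable.
Context {R : realType}.

Lemma measurable_coord3 i : measurable_fun setT (fun x : R3 R => coord3 x i).
Proof.
case: i => [[|[|[|]]]] //= ?; rewrite /coord3 /=.
- by apply: measurableT_comp.
- by apply: measurableT_comp.
- exact: measurable_snd.
Qed.

(** Integrability of the gradient is known only through its pairings with the coordinate directions,
    so [dot7] is expanded along them; the coefficients are bounded on D and cut off outside. *)
Lemma Lone_dot7 d (T : measurableType d) (mu : {measure set T -> \bar R})
    (D : set T) (P Y : T -> txv R) (M : R) :
  measurable D -> measurable_fun setT Y ->
  (forall z, D z -> [/\ `|(Y z).1.1| <= M, forall i, `|coord3 (Y z).1.2 i| <= M &
     forall i, `|coord3 (Y z).2 i| <= M]) ->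
  (forall e, ([set et R] `|` @xv_dir R) e -> Lone mu ((fun z => dot7 (P z) e) \_ D)) ->
  Lone mu ((fun z => dot7 (P z) (Y z)) \_ D).
Proof.
move=> mD /measurable_fun_pairP[/measurable_fun_pairP[m1 m2] m3] bY lP.
have lt := lP _ (or_introl erefl).
have lx i := lP (ex R i) (or_intror (ex_intro _ i (or_introl erefl))).
have lv i := lP (ev R i) (or_intror (ex_intro _ i (or_intror erefl))).
have K (c : T -> R) e : measurable_fun setT c -> (forall z, D z -> `|c z| <= M) ->
    Lone mu ((fun z => dot7 (P z) e) \_ D) ->
    Lone mu ((fun z => c z * dot7 (P z) e) \_ D).
  move=> mc bc le.
  have -> : (fun z => c z * dot7 (P z) e) \_ D =
      (fun z => ((fun z => dot7 (P z) e) \_ D) z * (c \_ D) z).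
    by apply/funext => z; rewrite !patchE; case: ifP; rewrite ?mulr0// mulrC.
  apply: (@LoneM _ _ _ _ _ _ `|M|) => //.
    apply/(measurable_restrictT c mD); exact: measurable_funTS mc.
  move=> z; rewrite patchE; case: ifPn => [/set_mem Dz|_]; last by rewrite normr0.
  by apply: le_trans (bc z Dz) _; rewrite ler_norm.
have kt := K _ _ m1 (fun z Dz => let: And3 a _ _ := bY z Dz in a) lt.
have mx i : measurable_fun setT (fun z => coord3 (Y z).1.2 i).
  exact: (measurableT_comp (measurable_coord3 i) m2).
have mv i : measurable_fun setT (fun z => coord3 (Y z).2 i).
  exact: (measurableT_comp (measurable_coord3 i) m3).
have kx i := K _ _ (mx i) (fun z Dz => let: And3 _ a _ := bY z Dz in a i) (lx i).
have kv i := K _ _ (mv i) (fun z Dz => let: And3 _ _ a := bY z Dz in a i) (lv i).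
have [l1 _] := int_sum kx; have [l2 _] := int_sum kv.
have -> : (fun z => dot7 (P z) (Y z)) \_ D = (fun z =>
   ((fun z => (Y z).1.1 * dot7 (P z) (et R)) \_ D) z +
   \sum_(i < 3) ((fun z => coord3 (Y z).1.2 i * dot7 (P z) (ex R i)) \_ D) z +
   \sum_(i < 3) ((fun z => coord3 (Y z).2 i * dot7 (P z) (ev R i)) \_ D) z).
  apply/funext => z; have E h : (h \_ D) z = (\1_D z : R) * h z.
    by rewrite patchE indicE; case: ifP => _; rewrite ?mul1r ?mul0r.
  under eq_bigr do rewrite E; under [X in _ = _ + X]eq_bigr do rewrite E.
  by rewrite !E dot7_sum 2!mulrDr !mulr_sumr.
by apply: LoneD => //; exact: LoneD.
Qed.

End dot7_integrable.

Section flow_identity.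
Context {R : realType}.
Notation W := (txv R).
Notation mu := (@leb7 R).
Notation leb := (@lebesgue_measure R).
Variables (U : set W) (f : W -> R) (Df : W -> W).
Hypotheses (oU : open U) (Hg : distr_grad U f Df).
Variables (d : W) (lambda : R).
Hypothesis hd : lambda *: d.2 = 0.
Notation X := (afield d lambda).
Notation A := (aflow d lambda).
Notation fb := (f \_ U).
Notation gb := ((fun w => dot7 (Df w) (X w)) \_ U).

Lemma locint_grad e : ([set et R] `|` @xv_dir R) e ->
  locint U fb /\ locint U ((fun w => dot7 (Df w) e) \_ U).
Proof. by move=> /Hg /(distr_deriv_patch oU)[]. Qed.

Lemma locint_f : locint U fb.
Proof. by have [] := locint_grad (or_introl erefl). Qed.

Lemma patch_sub (h : W -> R) K : K `<=` U -> (h \_ U) \_ K = h \_ K.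
Proof.
move=> KU; apply/funext => w; rewrite !patchE; case: ifPn => // /set_mem/KU Uw.
by rewrite mem_set.
Qed.

Lemma bounded_afield K : compact K -> exists M, forall w, K w ->
  [/\ `|(X w).1.1| <= M, forall i, `|coord3 (X w).1.2 i| <= M &
      forall i, `|coord3 (X w).2 i| <= M].
Proof.
move=> cK.
have /choice[M2 H2] : forall i : 'I_3, exists M, forall w, K w ->
    `|coord3 (X w).1.2 i| <= M.
  move=> i; apply: compact_bounded => //; apply: continuous_subspaceT.
  exact: continuous_afield_coord.
exists (`|d.1.1| + \sum_i `|M2 i| + \sum_i `|coord3 d.2 i|) => w Kw.
have S0 (c : 'I_3 -> R) : 0 <= \sum_i `|c i| by apply: sumr_ge0.
have S1 (c : 'I_3 -> R) i : `|c i| <= \sum_i `|c i|.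
  by rewrite (bigD1 i)//= lerDl; apply: sumr_ge0.
have a0 := S0 M2; have b0 := S0 (coord3 d.2); have t0 := normr_ge0 d.1.1.
split => [|i|i] /=.
- by rewrite -addrA lerDl addr_ge0.
- apply: le_trans (H2 i w Kw) _; apply: le_trans (ler_norm _) _.
  have := S1 M2 i; lra.
- have := S1 (coord3 d.2) i; lra.
Qed.

Lemma locint_g : locint U gb.
Proof.
move=> K cK KU; rewrite patch_sub//.
have [M HM] := bounded_afield cK.
apply: (@Lone_dot7 _ _ _ mu K Df X M).
- exact: compact_measurable7.
- apply: measurable_fun_pair; last exact: measurable_cst.
  apply: measurable_fun_pair; first exact: measurable_cst.
  apply: measurable_fun_addR3; first exact: measurable_cst.
  by apply: measurable_fun_scaleR3; [exact: measurable_cst|exact: measurable_snd].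
- exact: HM.
- by move=> e /locint_grad[_ /(_ K cK KU)]; rewrite patch_sub.
Qed.

Definition dflow (phi : W -> R) (w : W) : R := 'D_(X w) phi w.

(** The coefficients of this derivation depend on the point; the divergence form of [derive_afield]
    displays it as a sum of smooth functions. *)
Lemma test_function_dflow V phi : open V -> test_function V phi ->
  test_function V (dflow phi).
Proof.
move=> oV tphi; have sphi := test_function_smooth tphi.
have [_ [K [cK KV phi0]]] := tphi.
have oK : open (~` K).
  by apply: closed_openC; apply: compact_closed => //; exact: norm_hausdorff.
split; last first.
  exists K; split => // w nKw; rewrite /dflow.
  rewrite (@near_eq_derive _ _ _ _ (cst 0)) ?derive_cst//.
  have : nbhs w (~` K) by exact: open_nbhs_nbhs.
  by apply: filterS => y /phi0 ->.
have -> : dflow phi = fun w => d.1.1 * 'D_(et R) phi w +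
    \sum_(i < 3) 'D_(ex R i) (fun w => coord3 (afield d lambda w).1.2 i * phi w) w +
    \sum_(i < 3) coord3 d.2 i * 'D_(ev R i) phi w.
  by apply/funext => w; exact: derive_afield.
apply: smoothD; last by apply: smooth_sum => i; apply: smoothZ; exact: smooth_derive.
apply: smoothD; first by apply: smoothZ; exact: smooth_derive.
apply: smooth_sum => i; apply: smooth_derive; apply: smoothM => //.
exact: smooth_afield_coord.
Qed.

Lemma weak_flow r s phi : 0 <= s <= r ->
  test_function (flow_domain d lambda U r) phi ->
  \int[mu]_w (fb w * dflow phi (A (- s) w)) =
  - \int[mu]_w (gb w * phi (A (- s) w)).
Proof.
move=> sr tphi; have sphi := test_function_smooth tphi.
rewrite -(weak_afield d lambda oU Hg (test_function_flow hd sr tphi)).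
by apply: eq_Rintegral => w _; rewrite derive_flow.
Qed.

End flow_identity.

Section flow_ae.
Context {R : realType}.
Notation W := (txv R).
Notation mu := (@leb7 R).
Notation leb := (@lebesgue_measure R).
Variables (U : set W) (f : W -> R) (Df : W -> W).
Hypotheses (oU : open U) (Hg : distr_grad U f Df).
Variables (d : W) (lambda : R).
Hypothesis hd : lambda *: d.2 = 0.
Notation X := (afield d lambda).
Notation A := (aflow d lambda).
Notation fb := (f \_ U).
Notation gb := ((fun w => dot7 (Df w) (X w)) \_ U).

Let defect (r : R) w := fb (A r w) - fb w -
  \int[leb]_s (\1_`[0, r] s * gb (A s w)).

Let flow_image (r : R) K := (fun z : R * W => A z.1 z.2) @` (`[0, r]%classic `*` K).

(** f and g are only locally integrable in U, but the flow of a compact part of the flow domain up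
    to time r sweeps a compact subset of U; cutting both functions there makes [flow_duality]
    applicable. *)
Let defect_cut r K w : 0 <= r -> K w -> defect r w =
  (fb \_ (flow_image r K)) (A r w) - (fb \_ (flow_image r K)) w -
  \int[leb]_s (\1_`[0, r] s * (gb \_ (flow_image r K)) (A s w)).
Proof.
move=> r0 Kw.
have P (h : W -> R) s : 0 <= s <= r -> (h \_ (flow_image r K)) (A s w) = h (A s w).
  by move=> sr; rewrite patchE mem_set//; exists (s, w).
have P0 (h : W -> R) : (h \_ (flow_image r K)) w = h w.
  by have := P h 0; rewrite aflow0; apply; rewrite lexx.
rewrite P0 P ?r0 ?lexx//; congr (_ - _); apply: eq_Rintegral => s _.
rewrite indic_itvcc; case: (boolP ((0 : R) <= s <= r)) => sr; last by rewrite !mul0r.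
by rewrite P.
Qed.

Let Lone_image (h : W -> R) r K : locint U h -> compact K ->
  K `<=` flow_domain d lambda U r -> Lone mu (h \_ (flow_image r K)).
Proof.
move=> lh cK KU; apply: lh; first exact: compact_flow_image.
exact: flow_image_sub.
Qed.

(** A weak derivative becomes an identity between values: for each r the defect is orthogonal to all
    test functions of the flow domain by [flow_duality], and [vanishing_of_test] applies. The
    exceptional null set depends on r. *)
Lemma flow_ae r : 0 <= r -> {ae mu, forall w, flow_domain d lambda U r w ->
  fb (A r w) - fb w = \int[leb]_s (\1_`[0, r] s * gb (A s w))}.
Proof.
move=> r0; suff : {ae mu, forall w, flow_domain d lambda U r w -> defect r w = 0}.
  by apply: ae_imp => w Hw /Hw /eqP; rewrite subr_eq0 => /eqP.
have lf := locint_f oU Hg; have lg := locint_g oU Hg d lambda.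
have mA := measurable_aflow d lambda.
have pA := preserves_aflow d lambda.
have AK := aflowK hd.
apply: vanishing_of_test; first exact: open_flow_domain.
- move=> K cK KU.
  have l1 := Lone_image lf cK KU; have l2 := Lone_image lg cK KU.
  have -> : defect r \_ K = (fun w => (fb \_ (flow_image r K)) (A r w) -
      (fb \_ (flow_image r K)) w -
      \int[leb]_s (\1_`[0, r] s * (gb \_ (flow_image r K)) (A s w))) \_ K.
    apply/funext => w; rewrite !patchE; case: ifPn => // /set_mem Kw.
    exact: defect_cut.
  apply: Lone_patch; first exact: compact_measurable7.
  apply: LoneB; first by apply: LoneB => //; exact: (preserves_Lone (pA r)).
  exact: (@flow_average_Lone _ _ R (@leb7 R) A _ r mA pA l2).
- move=> phi tphi; have [sphi [K [cK KU phi0]]] := tphi.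
  have oV : open (flow_domain d lambda U r) by exact: open_flow_domain.
  have tdphi := test_function_dflow d lambda oV tphi.
  have [sdphi [K' [cK' K'U dphi0]]] := tdphi.
  have [M1 HM1] := compact_support_bounded cK (smooth_continuous sphi) phi0.
  have [M2 HM2] := compact_support_bounded cK' (smooth_continuous sdphi) dphi0.
  pose KK := K `|` K'.
  have cKK : compact KK by exact: compactU.
  have KKU : KK `<=` flow_domain d lambda U r by move=> w [/KU|/K'U].
  have l1 := Lone_image lf cKK KKU; have l2 := Lone_image lg cKK KKU.
  have cut (h psi : W -> R) s w : 0 <= s <= r -> (forall w, ~ KK w -> psi w = 0) ->
      (h \_ (flow_image r KK)) w * psi (A (- s) w) = h w * psi (A (- s) w).
    move=> sr psi0; have [KKw|nKKw] := pselect (KK (A (- s) w)); last first.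
      by rewrite psi0// !mulr0.
    by rewrite patchE mem_set//; exists (s, A (- s) w) => //=; rewrite aflowNK.
  have phi0' w : ~ KK w -> phi w = 0 by move=> /not_orP[/phi0].
  have dphi0' w : ~ KK w -> dflow d lambda phi w = 0 by move=> /not_orP[_ /dphi0].
  transitivity (\int[mu]_w (((fb \_ (flow_image r KK)) (A r w) -
      (fb \_ (flow_image r KK)) w -
      \int[leb]_s (\1_`[0, r] s * (gb \_ (flow_image r KK)) (A s w))) * phi w)).
    apply: eq_Rintegral => w _.
    have [KKw|/phi0' ->] := pselect (KK w); last by rewrite !mulr0.
    by rewrite (defect_cut r0 KKw).
  apply: (@flow_duality _ _ R (@leb7 R) A _ _ phi (dflow d lambda phi) r (Num.max M1 M2)) => //.
  + exact: continuous_measurable7 (smooth_continuous sphi).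
  + by move=> w; rewrite le_max HM1.
  + exact: continuous_measurable7 (smooth_continuous sdphi).
  + by move=> w; rewrite le_max HM2 orbT.
  + move=> s sr; under eq_Rintegral do rewrite (cut _ _ _ _ sr dphi0').
    under [in RHS]eq_Rintegral do rewrite (cut _ _ _ _ sr phi0').
    exact: (weak_flow oU Hg hd sr tphi).
  + move=> w.
    have D s : is_derive s (1 : R) (fun s => phi (A (- s) w)) (- dflow d lambda phi (A (- s) w)).
      have E : (fun s => phi (A (- s) w)) = (fun s => phi (w + s *: (- X w))).
        by apply/funext => t; rewrite /aflow scaleNr scalerN.
      rewrite E; apply: is_derive_line.
      have -> : w + s *: - X w = A (- s) w by rewrite /aflow scaleNr scalerN.
      have Z : derivable phi (A (- s) w) (X w) by exact: smooth_derivable.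
      have {}Z := derivable_dirZ (-1) Z; rewrite scaleN1r mulN1r in Z.
      by rewrite /dflow (afield_flow hd).
    have cD : continuous (fun s => dflow d lambda phi (A (- s) w)).
      move=> s.
      apply: (@continuous_comp _ _ _ (fun s : R => A (- s) w) (dflow d lambda phi)).
        apply: cvgD; first exact: cvg_cst.
        by apply: cvgZr_tmp; apply: cvgN; exact: cvg_id.
      exact: smooth_continuous sdphi _.
    have D' s : is_derive s (1 : R) (fun s => - phi (A (- s) w)) (dflow d lambda phi (A (- s) w)).
      by rewrite -[X in is_derive _ _ _ X]opprK; exact: is_deriveN (D s).
    by rewrite (int_indic_derive r0 D' cD) oppr0 aflow0 opprK addrC.
Qed.

End flow_ae.

(** * From increments along a flow back to integration by parts *)

Section flow_ibp.
Context d (T : measurableType d) (R : realType).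
Variable mu : {sigma_finite_measure set T -> \bar R}.
Notation leb := (@lebesgue_measure R).
Variables (A : R -> T -> T) (f g psi dpsi : T -> R) (r0 M : R).
Hypotheses (mA : measurable_fun setT (fun z : R * T => A z.1 z.2))
  (pA : forall s, preserves mu (A s))
  (AK : forall s w, A (- s) (A s w) = w)
  (lf : Lone mu f) (lg : Lone mu g) (r00 : 0 < r0)
  (mpsi : measurable_fun setT psi) (bpsi : forall w, `|psi w| <= M)
  (mdpsi : measurable_fun setT dpsi)
  (lip : forall s w, 0 <= s -> `|psi (A (- s) w) - psi w| <= M * s)
  (der : forall w, is_derive (0 : R) (1 : R) (fun s => psi (A (- s) w)) (- dpsi w))
  (flow : forall r, 0 < r <= r0 -> \int[mu]_w ((f (A r w) - f w -
     \int[leb]_s (\1_`[0, r] s * g (A s w))) * psi w) = 0).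

Hypothesis A0 : forall w, A 0 w = w.

Let mA1 s : measurable_fun setT (A s). Proof. by have [] := pA s. Qed.

Let mA2 : measurable_fun setT (fun z : R * T => A (- z.1) z.2).
Proof.
rewrite [X in measurable_fun _ X](_ : _ =
  (fun z : R * T => A z.1 z.2) \o (fun z : R * T => (- z.1, z.2)))//.
apply: measurableT_comp => //; apply: measurable_fun_pair => //.
exact: measurableT_comp.
Qed.

Let mpsis s : measurable_fun setT (fun w => psi (A (- s) w)).
Proof. exact: measurableT_comp. Qed.

Let mpsiw w : measurable_fun setT (fun s : R => psi (A (- s) w)).
Proof. apply: (measurableT_comp mpsi); exact: (measurable_fun_pair1 w mA2). Qed.

(** Fubini and preservation of measure transfer the time average from g to [psi]; g is integrated
    against this average before r -> 0. *)
Let average r w := r^-1 * \int[leb]_s (\1_`[0, r] s * psi (A (- s) w)).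

Let M0 (w : T) : 0 <= M. Proof. exact: le_trans (normr_ge0 _) (bpsi w). Qed.

Let int_indic r : 0 <= r -> \int[leb]_s (\1_`[0, r] s : R) = r.
Proof.
move=> r0'; have D (x : R) : is_derive x (1 : R) id (cst 1 x) by exact: is_derive_id.
have := int_indic_derive r0' D (fun x => cvg_cst _); rewrite subr0 => {2}<-.
by apply: eq_Rintegral => s _; rewrite mulr1.
Qed.

Let Lindic r : Lone leb (\1_`[0, r] : R -> R). Proof. exact: Lone_indic_itv. Qed.

Let Lpsi r w : Lone leb (fun s => \1_`[0, r] s * psi (A (- s) w)).
Proof.
apply: (@LoneM _ _ _ leb _ (fun s => psi (A (- s) w)) M).
- exact: mpsiw.
- by move=> s; exact: bpsi.
- exact: Lindic.
Qed.

Let average_close r w : 0 < r -> `|average r w - psi w| <= M * r.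
Proof.
move=> r1; have -> : average r w - psi w = r^-1 *
    \int[leb]_s (\1_`[0, r] s * psi (A (- s) w) - psi w * \1_`[0, r] s).
  rewrite intB//; last exact: LoneZ.
  by rewrite intZ// int_indic ?ltW// mulrBr /average mulrCA mulVf ?mulr1 ?gt_eqF.
rewrite normrM gtr0_norm ?invr_gt0// mulrC ler_pdivrMr//.
have L : Lone leb (fun s => \1_`[0, r] s * psi (A (- s) w) - psi w * \1_`[0, r] s).
  by apply: LoneB => //; exact: LoneZ.
apply: le_trans (le_norm_int L) _.
have -> : M * r * r = \int[leb]_s (M * r * \1_`[0, r] s).
  by rewrite intZ// int_indic// ltW.
apply: int_le => [||s]; [exact: Lone_norm|exact: LoneZ|].
rewrite [psi w * _]mulrC -mulrBr normrM mulrC indic_itvcc.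
case: (boolP ((0 : R) <= s <= r)) => [/andP[s0 sr]|_]; last by rewrite normr0 !mulr0.
rewrite normr1 !mulr1; apply: le_trans (lip w s0) _.
by rewrite ler_wpM2l// (M0 w).
Qed.

Let average_bound r w : 0 < r -> `|average r w| <= M.
Proof.
move=> r1; rewrite /average normrM gtr0_norm ?invr_gt0// mulrC ler_pdivrMr//.
apply: le_trans (le_norm_int (Lpsi r w)) _.
have -> : M * r = \int[leb]_s (M * \1_`[0, r] s) by rewrite intZ// int_indic// ltW.
apply: int_le => [||s]; [exact: Lone_norm|exact: LoneZ|].
rewrite normrM mulrC indic_itvcc.
by case: (boolP ((0 : R) <= s <= r)) => _; rewrite ?normr0 ?mulr0// normr1 !mulr1.
Qed.

Let lchi r : Lone (sfprod leb mu) (fun z => (\1_`[0, r] z.1 * g z.2) * psi (A (- z.1) z.2)).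
Proof.
apply: (@LoneM _ _ _ _ _ _ M) => //; first exact: measurableT_comp.
by apply: (@Lone_flow _ _ _ mu _ snd) => // s; exact: preserves_id.
Qed.

Let average_int r : 0 < r -> Lone mu (fun w => g w * average r w) /\
  \int[mu]_w (\int[leb]_s (\1_`[0, r] s * g (A s w)) * psi w) =
  r * \int[mu]_w (g w * average r w).
Proof.
move=> r1; have lgp : Lone (sfprod leb mu)
    (fun z => (\1_`[0, r] z.1 * g (A z.1 z.2)) * psi z.2).
  apply: (@LoneM _ _ _ _ _ _ M) => //; last exact: (flow_kernel_Lone r mA pA lg).
  exact: measurableT_comp.
have E w : \int[leb]_s ((\1_`[0, r] s * g w) * psi (A (- s) w)) = r * (g w * average r w).
  rewrite mulrCA /average mulVKf ?gt_eqF// -intZ//.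
  by apply: eq_Rintegral => s _; ring.
have L : Lone mu (fun w => r * (g w * average r w)).
  by have := Lone_fubini2 (lchi r); rewrite /=; under eq_fun do rewrite E.
have L' : Lone mu (fun w => g w * average r w).
  have := LoneZ r^-1 L; congr Lone; apply/funext => w.
  by rewrite mulrA mulVf ?mul1r ?gt_eqF.
split => //; rewrite -intZ//.
transitivity (\int[mu]_w \int[leb]_s ((\1_`[0, r] s * g (A s w)) * psi w)).
  apply: eq_Rintegral => w _; rewrite mulrC -intZ_meas.
    by apply: eq_Rintegral => s _; rewrite mulrC.
  exact: (measurable_fun_pair1 w (Lone_meas (flow_kernel_Lone r mA pA lg))).
under [RHS]eq_Rintegral do rewrite -E.
rewrite (int_fubini2 lgp) -(int_fubini1 lgp) (int_fubini2 (lchi r)).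
rewrite -(int_fubini1 (lchi r)); apply: eq_Rintegral => s _ /=.
have L5 : Lone mu (fun w => (\1_`[0, r] s * g w) * psi (A (- s) w)).
  by apply: (@LoneM _ _ _ _ _ _ M) => //; exact: LoneZ.
rewrite -(preserves_int (pA s) L5); apply: eq_Rintegral => w _.
by rewrite AK.
Qed.

Let quot n : R := r0 / n.+1%:R.

Let quot_gt0 n : 0 < quot n. Proof. by rewrite divr_gt0. Qed.

Let quot_le n : quot n <= r0.
Proof. by rewrite ler_pdivrMr// ler_peMr ?ler1n// ltW. Qed.

Let cvg_quot : quot n @[n --> \oo] --> (0 : R).
Proof.
rewrite -[X in _ --> X](mulr0 r0); apply: cvgM; first exact: cvg_cst.
exact: cvg_harmonic.
Qed.

Let cvg_quot_dnbhs : quot n @[n --> \oo] --> (0 : R)^'.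
Proof.
move=> P; rewrite /dnbhs /within/= => H.
have H2 : \forall n \near \oo, quot n != 0 -> P (quot n) := cvg_quot H.
suff : \forall n \near \oo, P (quot n) by [].
by apply: filterS H2 => n; apply; rewrite gt_eqF// quot_gt0.
Qed.

Let step n : \int[mu]_w (f w * ((quot n)^-1 * (psi (A (- quot n) w) - psi w))) =
  \int[mu]_w (g w * average (quot n) w).
Proof.
have q0 := quot_gt0 n; set r := quot n in q0 *.
have L1 : Lone mu (fun w => f (A r w) * psi w).
  by apply: (LoneM mpsi bpsi); exact: preserves_Lone.
have L2 : Lone mu (fun w => f w * psi w) by exact: (LoneM mpsi bpsi).
have L4 : Lone mu (fun w => f w * psi (A (- r) w)).
  by apply: (@LoneM _ _ _ _ _ _ M) => //.
have L3 : Lone mu (fun w => (\int[leb]_s (\1_`[0, r] s * g (A s w))) * psi w).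
  by apply: (LoneM mpsi bpsi); exact: (flow_average_Lone r mA pA lg).
have [L5 E5] := average_int q0.
have := @flow r; rewrite q0 quot_le => /(_ isT).
under eq_Rintegral do rewrite !mulrBl.
rewrite intB//; last exact: LoneB.
rewrite intB// E5.
have -> : \int[mu]_w (f (A r w) * psi w) = \int[mu]_w (f w * psi (A (- r) w)).
  by rewrite -(preserves_int (pA r) L4); apply: eq_Rintegral => w _; rewrite AK.
rewrite -intB// => /eqP; rewrite subr_eq0 => /eqP E.
transitivity (r^-1 * \int[mu]_w (f w * psi (A (- r) w) - f w * psi w)).
  by rewrite -intZ; [apply: eq_Rintegral => w _; ring|exact: LoneB].
by rewrite E mulrA mulVf ?mul1r// gt_eqF.
Qed.

(** The flow identity at time r, divided by r. The difference quotient of [psi] is dominated by M,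
    by the Lipschitz bound, and converges to - [dpsi]; on the other side the averages of [psi]
    converge to [psi]. Dominated convergence is applied along r = r0 / (n + 1). *)
Lemma flow_ibp : \int[mu]_w (f w * dpsi w) = - \int[mu]_w (g w * psi w).
Proof.
have [|||||Lfd C1] := @int_dct _ _ _ mu
    (fun n w => f w * ((quot n)^-1 * (psi (A (- quot n) w) - psi w)))
    (fun w => f w * (- dpsi w)) (fun w => M * `|f w|).
- move=> n; apply: measurable_funM; first exact: (Lone_meas lf).
  by apply: measurable_funM => //; exact: measurable_funB.
- apply: measurable_funM; first exact: (Lone_meas lf).
  exact: measurableT_comp.
- apply: aeW => w; apply: cvgM; first exact: cvg_cst.
  have /is_derive1_cvgP H := der w.
  have := cvg_comp _ _ cvg_quot_dnbhs H.
  by under eq_fun do rewrite /= add0r oppr0 A0.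
- exact/LoneZ/Lone_norm.
- move=> n w; rewrite normrM mulrC ler_wpM2r// normrM gtr0_norm ?invr_gt0//.
  by rewrite mulrC ler_pdivrMr//; apply: lip; exact: ltW.
have [|||||_ C2] := @int_dct _ _ _ mu
    (fun n w => g w * average (quot n) w) (fun w => g w * psi w) (fun w => M * `|g w|).
- move=> n; exact: Lone_meas (average_int (quot_gt0 n)).1.
- by apply: measurable_funM => //; exact: (Lone_meas lg).
- apply: aeW => w; apply: cvgM; first exact: cvg_cst.
  apply/cvgrPdist_le => e e0; near=> n.
  rewrite distrC; apply: le_trans (average_close _ (quot_gt0 n)) _.
  have : `|M * quot n| <= e.
    near: n; have : M * quot n @[n --> \oo] --> M * (0 : R).
      by apply: cvgM; [exact: cvg_cst|exact: cvg_quot].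
    by rewrite mulr0 => /cvgr0Pnorm_le /(_ e e0).
  exact: le_trans (ler_norm _).
- exact/LoneZ/Lone_norm.
- by move=> n w; rewrite normrM mulrC ler_wpM2r// average_bound.
have E : \int[mu]_w (f w * - dpsi w) = \int[mu]_w (g w * psi w).
  have C3 : \int[mu]_w (f w * ((quot n)^-1 * (psi (A (- quot n) w) - psi w)))
      @[n --> \oo] --> \int[mu]_w (g w * psi w).
    by under eq_cvg do rewrite step; exact: C2.
  exact: (cvg_unique (@Rhausdorff R) C1 C3).
rewrite -E -intN//; apply: eq_Rintegral => w _.
by rewrite mulrN opprK.
Unshelve. all: by end_near. Qed.

End flow_ibp.

Section directional_ibp.
Context {R : realType}.
Notation W := (txv R).
Notation mu := (@leb7 R).
Notation leb := (@lebesgue_measure R).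
Variables (U : set W) (f : W -> R) (Df : W -> W).
Hypotheses (oU : open U) (Hg : distr_grad U f Df).
Variable d : W.
Notation A := (aflow d 0).
Notation fb := (f \_ U).
Notation gb := ((fun w => dot7 (Df w) (afield d 0 w)) \_ U).

Lemma afield0 w : afield d 0 w = d.
Proof. by rewrite /afield scale0r addr0; case: d => [[]]. Qed.

Let hd : 0 *: d.2 = 0. Proof. by rewrite scale0r. Qed.

Lemma compact_flow_domain K : compact K -> K `<=` U ->
  exists2 r : R, 0 < r & K `<=` flow_domain d 0 U r.
Proof.
move=> cK KU.
have cov := (@compact_near_coveringP _ K).1 cK R (nbhs (0 : R)) (fun s w => U (A s w)) _.
have H : nbhs (0 : R) (fun s => K `<=` (fun w => U (A s w))).
  apply: cov => w Kw.
  have Uw : nbhs (A 0 w) U by apply: open_nbhs_nbhs; split => //; rewrite aflow0; exact: KU.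
  have [[P Q] /= [sP wQ] PQ] := @continuous_aflow R d 0 (0, w) U Uw.
  by exists (Q, P) => //= -[a b] [Qa Pb]; apply: (PQ (b, a)).
move/nbhs_ballP : H => [e /= e0 He]; exists (e / 2); first by rewrite divr_gt0.
move=> w Kw s /andP[s0 se]; apply: He => //.
rewrite /ball/= sub0r normrN ger0_norm//; apply: le_lt_trans se _.
by rewrite ltr_pdivrMr// ltr_pMr// ltr1n.
Qed.

Variables (psi dpsi : W -> R) (K : set W) (M : R).
Hypotheses (cK : compact K) (KU : K `<=` U)
  (psi0 : forall w, ~ K w -> psi w = 0)
  (mpsi : measurable_fun setT psi) (mdpsi : measurable_fun setT dpsi)
  (bpsi : forall w, `|psi w| <= M) (bdpsi : forall w, `|dpsi w| <= M)
  (der : forall w, is_derive w d psi (dpsi w)).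

Let dpsi0 w : ~ K w -> dpsi w = 0.
Proof.
move=> nKw; have [_ <-] := der w.
have oK : open (~` K).
  by apply: closed_openC; apply: compact_closed => //; exact: norm_hausdorff.
rewrite (@near_eq_derive _ _ _ _ (cst 0)) ?derive_cst//.
have : nbhs w (~` K) by exact: open_nbhs_nbhs.
by apply: filterS => y /psi0 ->.
Qed.

Let derline w s : is_derive s (1 : R) (fun s => psi (A (- s) w)) (- dpsi (A (- s) w)).
Proof.
have E : (fun s => psi (A (- s) w)) = (fun s => psi (w + s *: (- d))).
  by apply/funext => t; rewrite /aflow afield0 scaleNr scalerN.
rewrite E; apply: is_derive_line.
have -> : w + s *: - d = A (- s) w by rewrite /aflow afield0 scaleNr scalerN.
have [Z <-] := der (A (- s) w).
by have {}Z := derivable_dirZ (-1) Z; rewrite scaleN1r mulN1r in Z.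
Qed.

(** The test is differentiable in the direction d only, with bounded measurable derivative, so
    cutoffs built from exit times, known only to be C^1, qualify. The mean value theorem gives the
    Lipschitz bound along the flow and [flow_ae] the flow identity, for r so small that K stays in
    U. *)
Lemma directional_ibp :
  \int[mu]_w (fb w * dpsi w) =
  - \int[mu]_w (((fun w => dot7 (Df w) d) \_ U) w * psi w).
Proof.
have [r0 r00 Kr] := compact_flow_domain cK KU.
have pA := preserves_aflow d 0; have AK := aflowK hd.
have mA := measurable_aflow d (0 : R).
set K2 := (fun z : R * W => A z.1 z.2) @` (`[0, r0]%classic `*` K).
have cK2 : compact K2 by exact: compact_flow_image.
have K2U : K2 `<=` U by exact: flow_image_sub.
have K2in s w : 0 <= s <= r0 -> K w -> K2 (A s w) by move=> sr Kw; exists (s, w).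
have lf := locint_f oU Hg cK2 K2U; have lg := locint_g oU Hg d (0 : R) cK2 K2U.
have P (h : W -> R) s w : 0 <= s <= r0 -> K w -> (h \_ K2) (A s w) = h (A s w).
  by move=> sr Kw; rewrite patchE mem_set//; exact: K2in.
have P0 (h : W -> R) w : K w -> (h \_ K2) w = h w.
  by move=> Kw; have := P h 0 w; rewrite aflow0; apply => //; rewrite lexx ltW.
have M0 : 0 <= M by exact: le_trans (normr_ge0 _) (bpsi 0).
have := @flow_ibp _ _ R (@leb7 R) A (fb \_ K2) (gb \_ K2) psi dpsi r0 M mA pA AK
  lf lg r00 mpsi bpsi mdpsi _ _ _ (@aflow0 R d 0).
have E1 : \int[mu]_w ((fb \_ K2) w * dpsi w) = \int[mu]_w (fb w * dpsi w).
  apply: eq_Rintegral => w _; have [Kw|/dpsi0 ->] := pselect (K w).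
    by rewrite P0.
  by rewrite !mulr0.
have E2 : \int[mu]_w ((gb \_ K2) w * psi w) =
    \int[mu]_w (((fun w => dot7 (Df w) d) \_ U) w * psi w).
  apply: eq_Rintegral => w _; have [Kw|/psi0 ->] := pselect (K w).
    by rewrite P0// !patchE afield0.
  by rewrite !mulr0.
rewrite E1 E2; apply.
- move=> s w s0; have [c [_]] := MVT_line s (derline w).
  rewrite oppr0 aflow0 => ->; rewrite normrM normrN (ger0_norm s0) mulrC.
  by rewrite ler_wpM2r.
- by move=> w; have := derline w 0; rewrite oppr0 aflow0.
- move=> r /andP[r1 rr0].
  transitivity (\int[mu]_w (0 : R)); last exact: int0.
  have mF : measurable_fun setT (fun w => ((fb \_ K2) (A r w) - (fb \_ K2) w -
     \int[leb]_s (\1_`[0, r] s * (gb \_ K2) (A s w))) * psi w).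
    apply: measurable_funM => //; apply: measurable_funB.
      apply: measurable_funB; last exact: (Lone_meas lf).
      exact: (Lone_meas (preserves_Lone (pA r) lf)).
    exact: (Lone_meas (@flow_average_Lone _ _ R (@leb7 R) A _ r mA pA lg)).
  apply: ae_eq_int => //.
  have := flow_ae oU Hg hd (ltW r1); apply: ae_imp => w Hw.
  have [Kw|/psi0 ->] := pselect (K w); last by rewrite mulr0.
  have Hr : flow_domain d 0 U r w.
    by move=> s /andP[s0 sr]; apply: Kr => //; rewrite s0 (le_trans sr).
  have rr : 0 <= r <= r0 by rewrite ltW.
  rewrite (P fb r w rr Kw) (P0 fb w Kw) (Hw Hr).
  rewrite (_ : \int[leb]_s (\1_`[0, r] s * (gb \_ K2) (A s w)) =
    \int[leb]_s (\1_`[0, r] s * gb (A s w))) ?subrr ?mul0r//.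
  apply: eq_Rintegral => s _; rewrite indic_itvcc.
  case: (boolP ((0 : R) <= s <= r)) => [/andP[s0 sr]|]; last by rewrite !mul0r.
  by rewrite P// s0 (le_trans sr).
Qed.

End directional_ibp.

(** * The exit time *)

Lemma continuous_at_comp (U V W : topologicalType) (g : U -> V) (f : V -> W) x :
  {for x, continuous g} -> {for g x, continuous f} ->
  {for x, continuous (fun y => f (g y))}.
Proof. exact: continuous_comp. Qed.

Lemma cvg_at_comp (T : Type) (F : set_system T) (U V : topologicalType)
    (u : T -> U) (f : U -> V) x : Filter F ->
  u t @[t --> F] --> x -> {for x, continuous f} ->
  f (u t) @[t --> F] --> f x.
Proof. by move=> FF ux fx; apply: cvg_comp ux fx. Qed.

Lemma cvg_scale_le1 {R : realType} (V : normedModType R) (T : Type)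
    (F : set_system T) (c : T -> R) (w : T -> V) : Filter F ->
  (forall t, `|c t| <= 1) -> w t @[t --> F] --> 0 ->
  c t *: w t @[t --> F] --> 0.
Proof.
move=> FF c1 /cvgr0Pnorm_lt H; apply/cvgr0Pnorm_lt => d d0.
apply: filterS (H d d0) => t; apply: le_lt_trans.
by rewrite normrZ ler_piMl.
Qed.

Lemma smooth_dir_combination {R : realType} (V : normedModType R) (g : V -> R)
    (h k c d : R) (a b w y : V) : smooth g ->
  'D_(h *: (a - k *: (c *: b)) - d *: w) g y =
  h * ('D_a g y - k * (c * 'D_b g y)) - d * 'D_w g y.
Proof.
by move=> sg; rewrite -!scaleNr !(smooth_dirD, smooth_dirZ)// !mulNr.
Qed.

Lemma derive3_sum {R : realType} (g : R3 R -> R) (v x : R3 R) : smooth g ->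
  'D_v g x = \sum_(i < 3) coord3 v i * 'D_(e3 R i) g x.
Proof. by move=> sg; rewrite {1}(sum_coord3 v) smooth_dir_sum. Qed.

(** * First and second derivatives of the defining function *)

Section euclidean.
Context {R : realType}.
Variable xi : R3 R -> R.
Hypothesis sxi : smooth xi.

Lemma dot3_grad3 (x v : R3 R) : dot3 (grad3 xi x) v = 'D_v xi x.
Proof.
rewrite derive3_sum// /dot3; apply: eq_bigr => i _; rewrite mulrC; congr (_ * _).
have E (k : 'I_3) : val k = val i -> 'D_(e3 R k) xi x = 'D_(e3 R i) xi x.
  by move=> /val_inj ->.
by move: i E => [[|[|[|//]]] i3] E; apply: E.
Qed.

Lemma hessian_sum (x v : R3 R) :
  \sum_(i < 3) \sum_(j < 3)
    'D_(e3 R i) ('D_(e3 R j) xi) x * coord3 v i * coord3 v j =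
  'D_v ('D_v xi) x.
Proof.
have -> : 'D_v xi = fun y => \sum_(j < 3) coord3 v j * 'D_(e3 R j) xi y.
  by apply/funext => y; exact: derive3_sum.
rewrite derive_lincomb; last by move=> i; exact: smooth_derive.
rewrite exchange_big/=; apply: eq_bigr => j _.
rewrite (derive3_sum v x (smooth_derive _ sxi)).
by rewrite mulr_sumr; apply: eq_bigr => i _; ring.
Qed.

Lemma dot3_gt0 (v : R3 R) : v != 0 -> 0 < dot3 v v.
Proof.
case: v => [[a b] c] v0; rewrite /dot3 !big_ord_recr big_ord0/= add0r /coord3/=.
rewrite lt_neqAle; apply/andP; split; last first.
  by rewrite !addr_ge0// -expr2 sqr_ge0.
apply: contra v0 => /eqP/esym/eqP.
rewrite -!expr2 paddr_eq0 ?addr_ge0 ?sqr_ge0// paddr_eq0 ?sqr_ge0//.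
by rewrite !sqrf_eq0 => /andP[/andP[/eqP -> /eqP ->] /eqP ->].
Qed.

Lemma continuous_dir_derive :
  continuous (fun y : R3 R * R3 R => 'D_(y.2) xi y.1).
Proof.
have -> : (fun y : R3 R * R3 R => 'D_(y.2) xi y.1) =
    fun y => \sum_(i < 3) coord3 y.2 i * 'D_(e3 R i) xi y.1.
  by apply/funext => y; exact: derive3_sum.
have c i : continuous (fun y : R3 R * R3 R => coord3 y.2 i * 'D_(e3 R i) xi y.1).
  have c1 : continuous (fun y : R3 R * R3 R => coord3 y.2 i).
    by move=> y; apply: (continuous_at_comp (g := snd) (f := fun u => coord3 u i));
      [exact: cvg_snd|exact: continuous_coord3].
  have c2 : continuous (fun y : R3 R * R3 R => 'D_(e3 R i) xi y.1).
    move=> y; apply: (continuous_at_comp (g := fst) (f := 'D_(e3 R i) xi)).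
      exact: cvg_fst.
    exact: (smooth_continuous (smooth_derive _ sxi)).
  by move=> y; exact: cvgM (c1 y) (c2 y).
under eq_fun do rewrite !big_ord_recr big_ord0 /= add0r.
move=> y; apply: cvgD; last exact: c.
by apply: cvgD; exact: c.
Qed.

End euclidean.

Section exit.
Context {R : realType}.
Variables (xi : R3 R -> R) (Omega : set (R3 R)).
Hypothesis HO : convex_domain xi Omega.

Let oO : open Omega. Proof. by case: HO => -[]. Qed.
Let bO : bounded_set Omega. Proof. by case: HO => -[]. Qed.
Let sxi : smooth xi. Proof. by case: HO. Qed.
Let OE : Omega = [set x | xi x < 0]. Proof. by case: HO => _ _ []. Qed.
Let bE : boundary Omega = [set x | xi x = 0]. Proof. by case: HO => _ _ []. Qed.

Lemma line_continuous (x v : R3 R) : continuous (fun s : R => x - s *: v).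
Proof.
move=> s; apply: cvgB; first exact: cvg_cst.
by apply: cvgZr_tmp; exact: cvg_id.
Qed.

Lemma line_in_nbhs (x v : R3 R) (s : R) : Omega (x - s *: v) ->
  exists2 e : R, 0 < e & forall t, `|t - s| < e -> Omega (x - t *: v).
Proof.
move=> Os; have : nbhs (x - s *: v) Omega by exact: open_nbhs_nbhs.
move=> /(@line_continuous x v s)/nbhs_ballP[e /= e0 He]; exists e => // t ts.
by apply: (He t); rewrite /ball/= distrC.
Qed.

Lemma exit_nonempty (x v : R3 R) : v != 0 ->
  exists t : R, 0 < t /\ ~ Omega (x - t *: v).
Proof.
move=> v0; have [M [Mr HM]] := bO.
pose N := `|M| + 1.
have HN y : Omega y -> `|y| <= N.
  by move=> Oy; apply: (HM N) => //; rewrite /N (le_lt_trans (ler_norm M))// ltrDl.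
have nv : 0 < `|v| by rewrite normr_gt0.
have N0 : 0 < N by rewrite /N ltr_wpDl.
pose t := (N + `|x| + 1) / `|v|.
have t0 : 0 < t by rewrite divr_gt0// ltr_wpDl// addr_ge0// ltW.
exists t; split => // /HN H.
have : `|t *: v| <= `|x| + N.
  have -> : t *: v = x - (x - t *: v) by rewrite opprB addrC subrK.
  by rewrite (le_trans (ler_normB _ _))// lerD2l.
by rewrite normrZ gtr0_norm// divfK ?gt_eqF//; lra.
Qed.

Let S (x v : R3 R) := [set tau : R | 0 < tau /\ ~ Omega (x - tau *: v)].

Let S_inf (x v : R3 R) : v != 0 -> has_inf (S x v).
Proof.
move=> v0; split; first by have [t] := exit_nonempty x v0; exists t.
by exists 0 => t [/ltW].
Qed.

Lemma exit_ge0 (x v : R3 R) : v != 0 -> 0 <= t_b Omega x v.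
Proof. by move=> /(S_inf x)[S0 _]; apply: lb_le_inf => // t [/ltW]. Qed.

(** The infimum is attained because Omega is open. *)
Lemma exit_notin (x v : R3 R) : v != 0 -> ~ Omega (x - t_b Omega x v *: v).
Proof.
move=> v0 /line_in_nbhs[d d0 H].
have [t [t0 nt] tlt] := @inf_adherent _ (S x v) d d0 (S_inf x v0).
have tge : t_b Omega x v <= t by apply: ge_inf; [exact: (S_inf x v0).2|split].
apply: nt; apply: H.
by rewrite ger0_norm ?subr_ge0// ltrBlDl.
Qed.

Lemma exit_in (x v : R3 R) (s : R) : v != 0 -> 0 < s < t_b Omega x v ->
  Omega (x - s *: v).
Proof.
move=> v0 /andP[s0 st]; apply: contrapT => ns.
have : t_b Omega x v <= s by apply: ge_inf; [exact: (S_inf x v0).2|split].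
by rewrite leNgt st.
Qed.

Lemma exit_unique (x v : R3 R) (a : R) : 0 < a ->
  (forall s, 0 < s < a -> Omega (x - s *: v)) -> ~ Omega (x - a *: v) ->
  t_b Omega x v = a.
Proof.
move=> a0 Hin nO; apply/eqP; rewrite eq_le; apply/andP; split.
  by apply: ge_inf; [exists 0 => t [/ltW]|split].
apply: lb_le_inf; first by exists a; split.
move=> t [t0 nt]; rewrite leNgt; apply/negP => ta; apply: nt; apply: Hin.
by rewrite t0.
Qed.

Lemma is_derive_back (g : R3 R -> R) (x v : R3 R) (s : R) : smooth g ->
  is_derive s (1 : R) (fun s => g (x - s *: v)) (- 'D_v g (x - s *: v)).
Proof.
move=> sg.
have [||D E] := @is_derive_affine _ _ _ g (fun s : R => x - s *: v) (1 : R) (- v) s.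
- by move=> k; rewrite scalerDl opprD addrA scalerN [k *: 1]mulr1.
- exact: smooth_derivable.
by split=> //; rewrite E -(scaleN1r v) smooth_dirZ// mulN1r.
Qed.

Section interior.
Variables (x v : R3 R).
Hypotheses (Ox : Omega x) (v0 : v != 0).
Local Notation a := (t_b Omega x v).

Lemma exit_gt0 : 0 < a.
Proof.
rewrite lt_neqAle exit_ge0// andbT; apply/eqP => E.
by apply: (@exit_notin x v v0); rewrite -E scale0r subr0.
Qed.

Lemma exit_in0 (s : R) : 0 <= s < a -> Omega (x - s *: v).
Proof.
rewrite le_eqVlt => /andP[/orP[/eqP <-|s0] sa]; first by rewrite scale0r subr0.
by apply: exit_in => //; rewrite s0.
Qed.

Lemma exit_closure : closure Omega (x - a *: v).
Proof.
move=> B /(@line_continuous x v a)/nbhs_ballP[d /= d0 Hd].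
pose s := Num.max 0 (a - d / 2).
have s0 : 0 <= s by rewrite le_max lexx.
have sa : s < a by rewrite gt_max exit_gt0; lra.
exists (x - s *: v); split; first by apply: exit_in0; rewrite s0.
apply: (Hd s); rewrite /ball/= ger0_norm ?subr_ge0 ?(ltW sa)//.
have as_ : a - d / 2 <= s by rewrite le_max lexx orbT.
by clearbody s; lra.
Qed.

Lemma exit_boundary : boundary Omega (x - a *: v).
Proof.
split; first exact: exit_closure.
by move=> /interior_subset; exact: exit_notin.
Qed.

Lemma xi_exit : xi (x - a *: v) = 0.
Proof. by have := exit_boundary; rewrite bE. Qed.

(** The function s -> xi (x - s v) is negative at 0 and zero at the exit, so its slope is positive
    somewhere before the exit, and convexity keeps the slope from decreasing up to the exit. The
    slope is minus the derivative of xi along v. *)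
Lemma exit_transversal : 'D_v xi (x - a *: v) < 0.
Proof.
have a0 := exit_gt0.
have cont g (b c : R) : smooth g -> {within `[b, c], continuous (fun s => g (x - s *: v))}.
  move=> sg; apply: continuous_subspaceT => s.
  by apply: continuous_comp; [exact: line_continuous|exact: smooth_continuous].
have [c /[!in_itv]/= /andP[c0 ca]] :=
  MVT a0 (fun s _ => is_derive_back _ _ s sxi) (cont _ 0 a sxi).
rewrite xi_exit scale0r subr0 sub0r => E.
have Dc : 'D_v xi (x - c *: v) < 0.
  have : xi x < 0 by move: Ox; rewrite OE.
  have : 0 < a - 0 by rewrite subr0.
  nra.
have [b /[!in_itv]/= /andP[bc ba]] :=
  MVT ca (fun s _ => is_derive_back _ _ s (smooth_derive v sxi)) (cont _ c a (smooth_derive v sxi)).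
have : 0 <= 'D_v ('D_v xi) (x - b *: v).
  case: HO => _ _ _ _ [C C0 /(_ (x - b *: v) v)].
  rewrite hessian_sum// => H; apply: le_trans (H _).
    by rewrite mulr_ge0 ?ltW// dot3_gt0.
  by apply: subset_closure; apply: exit_in0; rewrite ba (le_trans (ltW c0) (ltW bc)).
have : 0 < a - c by rewrite subr_gt0.
nra.
Qed.

End interior.

Lemma open_phase : open (phase Omega).
Proof.
rewrite (_ : phase Omega = [set z | Omega z.1.2] `&` [set z | z.2 != 0])//.
apply: openI.
  apply: (@open_comp _ _ (fun z : txv R => z.1.2)) => // z _.
  by apply: (continuous_at_comp (g := fst) (f := snd)); [exact: cvg_fst|exact: cvg_snd].
rewrite (_ : [set z : txv R | z.2 != 0] = snd @^-1` ~` [set 0]).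
  apply: open_comp; first by move=> z _; exact: cvg_snd.
  by rewrite openC; exact: accessible_closed_set1 (hausdorff_accessible (@norm_hausdorff _ _)) _.
by apply/seteqP; split => z /= /eqP.
Qed.

(** * Regularity of the exit time *)

Section exit_time.
Variable eps : R.
Hypothesis eps0 : eps != 0.

Local Notation A := (fun z : txv R => t_b Omega z.1.2 (eps *: z.2)).
Local Notation B := (fun z : txv R => z.1.2 - A z *: (eps *: z.2)).

Let ev0 (z : txv R) : phase Omega z -> eps *: z.2 != 0.
Proof. by case=> _ z0; rewrite scaler_eq0 negb_or eps0. Qed.

Let cont_pos : continuous (fun z : txv R => z.1.2).
Proof.
move=> z.
by apply: (continuous_at_comp (g := fst) (f := snd)); [exact: cvg_fst|exact: cvg_snd].
Qed.

(** Free flight is the affine flow without constant part, which makes [open_flow_domain] available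
    for the exit time. *)
Let back_flow r (z : txv R) :
  aflow (0 : txv R) (- eps) r z = (z.1.1, z.1.2 - r *: (eps *: z.2), z.2).
Proof.
case: z => [[t x] v]; rewrite /aflow /afield /=.
apply: injective_projections => /=; last by rewrite scaler0 addr0.
apply: injective_projections => /=; first by rewrite scaler0 addr0.
by rewrite add0r scaleNr scalerN.
Qed.

(** Lower bound: a segment stopped short of the exit is compact in Omega, hence stays in Omega for
    nearby data. Upper bound: by transversality xi is positive just after the exit, and remains so
    for nearby data. *)
Lemma continuous_exit z : phase Omega z -> {for z, continuous A}.
Proof.
move=> Uz; have [Oz z0] := Uz; have ez := ev0 Uz.
have a0 := exit_gt0 Oz ez.
apply/cvgrPdist_lt => d d0.
pose r := Num.max 0 (A z - d / 2).
have r0 : 0 <= r by rewrite le_max lexx.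
have ra : r < A z by rewrite gt_max a0; lra.
have rd : A z - d / 2 <= r by rewrite le_max lexx orbT.
have [s1 /andP[s1a s1d] xs1] : exists2 s1 : R, A z < s1 < A z + d &
    0 < xi (z.1.2 - s1 *: (eps *: z.2)).
  have := is_derive_back z.1.2 (eps *: z.2) (A z) sxi.
  move=> /is_derive1_cvgP/cvgrPdist_lt.
  have D := exit_transversal Oz ez.
  move=> /(_ (- 'D_(eps *: z.2) xi (B z))).
  rewrite oppr_gt0 => /(_ D) [k /= k0 Hk].
  pose h := Num.min (k / 2) (d / 2).
  have h0 : 0 < h by rewrite lt_min !divr_gt0.
  have hk : h <= k / 2 by rewrite ge_min lexx.
  have hd : h <= d / 2 by rewrite ge_min lexx orbT.
  exists (A z + h); first by clearbody h; lra.
  have := Hk h; rewrite /= sub0r normrN gtr0_norm// gt_eqF// => /(_ _ isT).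
  rewrite (xi_exit Oz ez) subr0 => H.
  have /H : h < k by clearbody h; lra.
  rewrite ltr_norml => /andP[_]; rewrite ltrBlDr -ltrBlDl subrr.
  by rewrite pmulr_rgt0// invr_gt0.
have [N1 N2] : (\forall z' \near z, flow_domain (0 : txv R) (- eps) (phase Omega) r z') /\
    (\forall z' \near z, 0 < xi (z'.1.2 - s1 *: (eps *: z'.2))).
  split.
    apply: open_nbhs_nbhs; split; first exact: open_flow_domain open_phase.
    move=> s /andP[sr0 sr]; rewrite back_flow; split => //=.
    by apply: exit_in0 => //; rewrite sr0 (le_lt_trans sr).
  have c : {for z, continuous (fun z' : txv R => xi (z'.1.2 - s1 *: (eps *: z'.2)))}.
    apply: (continuous_at_comp (f := xi)); last exact: smooth_continuous.
    apply: cvgB; first exact: cont_pos.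
    by apply: cvgZl_tmp; apply: cvgZl_tmp; exact: cvg_snd.
  exact: (cvgr_gt _ c).
near=> z'.
have Fz' : flow_domain (0 : txv R) (- eps) (phase Omega) r z' by near: z'.
have Ez' : 0 < xi (z'.1.2 - s1 *: (eps *: z'.2)) by near: z'.
have Uz' : phase Omega z'.
  have := Fz' 0; rewrite lexx r0 => /(_ isT); by rewrite /aflow scale0r addr0.
have ez' := ev0 Uz'.
have l : r < A z'.
  rewrite ltNge; apply/negP => Ar; apply: (@exit_notin z'.1.2 _ ez').
  have := Fz' (A z'); rewrite exit_ge0// Ar => /(_ isT)[+ _].
  by rewrite back_flow.
have u : A z' <= s1.
  apply: ge_inf; first by exists 0 => t [/ltW].
  split; first exact: lt_trans s1a.
  by rewrite OE /= => H; have := lt_trans H Ez'; rewrite ltxx.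
rewrite ltr_norml; apply/andP; split; clearbody r; lra.
Unshelve. all: by end_near.
Qed.

Lemma continuous_exit_point z : phase Omega z -> {for z, continuous B}.
Proof.
move=> Uz; apply: cvgB; first exact: cont_pos.
by apply: cvgZ; [exact: continuous_exit|apply: cvgZl_tmp; exact: cvg_snd].
Qed.

(** The solution of the equation obtained by differentiating xi (B z) = 0 along e; the denominator
    is nonzero by transversality. *)
Definition dexit (e z : txv R) : R :=
  ('D_(e.1.2) xi (B z) - A z * eps * 'D_(e.2) xi (B z)) /
  'D_(eps *: z.2) xi (B z).

Lemma continuous_dexit e z : phase Omega z -> {for z, continuous (dexit e)}.
Proof.
move=> Uz; have [Oz z0] := Uz; have ez := ev0 Uz.
have cB := continuous_exit_point Uz.
have cD d : {for z, continuous (fun z => 'D_d xi (B z))}.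
  apply: (continuous_at_comp (f := 'D_d xi) cB).
  exact: (smooth_continuous (smooth_derive _ sxi)).
apply: cvgM.
  apply: cvgB; first exact: cD.
  apply: cvgM; last exact: cD.
  by apply: cvgM; [exact: continuous_exit|exact: cvg_cst].
apply: cvgV; first by rewrite lt_eqF// exit_transversal.
apply: (continuous_at_comp (g := fun z => (B z, eps *: z.2))
  (f := fun y : R3 R * R3 R => 'D_(y.2) xi y.1)); last exact: continuous_dir_derive.
by apply: cvg_to_pair => //; apply: cvgZl_tmp; exact: cvg_snd.
Qed.

(** The implicit function theorem by hand. Both exit points lie on xi = 0, so the mean value theorem
    finds a point between them where the derivative of xi along their difference vanishes; this is
    linear in the increment of the exit time and can be solved for it, transversality persisting
    near B z. *)
Lemma is_derive_exit e z : phase Omega z -> is_derive z e A (dexit e z).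
Proof.
move=> Uz; have [Oz z0] := Uz; have ez := ev0 Uz.
apply/is_derive_cvgP.
(* The increment of the exit point, with the increment of the exit time isolated in the last
   term. *)
pose w h := h *: (e.1.2 - A (z + h *: e) *: (eps *: e.2)) -
  (A (z + h *: e) - A z) *: (eps *: z.2).
have wB h : B (z + h *: e) = B z + w h.
  rewrite /w /=; move: (t_b _ _ _) (t_b _ _ _) => a' a.
  by move: z.1.2 z.2 e.1.2 e.2 => -[[x1 x2] x3] [[v1 v2] v3] [[b1 b2] b3] [[c1 c2] c3];
    do ?apply: injective_projections; rewrite /= /GRing.scale /=; ring.
have dx y d : derivable xi y d by exact: smooth_derivable.
(* The phase condition is placed inside the existential because [choice] needs a value of c for
   every h, also where z + h e has left the phase space. *)
have ch h : exists c : R, `|c| <= 1 /\ (phase Omega (z + h *: e) ->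
    'D_(w h) xi (B z + c *: w h) = 0).
  have [c [c1 E]] := @MVT_line R (fun s : R => xi (B z + s *: w h))
    (fun s => 'D_(w h) xi (B z + s *: w h)) 1
    (fun s => is_derive_line (derivable_is_derive (dx _ _))).
  exists c; rewrite normr1 in c1; split => // Uh; move: E.
  rewrite scale1r scale0r addr0 -wB !xi_exit//; last 2 first.
  - by case: Uh.
  - exact: ev0.
  by rewrite subrr mul1r.
have [c Hc] := choice ch.
have h0 : h @[h --> (0 : R)^'] --> (0 : R) by exact: nbhs_dnbhs.
have zh : z + h *: e @[h --> (0 : R)^'] --> z.
  rewrite -[X in _ --> X]addr0 -(scale0r e).
  by apply: cvgD; [exact: cvg_cst|exact: cvgZr_tmp].
have Ah : A (z + h *: e) @[h --> (0 : R)^'] --> A z.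
  exact: (cvg_at_comp (f := A) _ zh (continuous_exit Uz)).
have wh : w h @[h --> (0 : R)^'] --> (0 : R3 R).
  have -> : (0 : R3 R) = 0 *: (e.1.2 - A z *: (eps *: e.2)) -
      (A z - A z) *: (eps *: z.2) by rewrite subrr !scale0r subrr.
  apply: cvgB.
    apply: cvgZ => //; apply: cvgB; first exact: cvg_cst.
    exact: cvgZr_tmp.
  by apply: cvgZr_tmp; apply: cvgB => //; exact: cvg_cst.
have ch0 : B z + c h *: w h @[h --> (0 : R)^'] --> B z.
  rewrite -[X in _ --> X]addr0; apply: cvgD; first exact: cvg_cst.
  by apply: cvg_scale_le1 => // h; have [] := Hc h.
pose D3 := 'D_(eps *: z.2) xi.
(* [dexit] with position and exit time as independent arguments: the difference quotient is exactly
   its value at the intermediate point and the new exit time. *)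
pose M (y : R3 R * R) := ('D_(e.1.2) xi y.1 - y.2 * eps * 'D_(e.2) xi y.1) /
  D3 y.1.
have D30 : D3 (B z) < 0 by exact: exit_transversal.
have cD d : continuous ('D_d xi) by exact: (smooth_continuous (smooth_derive _ sxi)).
have cD3 : continuous D3 by exact: cD.
have cDf d (y : R3 R * R) : {for y, continuous (fun y : R3 R * R => 'D_d xi y.1)}.
  by apply: (continuous_at_comp (g := fst) (f := 'D_d xi));
    [exact: cvg_fst|exact: cD].
have cM : {for (B z, A z), continuous M}.
  apply: cvgM; last by apply: cvgV; [rewrite lt_eqF|exact: cDf].
  apply: cvgB; first exact: cDf.
  apply: cvgM; last exact: cDf.
  by apply: cvgM; [exact: cvg_snd|exact: cvg_cst].
have Dw (h : R) y : 'D_(w h) xi y = h * ('D_(e.1.2) xi y - A (z + h *: e) * (eps *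
    'D_(e.2) xi y)) - (A (z + h *: e) - A z) * D3 y.
  exact: smooth_dir_combination.
suff : M (B z + c h *: w h, A (z + h *: e)) @[h --> (0 : R)^'] --> dexit e z.
  apply: cvg_trans; apply: near_eq_cvg.
  have N1 : \forall h \near (0 : R)^', phase Omega (z + h *: e).
    have /zh : nbhs z (phase Omega) by exact: open_nbhs_nbhs (conj open_phase Uz).
    by [].
  have N2 : \forall h \near (0 : R)^', D3 (B z + c h *: w h) < 0.
    by apply: (cvgr_lt _ (cvg_at_comp (f := D3) _ ch0 (cD3 _))).
  near=> h.
  have hn0 : h != 0 by near: h; exact: nbhs_dnbhs_neq.
  have Dh : D3 (B z + c h *: w h) < 0 by near: h.
  have Uh : phase Omega (z + h *: e) by near: h.
  have [_ /(_ Uh)] := Hc h.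
  rewrite Dw /M /= => E.
  have Dn0 := ltr0_neq0 Dh.
  rewrite -[RHS](mulfK Dn0); congr (_ / _); apply: (mulfI hn0).
  by rewrite -(mulrA h^-1) mulVKf//; lra.
have pz : (B z + c h *: w h, A (z + h *: e)) @[h --> (0 : R)^'] --> (B z, A z).
  by apply: cvg_to_pair.
exact: (cvg_at_comp (f := M) _ pz cM).
Unshelve. all: by end_near.
Qed.

End exit_time.

Section chord.
Variables (x u : R3 R).
Hypotheses (Ox : Omega x) (u0 : u != 0).

Let nu0 : - u != 0. Proof. by rewrite oppr_eq0. Qed.

Lemma chord_in (s : R) : - t_b Omega x u < s < t_b Omega x (- u) ->
  Omega (x + s *: u).
Proof.
move=> /andP[ps sq]; have [s0|s0] := ltP s 0.
  rewrite -[s]opprK scaleNr; apply: exit_in0 => //.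
  by rewrite oppr_ge0 ltW//= ltrNl.
by rewrite -[u]opprK scalerN; apply: exit_in0 => //; rewrite s0.
Qed.

(** The value s = t_b (- u) is allowed: the start may then lie on the boundary, as after each
    bounce, and the exit time is the whole chord since time 0 is excluded from the infimum. *)
Lemma exit_shift (s : R) : - t_b Omega x u < s <= t_b Omega x (- u) ->
  t_b Omega (x + s *: u) u = t_b Omega x u + s.
Proof.
move=> /andP[ps sq]; apply: exit_unique.
- by rewrite -ltrBlDl sub0r.
- move=> r /andP[r0 rs]; rewrite -addrA -scalerBl; apply: chord_in.
  by apply/andP; split; lra.
- rewrite -addrA -scalerBl opprD addrCA subrr addr0 scaleNr.
  exact: exit_notin.
Qed.

Lemma not_grazing (y w : R3 R) : 'D_w xi y != 0 -> ~ grazing xi Omega (y, w).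
Proof.
rewrite -(dot3_grad3 sxi) => D [_ /= E].
have g0 : grad3 xi y != 0.
  apply: contra D => /eqP ->; rewrite /dot3 big1// => i _.
  by rewrite /coord3; case: i => [[|[|[|//]]] i3] /=; rewrite mul0r.
have s0 : Num.sqrt (dot3 (grad3 xi y) (grad3 xi y)) != 0.
  by rewrite gt_eqF// sqrtr_gt0 dot3_gt0.
move/eqP: E; apply/negP; rewrite /normal.
rewrite (_ : dot3 _ _ = (Num.sqrt (dot3 (grad3 xi y) (grad3 xi y)))^-1 *
  dot3 (grad3 xi y) w); first by rewrite mulf_neq0// invr_eq0.
rewrite /dot3 mulr_sumr; apply: eq_bigr => i _.
by rewrite mulrA; congr (_ * _); case: i => [[|[|[|//]]] i3].
Qed.

(** Transversality at both ends: the closed chord avoids the grazing set, so that integrability up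
    to the boundary can be used on it. *)
Lemma chord_closed (t s : R) : - t_b Omega x u <= s <= t_b Omega x (- u) ->
  closed_phase xi Omega (t, x + s *: u, u).
Proof.
move=> /andP[]; rewrite le_eqVlt => /orP[/eqP <- _|ps].
  rewrite scaleNr; split; [exact: exit_closure|exact: u0|].
  by apply: not_grazing; rewrite lt_eqF// exit_transversal.
rewrite le_eqVlt => /orP[/eqP ->|sq].
  have -> : x + t_b Omega x (- u) *: u = x - t_b Omega x (- u) *: (- u).
    by rewrite scalerN opprK.
  split; [exact: exit_closure|exact: u0|apply: not_grazing].
  have := exit_transversal Ox nu0; rewrite -(scaleN1r u) smooth_dirZ// mulN1r.
  by rewrite oppr_lt0 => /gt_eqF ->.
have Oy : Omega (x + s *: u) by apply: chord_in; rewrite ps.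
split => //=; first exact: subset_closure.
by move=> [[_ ni] _]; apply: ni; exact: open_nbhs_nbhs (conj oO Oy).
Qed.

End chord.

(* p, q and q + t - t^j in the notation of the header. *)
Definition back_time j (z : txv R) : R := t_b Omega z.1.2 ((-1) ^+ j *: z.2).

Definition fore_time j (z : txv R) : R := if j is k.+1 then back_time k z else 0.

Fixpoint delay j (z : txv R) : R :=
  if j is k.+1 then 2 * back_time k z + delay k z else 0.

Definition along j (s : R) (z : txv R) : txv R :=
  (z.1.1 - delay j z + s, z.1.2 + s *: ((-1) ^+ j *: z.2), (-1) ^+ j *: z.2).

(** * Closed form of the bounce-back cycles *)

Section cycles.
Variables (z : txv R).
Hypothesis Uz : phase Omega z.

Let v0 j : (-1) ^+ j *: z.2 != 0.
Proof. by case: Uz => _ z0; rewrite scaler_eq0 negb_or signr_eq0. Qed.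

Lemma back_time_gt0 j : 0 < back_time j z.
Proof. by apply: exit_gt0 => //; case: Uz. Qed.

Lemma fore_time_ge0 j : 0 <= fore_time j z.
Proof. by case: j => //= j; rewrite ltW// back_time_gt0. Qed.

Lemma fore_time_le j :
  fore_time j z <= t_b Omega z.1.2 (- ((-1) ^+ j *: z.2)).
Proof.
case: j => [|j]; first by apply: exit_ge0; rewrite oppr_eq0.
by rewrite /= /back_time exprS mulN1r scaleNr opprK.
Qed.

(** Reversing the velocity exchanges the two exits, so every cycle runs on the chord through (x, v).
    From the first bounce on a cycle starts on the boundary and its exit time is the whole chord p +
    q; for j = 0 it starts at x itself and q = 0. *)
Lemma cycleE j : Defs.cycle Omega j z =
  (z.1.1 + fore_time j z - delay j z,
   z.1.2 + fore_time j z *: ((-1) ^+ j *: z.2), (-1) ^+ j *: z.2).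
Proof.
have [Oz _] := Uz.
elim: j => [|j IH].
  rewrite /= addr0 subr0 scale0r addr0 expr0 scale1r.
  by case: (z) => [[]].
rewrite /Defs.cycle iterS -/(Defs.cycle Omega j z) IH /bounce /x_b /=.
have E : t_b Omega (z.1.2 + fore_time j z *: ((-1) ^+ j *: z.2))
    ((-1) ^+ j *: z.2) = back_time j z + fore_time j z.
  apply: exit_shift => //; rewrite fore_time_le andbT.
  by rewrite (lt_le_trans _ (fore_time_ge0 j))// oppr_lt0 back_time_gt0.
have eN : (-1) ^+ j.+1 *: z.2 = - ((-1) ^+ j *: z.2).
  by rewrite exprS mulN1r scaleNr.
rewrite E eN scalerN.
congr (_, _, _); first by ring.
by rewrite scalerDl opprD addrACA subrr addr0.
Qed.

Lemma tcE j : tc Omega j z = z.1.1 + fore_time j z - delay j z.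
Proof. by rewrite /tc cycleE. Qed.

Lemma tcSE j : tc Omega j.+1 z = z.1.1 - delay j z - back_time j z.
Proof. by rewrite tcE /=; ring. Qed.

Lemma trajE j s :
  traj Omega j z (z.1.1 - delay j z + s) = along j s z.
Proof.
rewrite /traj /tc /xc /vc cycleE /along /=; congr (_, _, _).
rewrite -addrA -scalerBl; congr (_ + _ *: _); ring.
Qed.

Lemma along_phase j s : - back_time j z < s < fore_time j z ->
  phase Omega (along j s z).
Proof.
have [Oz _] := Uz.
move=> /andP[ps sq]; split => //=.
by apply: chord_in => //; rewrite ps (lt_le_trans sq (fore_time_le j)).
Qed.

Lemma along_closed_phase j s : - back_time j z <= s <= fore_time j z ->
  closed_phase xi Omega (along j s z).
Proof.
have [Oz _] := Uz.
move=> /andP[ps sq]; apply: chord_closed => //.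
by rewrite ps (le_trans sq (fore_time_le j)).
Qed.

Variable e : txv R.

Definition dback_time j : txv R -> R := dexit ((-1) ^+ j) e.

Definition dfore_time j (z : txv R) : R := if j is k.+1 then dback_time k z else 0.

Fixpoint ddelay j (z : txv R) : R :=
  if j is k.+1 then 2 * dback_time k z + ddelay k z else 0.

Lemma is_derive_back_time j : is_derive z e (back_time j) (dback_time j z).
Proof. by apply: is_derive_exit => //; rewrite signr_eq0. Qed.

Lemma is_derive_fore_time j : is_derive z e (fore_time j) (dfore_time j z).
Proof. by case: j => [|j]; [exact: is_derive_cst|exact: is_derive_back_time]. Qed.

Lemma is_derive_delay j : is_derive z e (delay j) (ddelay j z).
Proof.
elim: j => [|j IH]; first exact: is_derive_cst.
have D := is_derive_back_time j.
exact: (@is_deriveD _ _ _ (2 \*: back_time j) (delay j) z e _ _ (is_deriveZ _ D) IH).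
Qed.

Lemma continuous_back_time j : {for z, continuous (back_time j)}.
Proof. by apply: continuous_exit => //; rewrite signr_eq0. Qed.

Lemma continuous_fore_time j : {for z, continuous (fore_time j)}.
Proof. by case: j => [|j]; [exact: cvg_cst|exact: continuous_back_time]. Qed.

Lemma continuous_delay j : {for z, continuous (delay j)}.
Proof.
elim: j => [|j IH]; first exact: cvg_cst.
apply: cvgD => //; apply: cvgM; first exact: cvg_cst.
exact: continuous_back_time.
Qed.

Lemma continuous_dback_time j : {for z, continuous (dback_time j)}.
Proof. by apply: continuous_dexit => //; rewrite signr_eq0. Qed.

Lemma continuous_dfore_time j : {for z, continuous (dfore_time j)}.
Proof. by case: j => [|j]; [exact: cvg_cst|exact: continuous_dback_time]. Qed.

Lemma continuous_ddelay j : {for z, continuous (ddelay j)}.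
Proof.
elim: j => [|j IH]; first exact: cvg_cst.
apply: cvgD => //; apply: cvgM; first exact: cvg_cst.
exact: continuous_dback_time.
Qed.

End cycles.

End exit.

Lemma is_derive_along_ray {R : realType} (q : txv R -> R) (a c dq : R) (e z : txv R) :
  {for z, continuous q} -> is_derive z e q dq ->
  is_derive z e (fun z : txv R => a *: z.1.2 + q z *: (c *: z.2))
    (a *: e.1.2 + dq *: (c *: z.2) + q z *: (c *: e.2)).
Proof.
move=> cq dq'; pose f (z : txv R) : R3 R := a *: z.1.2 + q z *: (c *: z.2).
have h0 : h @[h --> (0 : R)^'] --> (0 : R) by exact: nbhs_dnbhs.
have zh : z + h *: e @[h --> (0 : R)^'] --> z.
  rewrite -[X in _ --> X]addr0 -(scale0r e).
  by apply: cvgD; [exact: cvg_cst|exact: cvgZr_tmp].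
have H : h^-1 *: ((f \o shift z) (h *: e) - f z) @[h --> (0 : R)^'] -->
    a *: e.1.2 + dq *: (c *: z.2) + q z *: (c *: e.2).
  have K : a *: e.1.2 + (h^-1 * (q (z + h *: e) - q z)) *: (c *: z.2) +
      q (z + h *: e) *: (c *: e.2) @[h --> (0 : R)^'] -->
      a *: e.1.2 + dq *: (c *: z.2) + q z *: (c *: e.2).
    apply: cvgD; last first.
      by apply: cvgZr_tmp; exact: (cvg_at_comp (f := q) _ zh cq).
    apply: cvgD; first exact: cvg_cst.
    by apply: cvgZr_tmp; apply/is_derive_cvgP.
  apply: cvg_trans K; apply: near_eq_cvg; near=> h.
  have hn0 : h != 0 by near: h; exact: nbhs_dnbhs_neq.
  rewrite /f /= [h *: e + z]addrC; move: (q (z + _)) (q z) => k b.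
  by move: z.1.2 z.2 e.1.2 e.2 => -[[x1 x2] x3] [[v1 v2] v3] [[b1 b2] b3] [[c1 c2] c3];
    do ?apply: injective_projections; rewrite /= /GRing.scale /=; field.
by apply: DeriveDef; [apply/cvg_ex; eexists; exact: H|exact: cvg_lim H].
Unshelve. all: by end_near.
Qed.

(** * Derivatives of the cycles *)

Section cycle_derivatives.
Context {R : realType}.
Variables (xi : R3 R -> R) (Omega : set (R3 R)).
Hypothesis HO : convex_domain xi Omega.
Variables (j : nat) (e z : txv R).
Hypotheses (Uz : phase Omega z) (e0 : e.1.1 = 0).

Local Notation q := (fore_time Omega j).
Local Notation eps := ((-1) ^+ j : R).
Local Notation dp := (dback_time xi Omega e j z).
Local Notation dq := (dfore_time xi Omega e j z).
Local Notation da := (ddelay xi Omega e j z).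

Let nearU : \near z, phase Omega z.
Proof. exact: open_nbhs_nbhs (conj (open_phase HO) Uz). Qed.

Lemma is_derive_time : is_derive z e (fun z : txv R => z.1.1) e.1.1.
Proof.
have [||D E] := @is_derive_affine _ _ _ (@id R) (fun z : txv R => z.1.1) e e.1.1 z.
- by [].
- exact: derivable_id.
by apply: (DeriveDef D); rewrite E derive_id.
Qed.

Lemma is_derive_tc : is_derive z e (tc Omega j) (dq - da).
Proof.
have := is_deriveB (is_deriveD is_derive_time (is_derive_fore_time HO Uz e j))
  (is_derive_delay HO Uz e j).
rewrite e0 add0r; apply: near_eq_is_derive.
by apply: filterS nearU => y Uy; rewrite (tcE HO Uy).
Qed.

Lemma is_derive_tcS : is_derive z e (tc Omega j.+1) (- da - dp).
Proof.
have := is_deriveB (is_deriveB is_derive_time (is_derive_delay HO Uz e j))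
  (is_derive_back_time HO Uz e j).
rewrite e0 sub0r; apply: near_eq_is_derive.
by apply: filterS nearU => y Uy; rewrite (tcSE HO Uy).
Qed.

Lemma is_derive_xc : is_derive z e (xc Omega j)
  (e.1.2 + dq *: (eps *: z.2) + q z *: (eps *: e.2)).
Proof.
have cq : {for z, continuous q} by exact: (@continuous_fore_time _ _ _ HO _ Uz j).
have := is_derive_along_ray 1 eps cq (is_derive_fore_time HO Uz e j).
rewrite !scale1r; apply: near_eq_is_derive.
by apply: filterS nearU => y Uy; rewrite /xc (cycleE HO Uy) scale1r.
Qed.

Lemma derive_vc : 'D_e (vc Omega j) z = eps *: e.2.
Proof.
have c1 : {for z, continuous (cst 1 : txv R -> R)} by exact: cvg_cst.
have [_ E] := is_derive_along_ray 0 eps c1 (is_derive_cst (1 : R) z e).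
transitivity ('D_e (fun y : txv R => 0 *: y.1.2 + cst 1 y *: (eps *: y.2)) z).
  apply: near_eq_derive.
  by apply: filterS nearU => y Uy; rewrite /vc (cycleE HO Uy) scale0r add0r scale1r.
by rewrite E !scale0r !add0r scale1r.
Qed.

(** [dtraj] differentiates at fixed elapsed time t^j - tau = q - s, so s moves with q: to the
    derivative at fixed s is added d_e q times the velocity of the segment. *)
Lemma dtrajE s : dtraj Omega j e z (z.1.1 - delay Omega j z + s) =
  (0, e.1.2 + (s * eps) *: e.2, eps *: e.2) - da *: et R +
  dq *: ((1, eps *: z.2, 0) : txv R).
Proof.
rewrite /dtraj derive_vc (tcE HO Uz).
have [_ ->] := is_derive_tc; have [_ ->] := is_derive_xc.
apply: injective_projections; last first.
  by rewrite /= !(scaler0, addr0, subr0).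
apply: injective_projections => /=.
  by rewrite /GRing.scale /=; ring.
move: z.2 e.1.2 e.2 => -[[v1 v2] v3] [[b1 b2] b3] [[c1 c2] c3];
  do ?apply: injective_projections; rewrite /= /GRing.scale /=; ring.
Qed.

End cycle_derivatives.

(** * Cutoffs on a slab *)

Lemma measurable_le_indic d (T : measurableType d) (R : realType) (f g : T -> R) :
  measurable_fun setT f -> measurable_fun setT g ->
  measurable_fun setT (fun x => (f x <= g x)%R%:R : R).
Proof.
move=> mf mg.
have mA : measurable [set x | f x <= g x].
  rewrite (_ : [set x | _] = setT `&` (fun x => f x <= g x) @^-1` [set true]).
    exact: (measurable_fun_ler mf mg).
  by rewrite setTI.
rewrite (_ : (fun x => _) = \1_[set x | f x <= g x]); first exact: measurable_indic.
apply/funext => x; rewrite indicE; case: (boolP (f x <= g x)) => fg.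
  by rewrite mem_set.
by rewrite memNset//=; exact/negP.
Qed.

(** * Integration by parts along one segment *)

Section slice.
Context {R : realType}.
Notation leb := (@lebesgue_measure R).
Variables (a b T : R) (u g c c' : R -> R).
Hypotheses (ab : a < b) (lu : Lone leb (u \_ `]a, b[)) (lg : Lone leb (g \_ `]a, b[)).
Hypothesis ug : {ae leb, forall s, a < s < b ->
  u s = T + \int[leb]_r (g \_ `]a, s]) r}.
Hypotheses (dc : forall s : R, is_derive s (1 : R) c (c' s)) (cc : continuous c').

Let I := `]a, b[%classic.
Let cb s := \1_`[a, b] s * c' s.

Let mc : measurable_fun setT c'.
Proof. exact: continuous_measurable_fun. Qed.

Let bcb : exists N : R, forall s, `|cb s| <= N.
Proof.
have cn : {within `[a, b], continuous (fun s => `|c' s|)}.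
  apply: continuous_subspaceT => s.
  exact: (continuous_at_comp (f := fun x : R => `|x|) (@cc s) (@norm_continuous _ _ _)).
have [s0 s0ab H] := EVT_max (ltW ab) cn.
exists `|c' s0| => s; rewrite /cb indic_itvcc.
case: (boolP (a <= s <= b)) => sab; last by rewrite mul0r normr0.
by rewrite mul1r; apply: H; rewrite in_itv.
Qed.

Let lcb : Lone leb cb.
Proof.
have [N HN] := bcb.
have -> : cb = fun s => \1_`[a, b] s * cb s.
  by apply/funext => s; rewrite /cb mulrA indicE; case: (_ \in _); rewrite !(mul0r, mul1r).
have mcb : measurable_fun setT cb.
  by apply: measurable_funM => //; exact: measurable_indic.
exact: (@LoneM _ _ _ leb (\1_`[a, b] : R -> R) cb N mcb HN (Lone_indic_itv a b)).
Qed.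

Let cbI (h : R -> R) (s : R) : (h \_ I) s * c' s = (h \_ I) s * cb s.
Proof.
rewrite patchE /cb; case: ifPn => [|_]; last by rewrite !mul0r.
rewrite inE /I /= in_itv /= => /andP[a_s sb].
by rewrite indic_itvcc (ltW a_s) (ltW sb) mul1r.
Qed.

Lemma Lone_sliceM (h : R -> R) : Lone leb (h \_ I) -> Lone leb (fun s => (h \_ I) s * c' s).
Proof.
move=> lh; rewrite (eq_fun (cbI h)); have [N HN] := bcb.
exact: LoneM (Lone_meas lcb) HN lh.
Qed.

Let H (z : R * R) := cb z.1 * (g \_ I) z.2 * (z.2 <= z.1)%R%:R.

Let lH : Lone (sfprod leb leb) H.
Proof.
have l0 : Lone (sfprod leb leb) (fun z : R * R => cb z.1 * (g \_ I) z.2).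
  exact: (@Lone_flow _ _ R leb cb snd (g \_ I) lcb measurable_snd (fun=> preserves_id leb) lg).
apply: (LoneM _ _ l0 (M := 1)).
  by apply: measurable_le_indic.
by move=> z; rewrite ger0_norm// lern1 leq_b1.
Qed.

Let cut (s : R) : a < s < b ->
  g \_ `]a, s] = fun r => (g \_ I) r * (r <= s)%R%:R.
Proof.
move=> /andP[a_s sb]; apply/funext => r; rewrite !patchE /I !mem_setE !in_itv /=.
have [ar|ar] := boolP (a < r); last by rewrite mul0r.
have [rs|rs] := boolP (r <= s); last by rewrite mulr0.
by rewrite (le_lt_trans rs sb) mulr1.
Qed.

Let ae_neq (x : R) : {ae leb, forall s, s != x}.
Proof.
exists [set x]; split => //; first exact: lebesgue_measure_set1.
by move=> s /= /negP; rewrite negbK => /eqP.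
Qed.

(** Fubini on the triangle r <= s. Only the value T at the left end enters; at b the vanishing
    weight c b - c r takes the place of a trace. *)
Lemma slice_ibp :
  \int[leb]_s ((u \_ I) s * c' s) =
  T * (c b - c a) + \int[leb]_r ((g \_ I) r * (c b - c r)).
Proof.
have E1 : \int[leb]_s ((u \_ I) s * c' s) =
    \int[leb]_s (T * cb s + \int[leb]_r H (s, r)).
  apply: ae_eq_int.
  - exact: Lone_meas (Lone_sliceM lu).
  - exact: Lone_meas (LoneD (LoneZ T lcb) (Lone_fubini1 lH)).
  (* The end points are discarded as null sets: [cb] lives on the closed interval, the functions cut
     to [I] on the open one. *)
  apply: (ae_imp2 _ ug (ae_imp2 (fun s x y => conj x y) (ae_neq a) (ae_neq b))).
  move=> s us [sa sb].
  rewrite cbI patchE /I mem_setE in_itv /=; case: ifPn => abs; last first.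
    have cb0 : cb s = 0.
      rewrite /cb indic_itvcc; case: (boolP (a <= s <= b)); rewrite ?mul0r// => /andP[h1 h2].
      by move: abs; rewrite !lt_neqAle h1 h2 eq_sym sa sb.
    rewrite cb0 mul0r mulr0 add0r; symmetry.
    by under eq_Rintegral do rewrite /H /= cb0 !mul0r; exact: int0.
  rewrite us// mulrDl; congr (_ + _); rewrite mulrC -intZ; last first.
    rewrite cut//; apply: (LoneM _ _ lg (M := 1)).
      by apply: measurable_le_indic.
    by move=> r; rewrite ger0_norm// lern1 leq_b1.
  by apply: eq_Rintegral => r _; rewrite cut// mulrA.
rewrite E1 (intD (LoneZ T lcb) (Lone_fubini1 lH)).
rewrite intZ// int_indic_derive//; last exact: ltW.
rewrite (int_fubini1 lH) -(int_fubini2 lH); congr (_ + _).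
apply: eq_Rintegral => r _.
have [abr|abr] := boolP (a < r < b); last first.
  rewrite patchE /I mem_setE in_itv /= (negbTE abr) mul0r.
  under eq_Rintegral do rewrite /H /= patchE /I mem_setE in_itv /= (negbTE abr) mulr0 mul0r.
  exact: int0.
have rb : r <= b by rewrite ltW//; case/andP: abr.
have ar : a <= r by rewrite ltW//; case/andP: abr.
have E s : cb s * (r <= s)%R%:R = \1_`[r, b] s * c' s.
  rewrite /cb !indic_itvcc; have [rs|rs] := boolP (r <= s); last by rewrite mulr0 mul0r.
  by rewrite (le_trans ar rs) mulr1.
have lr : Lone leb (fun s => \1_`[r, b] s * c' s).
  rewrite -(eq_fun E); apply: (LoneM _ _ lcb (M := 1)).
    by apply: measurable_le_indic.
  by move=> s; rewrite ger0_norm// lern1 leq_b1.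
rewrite -(int_indic_derive rb dc cc) -intZ//.
by apply: eq_Rintegral => s _; rewrite -E /H /= mulrCA mulrA.
Qed.

End slice.

Lemma Lone_patchM d (T : measurableType d) (R : realType)
    (mu : {measure set T -> \bar R}) (D : set T) (h m : T -> R) (N : R) :
  measurable D -> Lone mu (h \_ D) -> measurable_fun setT m ->
  (forall y, D y -> `|m y| <= N) -> Lone mu (fun y => (h \_ D) y * m y).
Proof.
move=> mD lh mm bm.
have -> : (fun y => (h \_ D) y * m y) = (fun y => (h \_ D) y * (m \_ D) y).
  by apply/funext => y; rewrite !patchE; case: ifPn; rewrite ?mul0r.
apply: (LoneM _ _ lh (M := Num.max N 0)).
  by apply/(measurable_restrictT m mD); exact: measurable_funTS.
move=> y; rewrite patchE; case: ifPn => [/[1!inE] Dy|_].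
  by rewrite le_max bm.
by rewrite normr0 le_max lexx orbT.
Qed.

Lemma normrM_le {R : numDomainType} (x y a b : R) :
  `|x| <= a -> `|y| <= b -> `|x * y| <= a * b.
Proof. by move=> xa yb; rewrite normrM ler_pM. Qed.

(** * The limit of the cutoff identities *)

Section slab.
Context d (T : measurableType d) (R : realType).
Variable mu : {sigma_finite_measure set T -> \bar R}.
Notation leb := (@lebesgue_measure R).
Notation nu := (sfprod leb mu).
Variables (K : set T) (p q pe qe phi dphi : T -> R) (M : R) (u us ue : R * T -> R).

Definition slab := [set y : R * T | K y.2 /\ - p y.2 < y.1 < q y.2].

Definition slab_param (s : R) z := (s + p z) / (p z + q z).

(** Zero where n theta (1 - theta) <= 1, thus near both ends and beyond them, and tending to 1
    inside since [flat] tends to 1 at +oo. *)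
Definition slab_bump (n : nat) (s : R) z :=
  flat (n%:R * (slab_param s z * (1 - slab_param s z)) - 1).

Definition dslab_bump (n : nat) (s : R) z :=
  'D_1 (@flat R) (n%:R * (slab_param s z * (1 - slab_param s z)) - 1) *
  (n%:R * (1 - 2 * slab_param s z) / (p z + q z)).

(* gamma in the notation of the header. *)
Definition slab_speed (s : R) z := slab_param s z * (pe z + qe z) - pe z.

(** The s-derivative of [slab_speed], constant along a segment because theta is affine in s. *)
Definition slab_rate z := (pe z + qe z) / (p z + q z).

Local Notation D := slab.
Local Notation l z := (p z + q z).
Local Notation th := slab_param.
Local Notation chi := slab_bump.
Local Notation dchi := dslab_bump.
Local Notation gam := slab_speed.

Lemma is_derive_slab_param z (s : R) :
  is_derive s (1 : R) (th^~ z) (p z + q z)^-1.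
Proof.
have -> : th^~ z = (fun s : R => (p z + q z)^-1 *: (s + p z)).
  by apply/funext => r; rewrite /slab_param mulrC.
have D1 : is_derive s (1 : R) (fun s : R => s + p z) 1.
  rewrite -[X in is_derive _ _ _ X]addr0.
  exact: (is_deriveD (is_derive_id _ _) (is_derive_cst _ _ _)).
by have := is_deriveZ ((p z + q z)^-1) D1; rewrite [_ *: (1 : R)]mulr1.
Qed.

Lemma is_derive_slab_bump n z (s : R) :
  is_derive s (1 : R) (fun s => chi n s z) (dchi n s z).
Proof.
have Dt := is_derive_slab_param z s.
have Db : is_derive s (1 : R) (fun s => n%:R * (th s z * (1 - th s z)) - 1)
    (n%:R * (1 - 2 * th s z) / l z).
  have D1 := is_deriveB (is_derive_cst (1 : R) s (1 : R)) Dt.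
  have D2 := is_deriveB (is_deriveZ n%:R (is_deriveM Dt D1))
    (is_derive_cst (1 : R) s (1 : R)).
  rewrite (_ : (fun s0 => _) = n%:R \*: ((th^~ z) * (cst 1 - th^~ z)) - cst 1)//.
  apply: is_derive_eq.
  rewrite (_ : (cst 1 - th^~ z) s = 1 - th s z)// /GRing.scale /=.
  by move: (th s z) (p z + q z)^-1 => t k; ring.
have Df : is_derive (n%:R * (th s z * (1 - th s z)) - 1) (1 : R) flat
    ('D_1 flat (n%:R * (th s z * (1 - th s z)) - 1)).
  by apply: derivable_is_derive; exact: smooth_derivable smooth_flat.
have := @is_derive1_comp R flat (fun s => n%:R * (th s z * (1 - th s z)) - 1) s _ _ Df Db.
by rewrite /dslab_bump.
Qed.

Lemma is_derive_slab_speed z (s : R) :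
  is_derive s (1 : R) (fun s => gam s z) (slab_rate z).
Proof.
have Dt := is_derive_slab_param z s.
have D2 := is_deriveB (is_deriveZ (pe z + qe z) Dt) (is_derive_cst (pe z) s (1 : R)).
rewrite (_ : (fun s => gam s z) = (pe z + qe z) \*: th^~ z - cst (pe z)).
  by apply: is_derive_eq; rewrite subr0.
by apply/funext => r; rewrite /slab_speed mulrC.
Qed.

Let continuous_th z : continuous (th^~ z).
Proof.
move=> s; apply: cvgM; last exact: cvg_cst.
by apply: cvgD; [exact: cvg_id|exact: cvg_cst].
Qed.

Let continuous_arg n z :
  continuous (fun s => n%:R * (th s z * (1 - th s z)) - 1).
Proof.
move=> s; apply: cvgB; last exact: cvg_cst.
apply: cvgM; first exact: cvg_cst.
apply: cvgM; first exact: continuous_th.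
by apply: cvgB; [exact: cvg_cst|exact: continuous_th].
Qed.

Let continuous_chi n z : continuous (fun s => chi n s z).
Proof.
move=> s; apply: (continuous_at_comp (g := fun s => n%:R * (th s z * (1 - th s z)) - 1)
    (f := flat)); first exact: continuous_arg.
exact: continuous_flat.
Qed.

Let continuous_dflat : continuous ('D_1 (@flat R)).
Proof. exact: smooth_continuous (smooth_derive _ smooth_flat). Qed.

Let continuous_dchi n z : continuous (fun s => dchi n s z).
Proof.
move=> s; apply: cvgM.
  apply: (continuous_at_comp (g := fun s => n%:R * (th s z * (1 - th s z)) - 1)
    (f := 'D_1 flat)); first exact: continuous_arg.
  exact: continuous_dflat.
apply: cvgM; last exact: cvg_cst.
apply: cvgM; first exact: cvg_cst.
apply: cvgB; first exact: cvg_cst.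
by apply: cvgM; [exact: cvg_cst|exact: continuous_th].
Qed.

Let continuous_gam z : continuous (fun s => gam s z).
Proof.
move=> s; apply: cvgB; last exact: cvg_cst.
by apply: cvgM; [exact: continuous_th|exact: cvg_cst].
Qed.

Hypotheses (mK : measurable K) (mp : measurable_fun setT p)
  (mq : measurable_fun setT q) (mpe : measurable_fun setT pe)
  (mqe : measurable_fun setT qe) (mphi : measurable_fun setT phi)
  (mdphi : measurable_fun setT dphi)
  (mil : measurable_fun setT (fun z => (p z + q z)^-1)).
Hypotheses (l0 : forall z, K z -> 0 < l z)
  (bl : forall z, K z -> (l z)^-1 <= M)
  (bpe : forall z, K z -> `|pe z| <= M) (bqe : forall z, K z -> `|qe z| <= M)
  (bphi : forall z, `|phi z| <= M) (bdphi : forall z, `|dphi z| <= M).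

Let m1 (h : T -> R) : measurable_fun setT h -> measurable_fun setT (fun y : R * T => h y.2).
Proof. by move=> mh; apply: (measurableT_comp mh). Qed.

Lemma measurable_slab : measurable D.
Proof.
have -> : D = [set y | K y.2] `&` ([set y | - p y.2 < y.1] `&` [set y | y.1 < q y.2]).
  by apply/seteqP; split => y; rewrite /slab /= => -[Ky]; [move=> /andP[? ?]|case=> -> ->].
apply: measurableI.
  have := @measurable_snd _ _ R T measurableT _ mK; rewrite setTI; exact.
have lt (f g : R * T -> R) : measurable_fun setT f -> measurable_fun setT g ->
    measurable [set y : R * T | f y < g y].
  move=> mf mg; rewrite (_ : [set y | _] = setT `&` (fun y => f y < g y) @^-1` [set true]).
    exact: (measurable_fun_ltr mf mg).
  by rewrite setTI.
apply: measurableI; apply: lt => //; last exact: m1.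
by apply: measurableT_comp => //; exact: m1.
Qed.

Let mth : measurable_fun setT (fun y : R * T => th y.1 y.2).
Proof.
apply: measurable_funM.
  by apply: measurable_funD => //; exact: m1.
exact: (m1 mil).
Qed.

Let mle : measurable_fun setT (fun y : R * T => pe y.2 + qe y.2).
Proof. by apply: measurable_funD; exact: m1. Qed.

Lemma measurable_slab_speed : measurable_fun setT (fun y : R * T => gam y.1 y.2).
Proof.
apply: measurable_funB; last exact: m1.
exact: measurable_funM.
Qed.

Lemma measurable_slab_rate : measurable_fun setT (fun y : R * T => slab_rate y.2).
Proof.
apply: measurable_funM => //.
exact: (m1 mil).
Qed.

Let marg n : measurable_fun setT
  (fun y : R * T => n%:R * (th y.1 y.2 * (1 - th y.1 y.2)) - 1).
Proof.
apply: measurable_funB => //; apply: measurable_funM => //.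
by apply: measurable_funM => //; exact: measurable_funB.
Qed.

Lemma measurable_slab_bump n : measurable_fun setT (fun y : R * T => chi n y.1 y.2).
Proof.
have mf : measurable_fun setT (@flat R).
  exact: continuous_measurable_fun continuous_flat.
exact: measurableT_comp mf (marg n).
Qed.

Lemma measurable_dslab_bump n : measurable_fun setT (fun y : R * T => dchi n y.1 y.2).
Proof.
apply: measurable_funM.
  have mf : measurable_fun setT ('D_1 (@flat R)).
    exact: continuous_measurable_fun continuous_dflat.
  exact: measurableT_comp mf (marg n).
apply: measurable_funM.
  apply: measurable_funM => //; apply: measurable_funB => //.
  exact: measurable_funM.
exact: (m1 mil).
Qed.

Lemma slab_param01 y : D y -> 0 < th y.1 y.2 < 1.
Proof.
move=> [Ky /andP[ps sq]]; rewrite /slab_param; have l0y := l0 Ky.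
rewrite divr_gt0//=; last by lra.
by rewrite ltr_pdivrMr// mul1r; lra.
Qed.

Let bth y : D y -> `|th y.1 y.2| <= 1.
Proof. by move=> /slab_param01 /andP[h0 h1]; rewrite ger0_norm ltW. Qed.

Let ble y : D y -> `|pe y.2 + qe y.2| <= 2 * M.
Proof.
move=> [Ky _]; apply: le_trans (ler_normD _ _) _.
by have := bpe Ky; have := bqe Ky; lra.
Qed.

Lemma slab_speed_le y : D y -> `|gam y.1 y.2| <= 3 * M.
Proof.
move=> Dy; have [Ky _] := Dy; apply: le_trans (ler_normB _ _) _.
have : `|th y.1 y.2 * (pe y.2 + qe y.2)| <= 2 * M.
  rewrite normrM; apply: le_trans (ble Dy).
  by rewrite ler_piMl// bth.
by have := bpe Ky; lra.
Qed.

Let bil y : D y -> `|(l y.2)^-1| <= M.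
Proof. by move=> [Ky _]; rewrite ger0_norm ?bl// invr_ge0 ltW// l0. Qed.

Lemma slab_rate_le y : D y -> `|slab_rate y.2| <= 2 * M * M.
Proof. by move=> Dy; rewrite normrM ler_pM// ?ble// bil. Qed.

Lemma slab_bump_off n (s : R) z : K z -> n%:R * (th s z * (1 - th s z)) <= 1 ->
  chi n s z = 0 /\ dchi n s z = 0.
Proof.
move=> Kz a1; rewrite /slab_bump /dslab_bump.
have a0 : n%:R * (th s z * (1 - th s z)) - 1 <= 0 by rewrite subr_le0.
(* The derivative of [flat] is again a [flat_poly], hence zero on the nonpositive half-line. *)
have [_ ->] := is_derive_flat_poly 1 (n%:R * (th s z * (1 - th s z)) - 1).
by rewrite flat_eq0// /flat_poly ltNge a0 mul0r.
Qed.

Lemma slab_inP (s : R) z : K z -> 0 < th s z * (1 - th s z) -> D (s, z).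
Proof.
move=> Kz; have lz := l0 Kz; have il : 0 < (l z)^-1 by rewrite invr_gt0.
rewrite /slab_param => H; split => //=.
have : 0 < (s + p z) * (q z - s).
  have -> : (s + p z) * (q z - s) = (s + p z) / l z * (1 - (s + p z) / l z) * (l z * l z).
    by field; rewrite gt_eqF.
  by rewrite mulr_gt0// mulr_gt0.
by move=> H2; apply/andP; split; nra.
Qed.

Lemma slab_bump_le1 n (s : R) z : `|chi n s z| <= 1.
Proof. by rewrite ger0_norm ?flat_le1// flat_ge0. Qed.

(** The bound may depend on n: it only ensures integrability, the derivative of the cutoff being
    removed before n -> oo. On the slab the argument of [flat] lies in [-1, n]. *)
Lemma dslab_bump_le n : exists N : R, forall y, D y -> `|dchi n y.1 y.2| <= N.
Proof.
have n0 : (-1 : R) <= n%:R by apply: (@le_trans _ _ 0); rewrite ?ler0n// lerN10.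
have cn : {within `[(-1 : R), n%:R], continuous (fun x => `|'D_1 (@flat R) x|)}.
  apply: continuous_subspaceT => x.
  exact: (continuous_at_comp (f := fun x : R => `|x|) (@continuous_dflat x) (@norm_continuous _ _ _)).
have [x0 _ H] := EVT_max n0 cn.
exists (`|'D_1 (@flat R) x0| * (n%:R * 1 * M)) => y Dy.
have /andP[t0 t1] := slab_param01 Dy; have n1 : (0 : R) <= n%:R by exact: ler0n.
rewrite /dslab_bump normrM; apply: ler_pM => //.
  apply: H; rewrite in_itv /=; move: (th _ _) t0 t1 => t t0 t1.
  have b0 : 0 <= t * (1 - t) by apply: mulr_ge0; lra.
  have b1 : t * (1 - t) <= 1 by nra.
  apply/andP; split; last by have := ler_wpM2l n1 b1; lra.
  by rewrite lerDr mulr_ge0.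
rewrite !normrM; apply: ler_pM => //; last exact: bil.
apply: ler_pM => //; first by rewrite ger0_norm.
by rewrite ler_norml; apply/andP; split; lra.
Qed.

Let mchi := measurable_slab_bump.
Let mdchi := measurable_dslab_bump.
Let mgam := measurable_slab_speed.
Let mrate := measurable_slab_rate.
Let bchi := slab_bump_le1.

Hypotheses (lu : Lone nu (u \_ D)) (lus : Lone nu (us \_ D))
  (lue : Lone nu (ue \_ D)).
(** The weak derivative along e at fixed s, where the e-derivative of the cutoff is already
    expressed as - gamma times its s-derivative. *)
Hypothesis transport : forall n (s : R),
  \int[mu]_z ((u \_ D) (s, z) * (chi n s z * dphi z - gam s z * dchi n s z * phi z)) =
  - \int[mu]_z ((ue \_ D) (s, z) * (chi n s z * phi z)).
(** Only functions c vanishing at both ends are tested, so no trace appears; the case of interest is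
    c = gamma chi_n. *)
Hypothesis slices : {ae mu, forall z, K z -> forall c c' : R -> R,
  (forall s : R, is_derive s (1 : R) c (c' s)) -> continuous c' ->
  c (- p z) = 0 -> c (q z) = 0 ->
  \int[leb]_s ((u \_ D) (s, z) * c' s) = - \int[leb]_s ((us \_ D) (s, z) * c s)}.

Definition slab_density (y : R * T) :=
  (ue \_ D) y + (us \_ D) y * gam y.1 y.2 + (u \_ D) y * slab_rate y.2.

Let LM (h m : R * T -> R) N : Lone nu (h \_ D) -> measurable_fun setT m ->
  (forall y, D y -> `|m y| <= N) -> Lone nu (fun y => (h \_ D) y * m y).
Proof. exact: (@Lone_patchM _ _ R nu D h m N measurable_slab). Qed.

Local Notation G := slab_density.

Let lchi n h : Lone nu h -> Lone nu (fun y => h y * chi n y.1 y.2).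
Proof.
move=> lh; apply: (@LoneM _ _ R nu h _ 1 _ _ lh); first exact: measurable_slab_bump.
by move=> y; exact: slab_bump_le1.
Qed.

Lemma Lone_slab_density : Lone nu G.
Proof.
have l1 := LM lus measurable_slab_speed slab_speed_le.
have l2 := LM lu measurable_slab_rate slab_rate_le.
have l3 := LoneD lue l1.
exact: LoneD l3 l2.
Qed.

Let In n (y : R * T) :=
  (u \_ D) y * (chi n y.1 y.2 * dphi y.2 - gam y.1 y.2 * dchi n y.1 y.2 * phi y.2) +
  (ue \_ D) y * (chi n y.1 y.2 * phi y.2).

Let En (y : R * T) := G y * phi y.2 + (u \_ D) y * dphi y.2.

Let lEn : Lone nu En.
Proof.
apply: LoneD.
  by apply: (LoneM _ _ Lone_slab_density (M := M)) => //; exact: m1.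
by apply: (LoneM _ _ lu (M := M)) => //; exact: m1.
Qed.

Let lI1 n : Lone nu (fun y => (u \_ D) y *
  (chi n y.1 y.2 * dphi y.2 - gam y.1 y.2 * dchi n y.1 y.2 * phi y.2)).
Proof.
have [N HN] := dslab_bump_le n.
apply: (LM lu (N := 1 * M + 3 * M * N * M)).
  apply: measurable_funB; first by apply: measurable_funM => //; exact: m1.
  apply: measurable_funM; last exact: m1.
  exact: measurable_funM.
move=> y Dy; apply: le_trans (ler_normB _ _) _.
by apply: lerD; do ?[apply: normrM_le => //]; [exact: slab_speed_le|exact: HN].
Qed.

Let lI2 n : Lone nu (fun y => (ue \_ D) y * (chi n y.1 y.2 * phi y.2)).
Proof.
apply: (LM lue (N := 1 * M)).
  by apply: measurable_funM => //; exact: m1.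
by move=> y Dy; apply: normrM_le.
Qed.

Let int_In n : \int[nu]_y In n y = 0.
Proof.
have lI := LoneD (lI1 n) (lI2 n).
rewrite -(int_fubini1 lI) -[RHS](@int0 _ _ R leb).
apply: ae_eq_int => //; first exact: Lone_meas (Lone_fubini1 lI).
apply: ae_imp2 (ae_Lone1 (lI1 n)) (ae_Lone1 (lI2 n)) => s l1 l2.
by rewrite (intD l1 l2) /= transport addNr.
Qed.

(** On each segment the integrands here and in [int_In] differ by phi z times u c' + u_s c with c =
    gamma chi_n. This integrates to zero by [slices], as chi_n, hence c, vanishes at both ends. *)
Let int_Jn n : \int[nu]_y (En y * chi n y.1 y.2) = 0.
Proof.
have lI := LoneD (lI1 n) (lI2 n).
have lJ : Lone nu (fun y => En y * chi n y.1 y.2).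
  exact: lchi.
have [N HN] := dslab_bump_le n.
have lA : Lone nu (fun y => (u \_ D) y *
    (slab_rate y.2 * chi n y.1 y.2 + gam y.1 y.2 * dchi n y.1 y.2)).
  apply: (LM lu (N := 2 * M * M * 1 + 3 * M * N)).
    by apply: measurable_funD; exact: measurable_funM.
  move=> y Dy; apply: le_trans (ler_normD _ _) _.
  by apply: lerD; apply: normrM_le => //; [exact: slab_rate_le|exact: slab_speed_le|exact: HN].
have lB : Lone nu (fun y => (us \_ D) y * (gam y.1 y.2 * chi n y.1 y.2)).
  apply: (LM lus (N := 3 * M * 1)); first exact: measurable_funM.
  by move=> y Dy; apply: normrM_le => //; exact: slab_speed_le.
rewrite -(int_fubini2 lJ) -(int_In n) -(int_fubini2 lI).
apply: ae_eq_int.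
- exact: Lone_meas (Lone_fubini2 lJ).
- exact: Lone_meas (Lone_fubini2 lI).
apply: (ae_imp2 _ slices (ae_imp2 (fun z x y => conj x y) (ae_Lone2 lI)
  (ae_imp2 (fun z x y => conj x y) (ae_Lone2 lA) (ae_Lone2 lB)))).
move=> z Hz [l1 [l2 l3]] /=.
have EJ s : En (s, z) * chi n s z = In n (s, z) + phi z *
   ((u \_ D) (s, z) * (slab_rate z * chi n s z + gam s z * dchi n s z) +
    (us \_ D) (s, z) * (gam s z * chi n s z)).
  by rewrite /En /In /slab_density /=; ring.
under eq_Rintegral do rewrite EJ.
rewrite (intD l1 (LoneZ _ (LoneD l2 l3))) (intZ _ (LoneD l2 l3)) (intD l2 l3) /=.
have [Kz|nKz] := pselect (K z); last first.
  have D0 (h : R * T -> R) s : (h \_ D) (s, z) = 0.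
    by rewrite patchE memNset// => -[].
  have Z (h : R * T -> R) (m : R -> R) : \int[leb]_s ((h \_ D) (s, z) * m s) = 0.
    by under eq_Rintegral do rewrite D0 mul0r; exact: int0.
  by rewrite !Z addr0 mulr0 addr0.
pose c s := gam s z * chi n s z.
pose c' s := slab_rate z * chi n s z + gam s z * dchi n s z.
have Dc (s : R) : is_derive s (1 : R) c (c' s).
  have [Dd Ed] := is_deriveM (is_derive_slab_speed z s) (is_derive_slab_bump n z s).
  by apply: (DeriveDef Dd); rewrite Ed /c' /GRing.scale /= addrC [chi _ _ _ * _]mulrC.
have cc : continuous c'.
  move=> s; apply: cvgD; apply: cvgM.
  - exact: cvg_cst.
  - exact: continuous_chi.
  - exact: continuous_gam.
  - exact: continuous_dchi.
have cp : c (- p z) = 0.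
  by rewrite /c /slab_bump /slab_param addNr !mul0r mulr0 sub0r flat_eq0 ?mulr0.
have cq : c (q z) = 0.
  have ln0 : l z != 0 by rewrite gt_eqF// l0.
  rewrite /c /slab_bump /slab_param [q z + p z]addrC divff//.
  by rewrite subrr mulr0 mulr0 sub0r flat_eq0 ?mulr0.
by rewrite (Hz Kz c c' Dc cc cp cq) addNr mulr0 addr0.
Qed.

(** The cutoffs are bounded by 1 and tend to 1 on the slab, so [int_Jn] passes to the limit; the
    derivative of the cutoff no longer occurs in it. *)
Lemma slab_identity :
  \int[mu]_z ((\int[leb]_s (u \_ D) (s, z)) * dphi z) =
  - \int[mu]_z ((\int[leb]_s G (s, z)) * phi z).
Proof.
have lJ n : Lone nu (fun y => En y * chi n y.1 y.2).
  exact: lchi.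
have [|||||_ C] := @int_dct _ _ _ nu (fun n y => En y * chi n y.1 y.2) En
    (fun y => `|En y|).
- by move=> n; exact: Lone_meas (lJ n).
- exact: Lone_meas lEn.
- apply: aeW => y; have [Dy|nDy] := pselect (D y); last first.
    have -> : En y = 0.
      by rewrite /En /slab_density !patchE !memNset// !mul0r !addr0 mul0r.
    by under eq_fun do rewrite mul0r; exact: cvg_cst.
  rewrite -[X in _ --> X]mulr1; apply: cvgM; first exact: cvg_cst.
  have /andP[t0 t1] := slab_param01 Dy.
  have b0 : 0 < th y.1 y.2 * (1 - th y.1 y.2) by apply: mulr_gt0 => //; lra.
  apply: cvg_comp (@cvg_flat_pinfty R).
  apply/cvgryPge => A.
  have := nbhs_infty_ger ((A + 1) / (th y.1 y.2 * (1 - th y.1 y.2))).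
  by apply: filterS => n; rewrite ler_pdivrMr//; lra.
- exact: Lone_norm lEn.
- by move=> n y; rewrite normrM ler_piMr// slab_bump_le1.
have E0 : \int[nu]_y En y = 0.
  have E : (fun n => \int[nu]_y (En y * chi n y.1 y.2)) = fun=> 0.
    by apply/funext => n; exact: int_Jn.
  rewrite E in C; have := cvg_lim (@Rhausdorff R) C.
  by rewrite lim_cst// => <-.
have lF := Lone_fubini2 lu; have lG := Lone_fubini2 Lone_slab_density.
have lF' := LoneM mdphi bdphi lF; have lG' := LoneM mphi bphi lG.
apply/eqP; rewrite -subr_eq0 opprK -(intD lF' lG') -E0 -(int_fubini2 lEn).
apply/eqP; apply: ae_eq_int.
- exact: Lone_meas (LoneD lF' lG').
- exact: Lone_meas (Lone_fubini2 lEn).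
apply: ae_imp2 (ae_Lone2 lu) (ae_Lone2 Lone_slab_density) => z l1 l2.
have EE s : En (s, z) = dphi z * (u \_ D) (s, z) + phi z * G (s, z).
  by rewrite /En addrC mulrC; congr (_ + _); rewrite mulrC.
under [RHS]eq_Rintegral do rewrite EE.
rewrite (intD (LoneZ _ l1) (LoneZ _ l2)) (intZ _ l1) (intZ _ l2).
by rewrite mulrC; congr (_ + _); rewrite mulrC.
Qed.

End slab.

(** Each Phi (s, .) pulls the exceptional set back to a null set, and Fubini for its indicator
    exchanges the roles of s and z. The windows |s| <= n supply the integrable time weight asked by
    [Lone_flow]. *)
Lemma ae_flow_swap d (T : measurableType d) (R : realType)
    (mu : {sigma_finite_measure set T -> \bar R}) (Phi : R * T -> T) (P : T -> Prop) :
  measurable_fun setT Phi -> (forall s, preserves mu (fun w => Phi (s, w))) ->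
  {ae mu, forall z, P z} ->
  {ae mu, forall z, {ae (@lebesgue_measure R), forall s, P (Phi (s, z))}}.
Proof.
move=> mPhi pPhi [N [mN N0 PN]]; pose leb := @lebesgue_measure R.
have N1 : {ae mu, forall z, \1_N z = 0 :> R}.
  exists N; split => // z /= nz; apply: contrapT => nN; apply: nz.
  by rewrite indicE memNset.
have l1 : Lone mu (\1_N : T -> R).
  apply: (@ae_eq_Lone _ _ _ mu (fun=> 0) _ (measurable_indic mN) _ (Lone0 mu)).
  by apply: ae_imp N1 => z ->.
pose H n (y : R * T) := \1_`[- n%:R, n%:R] y.1 * (\1_N (Phi y) : R).
have lH n : Lone (sfprod leb mu) (H n).
  exact: (@Lone_flow _ _ R mu _ Phi _ (Lone_indic_itv (- n%:R) n%:R) mPhi pPhi l1).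
have H0 n y : 0 <= H n y by rewrite mulr_ge0// indicE.
have Hs n : {ae mu, forall z, {ae leb, forall s, H n (s, z) = 0}}.
  have F0 z : 0 <= \int[leb]_s H n (s, z) by apply: Rintegral_ge0.
  have I0 : \int[mu]_z `|\int[leb]_s H n (s, z)| = 0.
    under eq_Rintegral do rewrite ger0_norm//.
    rewrite (int_fubini2 (lH n)) -(int_fubini1 (lH n)) -[RHS](@int0 _ _ R leb).
    apply: eq_Rintegral => s _; rewrite -[RHS](@int0 _ _ R mu).
    apply: ae_eq_int.
    - exact: measurable_fun_pair2 s (Lone_meas (lH n)).
    - exact: measurable_cst.
    - by have := preserves_ae (pPhi s) N1; apply: ae_imp => z; rewrite /H => ->; rewrite mulr0.
  have := (int_norm_eq0 (Lone_fubini2 (lH n))).2 I0.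
  apply: ae_imp2 (ae_Lone2 (lH n)) => z lz z0.
  apply/(int_norm_eq0 lz); rewrite -[RHS]z0.
  by apply: eq_Rintegral => s _; rewrite ger0_norm.
have := ae_countable Hs; apply: ae_imp => z Hz.
have := ae_countable Hz; apply: ae_imp => s Hsz.
apply: contrapT => nP; have NPhi : N (Phi (s, z)) by exact: PN.
have := Hsz (Num.truncn `|s|).+1; rewrite /H /= indic_itvcc indicE mem_set// mulr1.
have -> : - (Num.truncn `|s|).+1%:R <= s <= (Num.truncn `|s|).+1%:R.
  by rewrite -ler_norml ltW// truncnS_gt.
by move/eqP; rewrite oner_eq0.
Qed.

(** Sigma-compactness of O: each point lies in the positivity set of one of countably many bumps
    with compact support in O. *)
Lemma ae_on_open7 {R : realType} (O : set (txv R)) (P : txv R -> Prop) : open O ->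
  (forall K, compact K -> K `<=` O -> {ae @leb7 R, forall z, K z -> P z}) ->
  {ae @leb7 R, forall z, O z -> P z}.
Proof.
move=> oO H; have [sk uk bk] := local_bumps_fam7 (R := R).
pose good i C := [/\ compact C, C `<=` O & forall y, ~ C y -> fam7 bump i y = 0 :> R].
have Hi i : {ae @leb7 R, forall z, 0 < fam7 bump i z :> R -> (exists C, good i C) -> P z}.
  have [[C gC]|nC] := pselect (exists C, good i C); last by apply: aeW => z _ /nC.
  have [cC CO C0] := gC; have := H C cC CO; apply: ae_imp => z Pz kz _; apply: Pz.
  by apply: contrapT => /C0 E; rewrite E ltxx in kz.
have := ae_countable Hi; apply: ae_imp => z Hz Oz.
have [|i [ki gi]] := bk z O; first by exact: open_nbhs_nbhs.
exact: Hz ki gi.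
Qed.

Lemma coord3_le_norm {R : realType} (x : R3 R) i : `|coord3 x i| <= `|x|.
Proof.
case: x => [[a b] c]; rewrite /coord3 /= !prod_normE /=.
by case: i => [[|[|[|//]]] i3] /=; rewrite !le_max lexx ?orbT.
Qed.

Lemma dot3D {R : realType} (x y y' : R3 R) : dot3 x (y + y') = dot3 x y + dot3 x y'.
Proof. by rewrite /dot3 -big_split; apply: eq_bigr => i _; rewrite coord3D mulrDr. Qed.

Lemma dot3Z {R : realType} (k : R) (x y : R3 R) : dot3 x (k *: y) = k * dot3 x y.
Proof. by rewrite /dot3 mulr_sumr; apply: eq_bigr => i _; rewrite coord3Z mulrCA. Qed.

Lemma dot3C {R : realType} (x y : R3 R) : dot3 x y = dot3 y x.
Proof. by apply: eq_bigr => i _; rewrite mulrC. Qed.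

Lemma dot7D {R : realType} (z w w' : txv R) : dot7 z (w + w') = dot7 z w + dot7 z w'.
Proof.
rewrite /dot7 /= !dot3D mulrDr.
by move: (dot3 _ _) (dot3 _ _) (dot3 _ _) (dot3 _ _) => a b c d; ring.
Qed.

Lemma dot7Z {R : realType} (k : R) (z w : txv R) : dot7 z (k *: w) = k * dot7 z w.
Proof. by rewrite /dot7 /= !dot3Z !mulrDr mulrCA. Qed.

Lemma dot7C {R : realType} (z w : txv R) : dot7 z w = dot7 w z.
Proof. by rewrite /dot7 mulrC; congr (_ + _ + _); exact: dot3C. Qed.

(** In contrast with [preserves_int], measurability is enough: positive and negative parts keep
    their integrals, finite or not. *)
Lemma preserves_Rint d (T : measurableType d) (R : realType)
    (mu : {measure set T -> \bar R}) (phi : T -> T) (g : T -> R) :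
  preserves mu phi -> measurable_fun setT g ->
  \int[mu]_x g (phi x) = \int[mu]_x g x.
Proof.
move=> [mphi H] mg; have mE : measurable_fun setT (EFin \o g) by exact/measurable_EFinP.
rewrite /Rintegral; congr fine; rewrite [LHS]integralE [RHS]integralE; congr (_ - _)%E.
  have <- := H ((EFin \o g)^\+)%E (measurable_funepos mE) (fun x => funepos_ge0 _ x).
  by apply: eq_integral => x _; rewrite !funeposE.
have <- := H ((EFin \o g)^\-)%E (measurable_funeneg mE) (fun x => funeneg_ge0 _ x).
by apply: eq_integral => x _; rewrite !funenegE.
Qed.

Lemma locint_measurable {R : realType} (O : set (txv R)) (h : txv R -> R) :
  open O -> locint O h -> measurable_fun setT (h \_ O).
Proof.
move=> oO lh; have [sk uk bk] := local_bumps_fam7 (R := R).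
pose good i (C : set (txv R)) := [/\ compact C, C `<=` O &
  forall y, ~ C y -> fam7 bump i y = 0 :> R].
apply/(measurable_restrictT h (open_measurable7 oO)) => _ Y mY.
pose A i := [set z | (exists C, good i C) /\ 0 < fam7 bump i z :> R /\ Y (h z)].
rewrite (_ : O `&` h @^-1` Y = \bigcup_i A i).
  apply: countable_bigcupT_measurable => [|i]; first exact: countableP.
  have [[C gC]|nC] := pselect (exists C, good i C); last first.
    by rewrite (_ : A i = set0)//; apply/seteqP; split => x // -[].
  have [cC CO C0] := gC.
  rewrite (_ : A i = (fam7 bump i @^-1` `]0, +oo[) `&` (h \_ C) @^-1` Y).
    apply: measurableI.
      rewrite -[X in measurable X]setTI.
      by apply: measurable_fam7 => //; exact: measurable_bump.
    by rewrite -[X in measurable X]setTI; apply: (Lone_meas (lh C cC CO)).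
  have inC z : 0 < fam7 bump i z :> R -> C z.
    by move=> kz; apply: contrapT => /C0 E; rewrite E ltxx in kz.
  apply/seteqP; split => z /=; rewrite in_itv/= andbT.
    by move=> [_ [kz Yz]]; split => //; rewrite patchE mem_set//; exact: inC.
  move=> [kz]; rewrite patchE mem_set; last exact: inC.
  by move=> Yz; split; [exists C|split].
apply/seteqP; split => z /=.
  move=> [Oz Yz]; have [|i [ki gi]] := bk z O; first by exact: open_nbhs_nbhs.
  by exists i.
move=> [i _ [[C [cC CO C0]] /= [ki Yz]]]; split => //; apply: CO.
by apply: contrapT => /C0 E; rewrite E ltxx in ki.
Qed.

(** * Transport along a segment *)

Lemma shear_shuffle (R : comNzRingType) (V : lmodType R) (x v b c : V) (t s k : R) :
  x + t *: (b + (s * k) *: c) - s *: (v + t *: (k *: c)) = x - s *: v + t *: b.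
Proof.
rewrite !scalerDr !scalerA (_ : s * t * k = t * (s * k)); last by rewrite [s * t]mulrC mulrA.
by rewrite opprD [x + (_ + _)]addrA addrACA subrr addr0 addrAC.
Qed.

Lemma is_derive_lineP {R : realType} (V : normedModType R) (F : V -> R) (z v : V) (d : R) :
  is_derive z v F d <-> is_derive (0 : R) (1 : R) (fun t => F (z + t *: v)) d.
Proof.
rewrite is_derive_cvgP is_derive1_cvgP.
have -> // : (fun h : R => h^-1 * (F (z + (0 + h) *: v) - F (z + (0 : R) *: v))) =
  (fun h => h^-1 * (F (z + h *: v) - F z)).
by apply/funext => h; rewrite add0r scale0r addr0.
Qed.

Lemma compact_superlevel (T : topologicalType) (R : realType) (K : set T) (a : T -> R) (c : R) :
  compact K -> (forall z, K z -> {for z, continuous a}) ->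
  compact (K `&` [set z | c <= a z]).
Proof.
move=> cK ca F PF FK.
have FK1 : F K by apply: filterS FK => z [].
have [z [Kz cz]] := cK F PF FK1; exists z; split => //; split => //=.
rewrite leNgt; apply/negP => az.
have N : nbhs z [set y | a y < c] by exact: (cvgr_lt _ (ca z Kz)).
by have [y [[_ /= yc]]] := cz _ _ FK N; rewrite ltNge yc.
Qed.

Lemma measurable_patch_open7 {R : realType} (U : set (txv R)) (g : txv R -> R) :
  open U -> (forall z, U z -> {for z, continuous g}) -> measurable_fun setT (g \_ U).
Proof.
move=> oU cg; apply/(measurable_restrictT g (open_measurable7 oU)).
apply: (measurability _ (RGenInftyO.measurableE R)) => //.
move=> _ [_ [x ->] <-]; apply: open_measurable7.
rewrite openE => z [Uz gz]; apply: filterI; first exact: open_nbhs_nbhs.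
have : nbhs (g z) `]-oo, x[%classic by exact: open_nbhs_nbhs.
exact: cg.
Qed.

Section transport.
Context {R : realType}.
Notation W := (txv R).
Notation mu := (@leb7 R).
Notation leb := (@lebesgue_measure R).
Variables (xi : R3 R -> R) (Omega : set (R3 R)).
Hypothesis HO : convex_domain xi Omega.
Variables (j : nat) (e : W).
Notation U := (phase Omega).
Local Notation eps := ((-1) ^+ j : R).

Let oU : open U. Proof. exact: open_phase HO. Qed.

(* Extended by 0 off the phase space, these functions are measurable and the
   slab - bt < s < ft is empty there. *)
Definition bt := back_time Omega j \_ U.
Definition ft := fore_time Omega j \_ U.
Definition dl := delay Omega j \_ U.
Definition dbt := dback_time xi Omega e j \_ U.
Definition dft := dfore_time xi Omega e j \_ U.
Definition ddl := ddelay xi Omega e j \_ U.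

(** [along] with the delay extended by zero: for each s a measure-preserving bijection of the whole
    space, although it follows a segment of the trajectory only inside the slab. *)
Definition ride (s : R) (z : W) : W :=
  (z.1.1 - dl z + s, z.1.2 + s *: (eps *: z.2), eps *: z.2).

Lemma patch_in (V : pointedType) (g : W -> V) z : U z -> (g \_ U) z = g z.
Proof. by move=> Uz; rewrite patchE mem_set. Qed.

Lemma rideE s z : U z -> ride s z = along Omega j s z.
Proof. by move=> Uz; rewrite /ride /dl patch_in. Qed.

Lemma bt_gt0 z : U z -> 0 < bt z.
Proof. by move=> Uz; rewrite /bt patch_in//; exact: back_time_gt0 HO _ Uz j. Qed.

Lemma ft_ge0 z : U z -> 0 <= ft z.
Proof. by move=> Uz; rewrite /ft patch_in//; exact: fore_time_ge0 HO _ Uz j. Qed.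

Lemma ride_phase s z : U z -> - bt z < s < ft z -> U (ride s z).
Proof.
move=> Uz; rewrite /bt /ft !patch_in// rideE//.
exact: (along_phase HO Uz).
Qed.

Lemma ride_closed_phase s z : U z -> - bt z <= s <= ft z ->
  closed_phase xi Omega (ride s z).
Proof.
move=> Uz; rewrite /bt /ft !patch_in// rideE//.
exact: (along_closed_phase HO Uz).
Qed.

Let near_patch (g : W -> R) z : U z -> \near z, (g \_ U) z = g z.
Proof.
move=> Uz; have : nbhs z U by exact: open_nbhs_nbhs.
by apply: filterS => y Uy; rewrite patch_in.
Qed.

Let cont_patch (g : W -> R) z : U z -> {for z, continuous g} ->
  {for z, continuous (g \_ U)}.
Proof.
move=> Uz cg; rewrite /prop_for /continuous_at patch_in//.
apply: cvg_trans cg; apply: near_eq_cvg.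
have : nbhs z U by exact: open_nbhs_nbhs.
by apply: filterS => y Uy; rewrite patch_in.
Qed.

Lemma continuous_bt z : U z -> {for z, continuous bt}.
Proof. by move=> Uz; apply: cont_patch => //; exact: (@continuous_back_time _ _ _ HO _ Uz). Qed.
Lemma continuous_ft z : U z -> {for z, continuous ft}.
Proof. by move=> Uz; apply: cont_patch => //; exact: (@continuous_fore_time _ _ _ HO _ Uz). Qed.
Lemma continuous_dl z : U z -> {for z, continuous dl}.
Proof. by move=> Uz; apply: cont_patch => //; exact: (@continuous_delay _ _ _ HO _ Uz). Qed.
Lemma continuous_dbt z : U z -> {for z, continuous dbt}.
Proof. by move=> Uz; apply: cont_patch => //; exact: (@continuous_dback_time _ _ _ HO _ Uz). Qed.
Lemma continuous_dft z : U z -> {for z, continuous dft}.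
Proof. by move=> Uz; apply: cont_patch => //; exact: (@continuous_dfore_time _ _ _ HO _ Uz). Qed.
Lemma continuous_ddl z : U z -> {for z, continuous ddl}.
Proof. by move=> Uz; apply: cont_patch => //; exact: (@continuous_ddelay _ _ _ HO _ Uz). Qed.

Let meas_patch (g : W -> R) : (forall z, U z -> {for z, continuous g}) ->
  measurable_fun setT (g \_ U).
Proof. exact: measurable_patch_open7. Qed.

Lemma measurable_bt : measurable_fun setT bt.
Proof. by apply: meas_patch => z Uz; exact: (@continuous_back_time _ _ _ HO _ Uz). Qed.
Lemma measurable_ft : measurable_fun setT ft.
Proof. by apply: meas_patch => z Uz; exact: (@continuous_fore_time _ _ _ HO _ Uz). Qed.
Lemma measurable_dl : measurable_fun setT dl.
Proof. by apply: meas_patch => z Uz; exact: (@continuous_delay _ _ _ HO _ Uz). Qed.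
Lemma measurable_dbt : measurable_fun setT dbt.
Proof. by apply: meas_patch => z Uz; exact: (@continuous_dback_time _ _ _ HO _ Uz). Qed.
Lemma measurable_dft : measurable_fun setT dft.
Proof. by apply: meas_patch => z Uz; exact: (@continuous_dfore_time _ _ _ HO _ Uz). Qed.
Lemma measurable_ddl : measurable_fun setT ddl.
Proof. by apply: meas_patch => z Uz; exact: (@continuous_ddelay _ _ _ HO _ Uz). Qed.

Lemma measurable_ilength : measurable_fun setT (fun z => (bt z + ft z)^-1).
Proof.
(* Off the phase space the length is 0, and so is its inverse by convention. *)
have -> : (fun z => (bt z + ft z)^-1) = (fun z => (bt z + ft z)^-1) \_ U.
  apply/funext => z; rewrite patchE; case: ifPn => //; rewrite notin_setE => nU.
  by rewrite /bt /ft !patchE !memNset// addr0 invr0.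
apply: meas_patch => z Uz.
apply: cvgV; last by apply: cvgD; [exact: continuous_bt|exact: continuous_ft].
by rewrite gt_eqF// ltr_wpDr// ?bt_gt0// ft_ge0.
Qed.

Lemma is_derive_bt z : U z -> is_derive z e bt (dbt z).
Proof.
move=> Uz; rewrite /dbt patch_in//.
apply: near_eq_is_derive (is_derive_back_time HO Uz e j).
by have := near_patch (back_time Omega j) Uz; apply: filterS => y; exact: esym.
Qed.
Lemma is_derive_ft z : U z -> is_derive z e ft (dft z).
Proof.
move=> Uz; rewrite /dft patch_in//.
apply: near_eq_is_derive (is_derive_fore_time HO Uz e j).
by have := near_patch (fore_time Omega j) Uz; apply: filterS => y; exact: esym.
Qed.
Lemma is_derive_dl z : U z -> is_derive z e dl (ddl z).
Proof.
move=> Uz; rewrite /ddl patch_in//.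
apply: near_eq_is_derive (is_derive_delay HO Uz e j).
by have := near_patch (delay Omega j) Uz; apply: filterS => y; exact: esym.
Qed.

Lemma patch_shift (g : W -> R) t z : (forall t z, g (t, z.1.2, z.2) = g z) ->
  (g \_ U) (t, z.1.2, z.2) = (g \_ U) z.
Proof.
move=> gE; rewrite !patchE gE; congr (if _ then _ else _).
Qed.

Lemma bt_shift t z : bt (t, z.1.2, z.2) = bt z.
Proof. exact: patch_shift. Qed.
Lemma ft_shift t z : ft (t, z.1.2, z.2) = ft z.
Proof. by apply: patch_shift => {}t {}z; rewrite /fore_time; case: (j). Qed.
Lemma dl_shift t z : dl (t, z.1.2, z.2) = dl z.
Proof. by apply: patch_shift => {}t {}z; elim: (j) => //= n ->. Qed.
Lemma ddl_shift t z : ddl (t, z.1.2, z.2) = ddl z.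
Proof. by apply: patch_shift => {}t {}z; elim: (j) => //= n ->. Qed.

Let mtxv (d : measure_display) (T : measurableType d) (a : T -> R) (x v : T -> R3 R) :
  measurable_fun setT a -> measurable_fun setT x -> measurable_fun setT v ->
  measurable_fun setT (fun y => (a y, x y, v y)).
Proof. by move=> ma mx mv; apply: measurable_fun_pair => //; exact: measurable_fun_pair. Qed.

Lemma measurable_ride : measurable_fun setT (fun y : R * W => ride y.1 y.2).
Proof.
have m2 : measurable_fun setT (fun y : R * W => y.2) by exact: measurable_snd.
have m12 : measurable_fun setT (fun y : R * W => y.2.1) by exact: measurableT_comp.
have m22 : measurable_fun setT (fun y : R * W => eps *: y.2.2).
  by apply: measurable_fun_scaleR3 => //; exact: measurableT_comp.
apply: mtxv => //.
  apply: measurable_funD => //; apply: measurable_funB; first exact: measurableT_comp.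
  exact: measurableT_comp measurable_dl m2.
apply: measurable_fun_addR3; first exact: measurableT_comp.
exact: measurable_fun_scaleR3.
Qed.

(** The delay does not depend on t ([dl_shift]), so it may be evaluated at time 0 and [ride s] is a
    shear whose action on v is the sign eps. *)
Lemma preserves_ride s : preserves mu (ride s).
Proof.
have mdl : measurable_fun setT (fun y : R3 R * R3 R => s - dl (0, y.1, y.2)).
  apply: measurable_funB => //.
  have m : measurable_fun setT (fun y : R3 R * R3 R => (0, y.1, y.2) : W) by exact: mtxv.
  exact: measurableT_comp measurable_dl m.
have mz : measurable_fun setT (fun v : R3 R => s *: (eps *: v)).
  by apply: measurable_fun_scaleR3 => //; exact: measurable_fun_scaleR3.
have pb : preserves (@leb3 R) (fun v => eps *: v).
  rewrite -signr_odd; case: odd; rewrite ?expr1 ?expr0.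
    by under eq_fun do rewrite scaleN1r; exact: preserves_opp3.
  by under eq_fun do rewrite scale1r; exact: preserves_id.
have := preserves_shear mdl mz pb.
congr (preserves _ _); apply/funext => z; rewrite /ride.
by rewrite -(dl_shift 0 z) addrAC addrA.
Qed.

Lemma continuous_ride (y : R * W) : U y.2 ->
  {for y, continuous (fun y : R * W => ride y.1 y.2)}.
Proof.
move=> Uy.
have c1 : {for y, continuous (fun y : R * W => y.1)} by exact: cvg_fst.
have c2 : {for y, continuous (fun y : R * W => y.2)} by exact: cvg_snd.
have c21 : {for y, continuous (fun y : R * W => y.2.1)}.
  by apply: (continuous_at_comp (g := snd) (f := fst)); [exact: c2|exact: cvg_fst].
have c22 : {for y, continuous (fun y : R * W => eps *: y.2.2)}.
  apply: cvgZl_tmp.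
  by apply: (continuous_at_comp (g := snd) (f := snd)); [exact: c2|exact: cvg_snd].
apply: cvg_to_pair; last exact: c22.
apply: cvg_to_pair.
  apply: cvgD; last exact: c1.
  apply: cvgB.
    by apply: (continuous_at_comp (g := fun y : R * W => y.2.1) (f := fst));
      [exact: c21|exact: cvg_fst].
  by apply: (continuous_at_comp (g := snd) (f := dl)); [exact: c2|exact: continuous_dl].
apply: cvgD; last by apply: cvgZ; [exact: c1|exact: c22].
by apply: (continuous_at_comp (g := fun y : R * W => y.2.1) (f := snd));
  [exact: c21|exact: cvg_snd].
Qed.

Section on_compact.
Variable K : set W.
Hypotheses (cK : compact K) (KU : K `<=` U).
Local Notation D := (slab K bt ft).

Let mK : measurable K. Proof. exact: compact_measurable7. Qed.

Lemma measurable_ride_slab : measurable D.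
Proof. exact: (measurable_slab mK measurable_bt measurable_ft). Qed.

Lemma bounded_on_compact (g : W -> R) : (forall z, U z -> {for z, continuous g}) ->
  exists2 M : R, 0 <= M & forall z, K z -> `|g z| <= M.
Proof.
move=> cg; have cg' : {within K, continuous g}.
  by apply: continuous_in_subspaceT => z; rewrite inE => /KU; exact: cg.
have [M HM] := compact_bounded cK cg'.
exists (Num.max M 0); first by rewrite le_max lexx orbT.
by move=> z Kz; rewrite le_max HM.
Qed.

Lemma ride_bounds : exists2 M : R, 0 <= M & forall z, K z ->
  [/\ `|bt z| <= M, `|ft z| <= M & (bt z + ft z)^-1 <= M] /\
  [/\ `|dbt z| <= M, `|dft z| <= M & `|ddl z| <= M].
Proof.
have [M1 M10 H1] := bounded_on_compact continuous_bt.
have [M2 M20 H2] := bounded_on_compact continuous_ft.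
have [M3 M30 H3] := bounded_on_compact continuous_dbt.
have [M4 M40 H4] := bounded_on_compact continuous_dft.
have [M5 M50 H5] := bounded_on_compact continuous_ddl.
have [M6 M60 H6] : exists2 M : R, 0 <= M & forall z, K z -> `|(bt z + ft z)^-1| <= M.
  apply: bounded_on_compact => z Uz.
  apply: cvgV; last by apply: cvgD; [exact: continuous_bt|exact: continuous_ft].
  by rewrite gt_eqF// ltr_wpDr// ?bt_gt0// ft_ge0.
exists (M1 + M2 + M3 + M4 + M5 + M6); first by rewrite !addr_ge0.
move=> z Kz; have h1 := H1 z Kz; have h2 := H2 z Kz; have h3 := H3 z Kz.
have h4 := H4 z Kz; have h5 := H5 z Kz; have h6 := le_trans (ler_norm _) (H6 z Kz).
by do ?split; lra.
Qed.

(** The parametrisation of the closed segments by theta in [0, 1] is continuous on a compact set.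
    Both ends are kept, whence a compact subset of [closed_phase], to which the integrability
    hypotheses apply. *)
Lemma compact_ride_image : exists2 K1 : set W, compact K1 &
  K1 `<=` closed_phase xi Omega /\
  forall s z, K z -> - bt z <= s <= ft z -> K1 (ride s z).
Proof.
pose sg (y : R * W) := y.1 * ft y.2 - (1 - y.1) * bt y.2.
pose F (y : R * W) := ride (sg y) y.2.
exists (F @` (`[0, 1]%classic `*` K)).
  apply: continuous_compact; last first.
    by apply: compact_setX => //; exact: segment_compact.
  apply: continuous_in_subspaceT => y; rewrite inE => -[_ /KU Uy].
  have c (g : W -> R) : {for y.2, continuous g} -> {for y, continuous (fun y : R * W => g y.2)}.
    by move=> cg; apply: (continuous_at_comp (g := snd)); [exact: cvg_snd|exact: cg].
  have c1 : {for y, continuous (fun y : R * W => y.1)} by exact: cvg_fst.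
  have c2 : {for y, continuous (fun y : R * W => y.2)} by exact: cvg_snd.
  have cs : {for y, continuous sg}.
    apply: cvgB; apply: cvgM.
    - exact: c1.
    - by apply: c; exact: continuous_ft.
    - by apply: cvgB; [exact: cvg_cst|exact: c1].
    - by apply: c; exact: continuous_bt.
  apply: (continuous_at_comp (g := fun y => (sg y, y.2)) (f := fun y : R * W => ride y.1 y.2)).
    by apply: cvg_to_pair; [exact: cs|exact: c2].
  exact: continuous_ride.
split.
  move=> _ [[th z] [/= + /KU Uz] <-]; rewrite in_itv /= => /andP[t0 t1].
  apply: ride_closed_phase => //; rewrite /sg /=.
  have := bt_gt0 Uz; have := ft_ge0 Uz; move: (bt z) (ft z) => b f f0 b0.
  by apply/andP; split; nra.
move=> s z Kz /andP[bs sf]; have Uz := KU Kz.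
have l0 : 0 < bt z + ft z by rewrite ltr_wpDr// ?bt_gt0// ft_ge0.
exists ((s + bt z) / (bt z + ft z), z).
  split => //=; rewrite in_itv /= divr_ge0//; [|lra|lra].
  by rewrite ler_pdivrMr// mul1r; lra.
rewrite /F /sg /=; congr (ride _ _).
by field; rewrite gt_eqF.
Qed.

Lemma Lone_ride (h : W -> R) :
  integrable_on_compacts (closed_phase xi Omega) U h ->
  Lone (sfprod leb mu) ((fun y => h (ride y.1 y.2)) \_ D).
Proof.
move=> Hh; have [K1 cK1 [K1c K1r]] := compact_ride_image.
have [M M0 HM] := ride_bounds.
have mK1U : measurable (K1 `&` U).
  by apply: measurableI; [exact: compact_measurable7|exact: open_measurable7].
have lh : Lone mu (h \_ (K1 `&` U)) 
    by exact: (@Lone_on _ _ R mu (K1 `&` U) h mK1U).1 (Hh K1 cK1 K1c).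
(* On the slab |s| <= M, as p and q are bounded on K; the indicator is the time weight for
   [Lone_flow]. *)
have lf := @Lone_flow _ _ R mu \1_`[- M, M] (fun y => ride y.1 y.2) _
  (Lone_indic_itv _ _) measurable_ride preserves_ride lh.
have := @Lone_patch _ _ R (sfprod leb mu) D _ measurable_ride_slab lf.
congr (Lone _ _); apply/funext => y; rewrite !patchE; case: ifPn => //.
rewrite inE => -[Ky /andP[bs sf]]; have Uy := KU Ky.
have [[h1 h2 _] _] := HM _ Ky.
rewrite indic_itvcc mem_set ?mul1r.
  suff -> : - M <= y.1 <= M by rewrite mul1r.
  move: h1 h2; rewrite !ler_norml => /andP[_ h1] /andP[_ h2].
  by rewrite (le_trans (ltW sf) h2) andbT (le_trans _ (ltW bs))// lerN2.
split; last by apply: ride_phase => //; rewrite bs.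
by apply: K1r => //; rewrite !ltW.
Qed.

End on_compact.

(** The derivative of [ride s] along e when e has no time component. *)
Definition ride_vel (s : R) (z : W) : W :=
  (- ddl z, e.1.2 + (s * eps) *: e.2, eps *: e.2).

(** * The weak derivative along e at fixed s *)

Section transport_identity.
Variables (f : W -> R) (Df : W -> W).
Hypothesis Hg : distr_grad U f Df.
Variables (K : set W) (phi : W -> R) (n : nat) (s : R).
Hypotheses (cK : compact K) (KU : K `<=` U) (sphi : smooth phi)
  (phi0 : forall z, ~ K z -> phi z = 0).
Hypothesis e0 : e.1.1 = 0.

Local Notation chi := (slab_bump bt ft n s).
Local Notation dchi := (dslab_bump bt ft n s).
Local Notation gam := (slab_speed bt ft dbt dft s).

Definition unride (w : W) : W :=
  let x := w.1.2 - s *: w.2 in let v := eps *: w.2 in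
  (w.1.1 + dl (0, x, v) - s, x, v).

Let eps2 : eps * eps = 1. Proof. by rewrite -expr2 sqrr_sign. Qed.

Lemma rideK z : unride (ride s z) = z.
Proof.
case: z => [[t x] v]; rewrite /unride /ride /=.
rewrite addrK scalerA eps2 scale1r.
have -> : dl (0, x, v) = dl (t, x, v) by exact: (dl_shift 0 (t, x, v)).
by congr (_, _, _); ring.
Qed.

Lemma unrideK w : ride s (unride w) = w.
Proof.
case: w => [[t x] v]; rewrite /unride /ride /=.
have -> : eps *: (eps *: v) = v by rewrite scalerA eps2 scale1r.
rewrite subrK.
set y := (_ - s, _, _); have -> : dl y = dl (0, x - s *: v, eps *: v).
  by rewrite -(dl_shift 0 y).
by congr (_, _, _); ring.
Qed.

Lemma measurable_unride : measurable_fun setT unride.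
Proof.
have m2 : measurable_fun setT (fun w : W => w.2) by exact: measurable_snd.
have m12 : measurable_fun setT (fun w : W => w.1.2) by exact: measurableT_comp.
have mx : measurable_fun setT (fun w : W => w.1.2 - s *: w.2).
  rewrite (_ : (fun w : W => _) = (fun w => w.1.2 + (- s) *: w.2)).
    by apply: measurable_fun_addR3 => //; exact: measurable_fun_scaleR3.
  by apply/funext => w; rewrite scaleNr.
have mv : measurable_fun setT (fun w : W => eps *: w.2) by exact: measurable_fun_scaleR3.
apply: mtxv => //; apply: measurable_funB => //.
apply: measurable_funD; first exact: measurableT_comp.
have m : measurable_fun setT (fun w : W => (0, w.1.2 - s *: w.2, eps *: w.2) : W).
  exact: mtxv.
exact: measurableT_comp measurable_dl m.
Qed.

Definition ride_dir : W := (0, e.1.2 + (s * eps) *: e.2, eps *: e.2).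

(** [ride s] turns e into the constant direction [ride_dir] up to a time shift, the variation of the
    delay. That shift is not linear in t, which is what [is_derive_curve] is for. *)
Lemma unride_dir w t : unride (w + t *: ride_dir) =
  unride w + t *: e + (dl (unride w + t *: e) - dl (unride w)) *: et R.
Proof.
set z := unride w; set w' := w + t *: ride_dir.
have Ex : w'.1.2 - s *: w'.2 = (z + t *: e).1.2.
  exact: (@shear_shuffle _ _ w.1.2 w.2 e.1.2 e.2).
have Ev : eps *: w'.2 = (z + t *: e).2.
  rewrite /w' /z /unride /ride_dir /= scalerDr !scalerA mulrAC -mulrA.
  by rewrite [eps * (eps * t)]mulrA eps2 mul1r.
have Ed r : dl (r, (z + t *: e).1.2, (z + t *: e).2) = dl (z + t *: e).
  exact: dl_shift.
have Ez : dl z = dl (0, w.1.2 - s *: w.2, eps *: w.2).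
  by rewrite -(dl_shift 0 z).
rewrite {1}/unride -/w' Ex Ev Ed.
apply: injective_projections; last by rewrite /= scaler0 addr0.
apply: injective_projections; last by rewrite /= scaler0 addr0.
rewrite Ez /= e0 /GRing.scale /=; ring.
Qed.

Lemma unride_et w t : unride (w + t *: et R) = unride w + t *: et R.
Proof.
have E1 : (w + t *: et R).1.2 = w.1.2 by rewrite /= scaler0 addr0.
have E2 : (w + t *: et R).2 = w.2 by rewrite /= scaler0 addr0.
rewrite /unride E1 E2.
apply: injective_projections; last by rewrite /= scaler0 addr0.
apply: injective_projections; last by rewrite /= scaler0 addr0.
by rewrite /GRing.scale /=; ring.
Qed.

Let arg z := n%:R * (slab_param bt ft s z * (1 - slab_param bt ft s z)).

Let carg z : U z -> {for z, continuous arg}.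
Proof.
move=> Uz; have cth : {for z, continuous (slab_param bt ft s)}.
  apply: cvgM.
    by apply: cvgD; [exact: cvg_cst|exact: continuous_bt].
  apply: cvgV; last by apply: cvgD; [exact: continuous_bt|exact: continuous_ft].
  by rewrite gt_eqF// ltr_wpDr// ?bt_gt0// ft_ge0.
apply: cvgM; first exact: cvg_cst.
by apply: cvgM => //; apply: cvgB => //; exact: cvg_cst.
Qed.

(** Contains every point of K where the cutoff or its derivative is nonzero. It is compact and
    inside the slab, so its image under [ride s] is a compact subset of U, as [directional_ibp]
    requires. *)
Let K2 := K `&` [set z | 1 <= arg z].

Let cK2 : compact K2.
Proof. by apply: compact_superlevel => // z /KU; exact: carg. Qed.

Let l0 z : K z -> 0 < bt z + ft z.
Proof. by move=> /KU Uz; rewrite ltr_wpDr// ?bt_gt0// ft_ge0. Qed.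

Let K2D z : K2 z -> slab K bt ft (s, z).
Proof.
move=> [Kz /= a1]; apply: slab_inP => //.
have n0 : (0 : R) <= n%:R by exact: ler0n.
have : 0 < arg z by rewrite (lt_le_trans ltr01).
rewrite !ltNge; apply: contra => b0; exact: mulr_ge0_le0.
Qed.

Let K3 := ride s @` K2.

Let cK3 : compact K3.
Proof.
apply: continuous_compact => //; apply: continuous_in_subspaceT => z.
rewrite inE => -[/KU Uz _].
have Uy : U (s, z).2 by [].
apply: (continuous_at_comp (g := fun z => (s, z)) (f := fun y : R * W => ride y.1 y.2)).
  by apply: cvg_to_pair; [exact: cvg_cst|exact: cvg_id].
exact: continuous_ride.
Qed.

Let K3U : K3 `<=` U.
Proof.
move=> _ [z K2z <-]; have [Kz _] := K2z; have [_ H] := K2D K2z.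
exact: ride_phase (KU Kz) H.
Qed.

Let phi_sm := smooth_continuous sphi.

Let dphi y d : derivable phi y d.
Proof. by exact: smooth_derivable. Qed.

Let dphi0 d z : ~ K z -> 'D_d phi z = 0.
Proof.
move=> nKz; have oK : open (~` K).
  by apply: closed_openC; apply: compact_closed => //; exact: norm_hausdorff.
rewrite (@near_eq_derive _ _ _ _ (cst 0)) ?derive_cst//.
have : nbhs z (~` K) by exact: open_nbhs_nbhs.
by apply: filterS => y /phi0 ->.
Qed.

Let bnd d : exists2 M : R, 0 <= M & forall z, `|phi z| <= M /\ `|'D_d phi z| <= M.
Proof.
have [M1 H1] := compact_support_bounded cK phi_sm phi0.
have [M2 H2] := compact_support_bounded cK
  (smooth_continuous (smooth_derive d sphi)) (dphi0 d).
exists (Num.max M1 M2); first by rewrite le_max (le_trans _ (H1 0)).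
by move=> z; rewrite !le_max H1 H2 orbT.
Qed.

Let unK3 w : ~ K3 w -> ~ K2 (unride w).
Proof. by move=> nK3 K2w; apply: nK3; exists (unride w) => //; exact: unrideK. Qed.

Let off w : ~ K3 w -> [\/ phi (unride w) = 0 /\ (forall d, 'D_d phi (unride w) = 0) |
  chi (unride w) = 0 /\ dchi (unride w) = 0].
Proof.
move=> /unK3 nK2; have [Kz|nKz] := pselect (K (unride w)); [right|left]; last first.
  by split => [|d]; [exact: phi0|exact: dphi0].
apply: (slab_bump_off Kz); rewrite leNgt; apply/negP => a1.
by apply: nK2; split => //=; exact: ltW.
Qed.

Let is_derive_arg z : U z -> is_derive (0 : R) (1 : R)
  (fun t => chi (z + t *: e)) (- (gam z * dchi z)).
Proof.
move=> Uz.
have Db := (is_derive_lineP _ _ _ _).1 (is_derive_bt Uz).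
have Df' := (is_derive_lineP _ _ _ _).1 (is_derive_ft Uz).
have l0z : 0 < bt z + ft z by rewrite ltr_wpDr// ?bt_gt0// ft_ge0.
pose b t := bt (z + t *: e); pose c t := ft (z + t *: e).
pose th t := (s + b t) / (b t + c t).
have lt0 : b 0 + c 0 != 0 by rewrite /b /c scale0r addr0 gt_eqF.
have Dth : is_derive (0 : R) (1 : R) th (- (gam z / (bt z + ft z))).
  have D0 : is_derive (0 : R) (1 : R) (fun t => s + b t) (dbt z).
    by have := is_deriveD (is_derive_cst s (0 : R) (1 : R)) Db; rewrite add0r.
  have D1 : is_derive (0 : R) (1 : R) (fun t => b t + c t) (dbt z + dft z).
    exact: (is_deriveD Db Df').
  have [D2 E2] := is_deriveM D0
    (@is_deriveV R (fun t => b t + c t) 0 (dbt z + dft z) 1 lt0 D1).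
  apply: (DeriveDef D2); rewrite E2 /slab_speed /slab_param /b /c scale0r addr0.
  move: (bt z) (ft z) (dbt z) (dft z) (lt0r_neq0 l0z) => b0 c0 db dc l0n.
  by rewrite /GRing.scale /=; field.
have th0 : th 0 = slab_param bt ft s z by rewrite /th /b /c scale0r addr0.
have Da : is_derive (0 : R) (1 : R) (fun t => n%:R * (th t * (1 - th t)) - 1)
    (n%:R * ((1 - 2 * th 0) * - (gam z / (bt z + ft z)))).
  have D1 := is_deriveB (is_derive_cst (1 : R) (0 : R) (1 : R)) Dth.
  have [D2 E2] := is_deriveB (is_deriveZ n%:R (is_deriveM Dth D1))
    (is_derive_cst (1 : R) (0 : R) (1 : R)).
  apply: (DeriveDef D2); rewrite E2 subr0 sub0r.
  move: (- (gam z / _)) => k; rewrite (_ : (cst 1 - th) 0 = 1 - th 0)//.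
  by move: (th 0) => a; rewrite /GRing.scale /=; ring.
have Dfl : is_derive (n%:R * (th 0 * (1 - th 0)) - 1) (1 : R) flat
    ('D_1 flat (n%:R * (th 0 * (1 - th 0)) - 1)).
  by apply: derivable_is_derive; exact: smooth_derivable smooth_flat.
have [D3 E3] := @is_derive1_comp R flat (fun t => n%:R * (th t * (1 - th t)) - 1) 0
  _ _ Dfl Da.
apply: (DeriveDef D3); rewrite E3 th0 /dslab_bump.
move: ((bt z + ft z)^-1) (gam z) (slab_param bt ft s z) => k g a.
by move: ('D_1 flat _) => F; ring.
Qed.

(** The derivative of [psi] along [ride_dir] contains a term in ddl d_t phi due to the delay.
    Testing [psi2] along [et] produces the same term, to be subtracted. This second derivative
    exists although [ddl] is only known to be continuous, because [ddl] and the cutoff do not depend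
    on t. *)
Let psi w := chi (unride w) * phi (unride w).
Let dpsi w := chi (unride w) * ('D_e phi (unride w) + ddl (unride w) * 'D_(et R) phi (unride w))
  - gam (unride w) * dchi (unride w) * phi (unride w).
Let psi2 w := ddl (unride w) * (chi (unride w) * phi (unride w)).
Let dpsi2 w := ddl (unride w) * (chi (unride w) * 'D_(et R) phi (unride w)).

(** Off [K3] the exit times need not be differentiable at [unride w], but the tests vanish on this
    open set. *)
Let near_off (g : W -> R) w d : (forall w, ~ K3 w -> g w = 0) -> ~ K3 w ->
  is_derive w d g 0.
Proof.
move=> g0 nK; have oK : open (~` K3).
  by apply: closed_openC; apply: compact_closed => //; exact: norm_hausdorff.
have : is_derive w d (cst 0 : W -> R) 0 by exact: is_derive_cst.
apply: near_eq_is_derive; have : nbhs w (~` K3) by exact: open_nbhs_nbhs.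
by apply: filterS => y /g0 ->.
Qed.

Let psi0 w : ~ K3 w -> psi w = 0.
Proof. by move=> /off[[H _]|[H _]]; rewrite /psi H ?mulr0 ?mul0r. Qed.

Let dpsi0 w : ~ K3 w -> dpsi w = 0.
Proof.
move=> /off[[H1 H2]|[H1 H2]]; rewrite /dpsi.
  by rewrite H1 !H2 !(mulr0, addr0, subr0).
by rewrite H1 H2 !(mulr0, mul0r, subr0).
Qed.

Let psi20 w : ~ K3 w -> psi2 w = 0.
Proof. by move=> /off[[H _]|[H _]]; rewrite /psi2 H ?mulr0 ?mul0r ?mulr0. Qed.

Let dpsi20 w : ~ K3 w -> dpsi2 w = 0.
Proof. by move=> /off[[_ H]|[H _]]; rewrite /dpsi2 H ?mulr0 ?mul0r ?mulr0. Qed.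

Let K3_in w : K3 w -> U (unride w).
Proof. by move=> [z [Kz _] <-]; rewrite rideK; exact: KU. Qed.

Let shift_et (g : W -> R) z t : (forall t z, g (t, z.1.2, z.2) = g z) ->
  g (z + t *: et R) = g z.
Proof.
move=> gE; rewrite -(gE 0 (z + _)) -(gE 0 z) /= !scaler0 !addr0; by [].
Qed.

Let chi_shift t z : chi (t, z.1.2, z.2) = chi z.
Proof. by rewrite /slab_bump /slab_param bt_shift ft_shift. Qed.

Let der_psi w : is_derive w ride_dir psi (dpsi w).
Proof.
have [K3w|nK] := pselect (K3 w); last by rewrite dpsi0//; exact: near_off.
apply/is_derive_lineP; have Uz := K3_in K3w.
pose z := unride w.
have -> : (fun t => psi (w + t *: ride_dir)) = (fun t => chi (z + t *: e) *
    phi (z + t *: e + (dl (z + t *: e) - dl z) *: et R)).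
  by apply/funext => t; rewrite /psi unride_dir (shift_et _ _ chi_shift).
have Dr : is_derive (0 : R) (1 : R) (fun t => dl (z + t *: e) - dl z) (ddl z).
  have D1 := (is_derive_lineP _ _ _ _).1 (is_derive_dl Uz).
  by have := is_deriveB D1 (is_derive_cst (dl z) (0 : R) (1 : R)); rewrite subr0.
have r0 : dl (z + (0 : R) *: e) - dl z = 0 by rewrite scale0r addr0 subrr.
have cz : {for z, continuous ('D_(et R) phi)}.
  exact: (smooth_continuous (smooth_derive _ sphi)).
have Dp : is_derive (0 : R) (1 : R)
    (fun t => phi (z + t *: e + (dl (z + t *: e) - dl z) *: et R))
    ('D_e phi z + ddl z * 'D_(et R) phi z).
  apply: (@is_derive_curve _ _ phi z e (et R) (fun t => dl (z + t *: e) - dl z)).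
  - exact: dphi.
  - by move=> y; exact: dphi.
  - exact: cz.
  - exact: r0.
have [Dd Ed] := is_deriveM (is_derive_arg Uz) Dp.
apply: (DeriveDef Dd); rewrite Ed /dpsi -/z scale0r addr0 subrr scale0r addr0.
by rewrite scalerN [_ *: (gam z * dchi z)]mulrC.
Qed.

Let der_psi2 w : is_derive w (et R) psi2 (dpsi2 w).
Proof.
have [K3w|nK] := pselect (K3 w); last by rewrite dpsi20//; exact: near_off.
apply/is_derive_lineP; pose z := unride w.
have -> : (fun t => psi2 (w + t *: et R)) =
    (fun t => (ddl z * chi z) *: phi (z + t *: et R)).
  apply/funext => t; rewrite /psi2 unride_et (shift_et _ _ chi_shift).
  by rewrite (shift_et _ _ ddl_shift) mulrA.
have D1 : is_derive (0 : R) (1 : R) (fun t => phi (z + t *: et R)) ('D_(et R) phi z).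
  by apply: (is_derive_lineP phi z (et R) _).1; apply: derivable_is_derive; exact: dphi.
have [Dd Ed] := is_deriveZ (ddl z * chi z) D1.
by apply: (DeriveDef Dd); rewrite Ed /dpsi2 -/z mulrA.
Qed.

Let mchi : measurable_fun setT chi.
Proof.
exact: (measurable_fun_pair2 s
  (measurable_slab_bump measurable_bt measurable_ilength n)).
Qed.

Let mdchi : measurable_fun setT dchi.
Proof.
exact: (measurable_fun_pair2 s
  (measurable_dslab_bump measurable_bt measurable_ilength n)).
Qed.

Let mgam : measurable_fun setT gam.
Proof.
exact: (measurable_fun_pair2 s (measurable_slab_speed measurable_bt
  measurable_dbt measurable_dft measurable_ilength)).
Qed.

Let mphi : measurable_fun setT phi.
Proof. exact: continuous_measurable7. Qed.

Let mDphi d : measurable_fun setT ('D_d phi).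
Proof. by apply: continuous_measurable7; exact: (smooth_continuous (smooth_derive _ sphi)). Qed.

Let mun (g : W -> R) : measurable_fun setT g -> measurable_fun setT (fun w => g (unride w)).
Proof. by move=> mg; exact: measurableT_comp mg measurable_unride. Qed.

Let mpsi : measurable_fun setT psi.
Proof. by apply: (mun (g := fun z => chi z * phi z)); exact: measurable_funM. Qed.

Let mdpsi : measurable_fun setT dpsi.
Proof.
apply: (mun (g := fun z => chi z * ('D_e phi z + ddl z * 'D_(et R) phi z) -
  gam z * dchi z * phi z)).
apply: measurable_funB; last by apply: measurable_funM => //; exact: measurable_funM.
apply: measurable_funM => //; apply: measurable_funD; first exact: mDphi.
by apply: measurable_funM; [exact: measurable_ddl|exact: mDphi].
Qed.

Let mpsi2 : measurable_fun setT psi2.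
Proof.
apply: (mun (g := fun z => ddl z * (chi z * phi z))).
by apply: measurable_funM; [exact: measurable_ddl|exact: measurable_funM].
Qed.

Let mdpsi2 : measurable_fun setT dpsi2.
Proof.
apply: (mun (g := fun z => ddl z * (chi z * 'D_(et R) phi z))).
apply: measurable_funM; first exact: measurable_ddl.
by apply: measurable_funM => //; exact: mDphi.
Qed.

Let bpsi : exists M : R, forall w,
  [/\ `|psi w| <= M, `|dpsi w| <= M, `|psi2 w| <= M & `|dpsi2 w| <= M].
Proof.
have [M1 M10 H1] := bnd (et R); have [M2 M20 H2] := bnd e.
have [M3 M30 H3] := ride_bounds cK KU.
have [N HN] := dslab_bump_le l0 (fun z Kz => let: conj (And3 _ _ h) _ := H3 z Kz in h) n.
have Hsp z := fun Dz => @slab_speed_le _ _ _ K bt ft dbt dft M3 l0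
  (fun z Kz => let: conj _ (And3 h _ _) := H3 z Kz in h)
  (fun z Kz => let: conj _ (And3 _ h _) := H3 z Kz in h) (s, z) Dz.
pose B1 := 1 * M1; pose B2 := 1 * (M2 + M3 * M1) + 3 * M3 * `|N| * M1.
pose B3 := M3 * (1 * M1).
have B10 : 0 <= B1 by rewrite /B1 mul1r.
have B30 : 0 <= B3 by rewrite /B3 mul1r mulr_ge0.
have B20 : 0 <= B2 by rewrite /B2 mul1r !addr_ge0// !mulr_ge0.
have B0 : 0 <= B1 + B2 + B3 by exact: addr_ge0 (addr_ge0 B10 B20) B30.
exists (B1 + B2 + B3) => w.
have [[z K2z <-]|nK] := pselect (K3 w); last first.
  by rewrite (psi0 nK) (dpsi0 nK) (psi20 nK) (dpsi20 nK) normr0; split; exact: B0.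
have [Kz _] := K2z; have Dz := K2D K2z.
have [_ [_ _ h5]] := H3 z Kz; have h6 := Hsp z Dz; have h7 := HN (s, z) Dz.
have h8 := le_trans h7 (ler_norm N); have h9 := slab_bump_le1 bt ft n s z.
have [p1 p2] := H1 z; have [_ p3] := H2 z.
have q1 : `|psi (ride s z)| <= B1 by rewrite /psi rideK; exact: normrM_le.
have q2 : `|dpsi (ride s z)| <= B2.
  rewrite /dpsi rideK; apply: le_trans (ler_normB _ _) _; apply: lerD.
    apply: normrM_le => //; apply: le_trans (ler_normD _ _) _.
    by apply: lerD => //; exact: normrM_le.
  by apply: normrM_le => //; exact: normrM_le.
have q3 : `|psi2 (ride s z)| <= B3.
  by rewrite /psi2 rideK; apply: normrM_le => //; exact: normrM_le.
have q4 : `|dpsi2 (ride s z)| <= B3.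
  by rewrite /dpsi2 rideK; apply: normrM_le => //; exact: normrM_le.
clearbody B1 B2 B3.
have s1 : B1 <= B1 + B2 + B3 by rewrite -addrA lerDl; exact: addr_ge0.
have s2 : B2 <= B1 + B2 + B3 by rewrite [B1 + _]addrC -addrA lerDl; exact: addr_ge0.
have s3 : B3 <= B1 + B2 + B3 by rewrite lerDr; exact: addr_ge0.
split; [exact: le_trans q1 s1|exact: le_trans q2 s2|exact: le_trans q3 s3|].
exact: le_trans q4 s3.
Qed.

Let dot7_split (P : W) a x v : dot7 P (a, x, v) = dot7 P (0, x, v) + a * dot7 P (et R).
Proof. by rewrite dot7_et /dot7 /= mulr0 add0r [a * _]mulrC -addrA addrC. Qed.

Let ring1 (c a b m k : R) : c * a - k = c * (a + m * b) - k - m * (c * b).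
Proof. ring. Qed.

Let ring2 (a b m k : R) : (a + - m * b) * k = a * k - b * (m * k).
Proof. ring. Qed.

(** Both integrals are rewritten in w = ride s z. The left one becomes the pairing of f with [dpsi]
    - [dpsi2], to which [directional_ibp] applies along [ride_dir] and along [et]; on the right,
    [ride_vel] is [ride_dir] minus ddl times [et]. *)
Lemma transport_identity :
  \int[mu]_z (((fun y => f (ride y.1 y.2)) \_ (slab K bt ft)) (s, z) *
    (chi z * 'D_e phi z - gam z * dchi z * phi z)) =
  - \int[mu]_z (((fun y => dot7 (Df (ride y.1 y.2)) (ride_vel y.1 y.2)) \_
      (slab K bt ft)) (s, z) * (chi z * phi z)).
Proof.
have [M HM] := bpsi.
have b1 w : `|psi w| <= M by have [] := HM w.
have b2 w : `|dpsi w| <= M by have [] := HM w.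
have b3 w : `|psi2 w| <= M by have [] := HM w.
have b4 w : `|dpsi2 w| <= M by have [] := HM w.
have A1 := directional_ibp oU Hg cK3 K3U psi0 mpsi mdpsi b1 b2 der_psi.
have A2 := directional_ibp oU Hg cK3 K3U psi20 mpsi2 mdpsi2 b3 b4 der_psi2.
have lf := locint_f oU Hg cK3 K3U.
have lX := locint_g oU Hg ride_dir (0 : R) cK3 K3U.
have lt := locint_g oU Hg (et R) (0 : R) cK3 K3U.
have aX d : (fun w => dot7 (Df w) (afield d 0 w)) = (fun w => dot7 (Df w) d).
  by apply/funext => w; rewrite afield0.
rewrite aX in lX; rewrite aX in lt.
have l1 := Lone_cut lf mdpsi b2 dpsi0; have l2 := Lone_cut lf mdpsi2 b4 dpsi20.
have l3 := Lone_cut lX mpsi b1 psi0; have l4 := Lone_cut lt mpsi2 b3 psi20.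
have pr := preserves_ride s.
have K3D z : K3 (ride s z) -> slab K bt ft (s, z).
  by move=> [y K2y /(congr1 unride)]; rewrite !rideK => <-; exact: K2D.
have inU z : slab K bt ft (s, z) -> U (ride s z).
  by move=> [Kz sz]; exact: ride_phase (KU Kz) sz.
have EL : \int[mu]_z (((fun y => f (ride y.1 y.2)) \_ (slab K bt ft)) (s, z) *
    (chi z * 'D_e phi z - gam z * dchi z * phi z)) =
    \int[mu]_w ((f \_ U) w * dpsi w - (f \_ U) w * dpsi2 w).
  rewrite -(preserves_int pr (LoneB l1 l2)); apply: eq_Rintegral => z _.
  have -> : chi z * 'D_e phi z - gam z * dchi z * phi z =
      dpsi (ride s z) - dpsi2 (ride s z).
    by rewrite /dpsi /dpsi2 rideK; exact: ring1.
  rewrite -mulrBr; have [Dz|nD] := pselect (slab K bt ft (s, z)).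
    by rewrite patchE mem_set// [in RHS]patchE mem_set//; exact: inU.
  have nK : ~ K3 (ride s z) by move=> /K3D.
  by rewrite dpsi0// dpsi20// subrr !mulr0.
have ER : \int[mu]_z (((fun y => dot7 (Df (ride y.1 y.2)) (ride_vel y.1 y.2)) \_
      (slab K bt ft)) (s, z) * (chi z * phi z)) =
    \int[mu]_w (((fun w => dot7 (Df w) ride_dir) \_ U) w * psi w -
      ((fun w => dot7 (Df w) (et R)) \_ U) w * psi2 w).
  rewrite -(preserves_int pr (LoneB l3 l4)); apply: eq_Rintegral => z _.
  have [Dz|nD] := pselect (slab K bt ft (s, z)); last first.
    have nK : ~ K3 (ride s z) by move=> /K3D.
    by rewrite psi0// psi20// patchE memNset// !(mulr0, mul0r) subrr.
  rewrite patchE mem_set// [in RHS]patchE mem_set; last exact: inU.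
  rewrite patchE mem_set; last exact: inU.
  rewrite /psi /psi2 rideK /= /ride_vel dot7_split.
  exact: ring2.
by rewrite EL ER (intB l1 l2) (intB l3 l4) A1 A2 opprB opprK addrC.
Qed.

End transport_identity.

(** * Absolute continuity on almost every segment *)

Section slices.
Variables (f : W -> R) (Df : W -> W).
Hypothesis Hg : distr_grad U f Df.
Hypothesis Hf : integrable_on_compacts (closed_phase xi Omega) U f.
Hypothesis HDf : forall d, ([set et R] `|` @xv_dir R) d ->
  integrable_on_compacts (closed_phase xi Omega) U (fun z => dot7 (Df z) d).

(* The velocity of s |-> ride s z; u_s is the derivative of u = f along it, and
   u_e the derivative of u along e at fixed s. *)
Definition stream (z : W) : W := (1, eps *: z.2, 0).

Definition u_of (y : R * W) := f (ride y.1 y.2).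
Definition us_of (y : R * W) := dot7 (Df (ride y.1 y.2)) (stream y.2).
Definition ue_of (y : R * W) := dot7 (Df (ride y.1 y.2)) (ride_vel y.1 y.2).

Section compact_slab.
Variable K : set W.
Hypotheses (cK : compact K) (KU : K `<=` U).
Local Notation D := (slab K bt ft).
Local Notation nu := (sfprod leb mu).

Lemma Lone_u : Lone nu (u_of \_ D).
Proof. exact: Lone_ride. Qed.

Let bnorm : exists2 M : R, 0 <= M & forall z, K z -> `|z.2| <= M.
Proof.
have [|M M0 H] := @bounded_on_compact K cK KU (fun z : W => `|z.2|).
  move=> z _; apply: (continuous_at_comp (g := snd) (f := fun x : R3 R => `|x|)).
    exact: cvg_snd.
  exact: norm_continuous.
by exists M => // z Kz; have := H z Kz; rewrite normr_id.
Qed.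

Let lDf d : ([set et R] `|` @xv_dir R) d ->
  Lone nu ((fun y => dot7 (Df (ride y.1 y.2)) d) \_ D).
Proof. by move=> dd; apply: (Lone_ride cK KU (HDf dd)). Qed.

Let neps : `|eps| = 1. Proof. by rewrite normr_sign. Qed.

Lemma Lone_us : Lone nu (us_of \_ D).
Proof.
have [M M0 HM] := bnorm.
apply: (@Lone_dot7 R _ _ nu D (fun y => Df (ride y.1 y.2)) (fun y => stream y.2) (1 + M)).
- exact: measurable_ride_slab.
- have m : measurable_fun setT (fun y : R * W => eps *: y.2.2).
    by apply: measurable_fun_scaleR3 => //; exact: measurableT_comp.
  exact: mtxv.
- move=> y [Ky _]; split => [|i|i] /=.
  + by rewrite normr1 lerDl.
  + apply: le_trans (coord3_le_norm _ _) _; rewrite normrZ neps mul1r.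
    by apply: le_trans (HM _ Ky) _; rewrite lerDr.
  + by apply: le_trans (coord3_le_norm _ _) _; rewrite normr0 addr_ge0.
- exact: lDf.
Qed.

Lemma Lone_ue : Lone nu (ue_of \_ D).
Proof.
have [M M0 HM] := ride_bounds cK KU.
pose N := M + (`|e.1.2| + M * `|e.2|) + `|e.2|.
have N0 : 0 <= M * `|e.2| by exact: mulr_ge0.
apply: (@Lone_dot7 R _ _ nu D (fun y => Df (ride y.1 y.2)) (fun y => ride_vel y.1 y.2) N).
- exact: measurable_ride_slab.
- apply: mtxv => //.
    apply: measurableT_comp => //.
    by apply: (measurableT_comp measurable_ddl).
  apply: measurable_fun_addR3 => //; apply: measurable_fun_scaleR3 => //.
  exact: measurable_funM.
- move=> [s z] [/= Kz /andP[ps sq]].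
  have [[h1 h2 _] [_ _ h3]] := HM z Kz.
  have sM : `|s| <= M.
    move: h1 h2; rewrite !ler_norml => /andP[_ h1] /andP[_ h2].
    by rewrite (le_trans (ltW sq) h2) andbT (le_trans _ (ltW ps))// lerN2.
  split => [|i|i] /=.
  + by rewrite normrN (le_trans h3)// /N -addrA lerDl !addr_ge0.
  + apply: le_trans (coord3_le_norm _ _) _; apply: le_trans (ler_normD _ _) _.
    apply: (@le_trans _ _ (`|e.1.2| + M * `|e.2|)).
      by rewrite normrZ normrM neps mulr1 lerD2l ler_wpM2r.
    by rewrite /N [M + _]addrC -addrA lerDl addr_ge0.
  + apply: le_trans (coord3_le_norm _ _) _; rewrite normrZ neps mul1r.
    by rewrite /N lerDr !addr_ge0.
- exact: lDf.
Qed.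

End compact_slab.

(** With lambda = -1 the field is (-1, - v, 0): free flight backwards, lowering s towards the end -p
    where the limit of f is taken. *)
Let back : W := (-1, 0, 0).
Let hback : -1 *: back.2 = 0. Proof. exact: scaler0. Qed.

Let back_ride r s z : aflow back (-1) r (ride s z) = ride (s - r) z.
Proof.
rewrite /aflow /afield /ride /back /=.
apply: injective_projections; last by rewrite /= scaler0 addr0.
apply: injective_projections => /=; first by rewrite /GRing.scale /=; ring.
by rewrite add0r scaleN1r scalerN -addrA -scalerBl.
Qed.

(** The null set of [flow_ae] depends on the duration; rational durations leave countably many null
    sets and still approach the end of the segment. *)
Definition rational_flow (w : W) := forall rho : rat, 0 < ratr rho :> R ->
  flow_domain back (-1) U (ratr rho) w ->
  (f \_ U) (aflow back (-1) (ratr rho) w) - (f \_ U) w =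
  \int[leb]_s (\1_`[0, ratr rho] s *
    ((fun w => dot7 (Df w) (afield back (-1) w)) \_ U) (aflow back (-1) s w)).

Lemma ae_rational_flow : {ae mu, forall z, {ae leb, forall s, rational_flow (ride s z)}}.
Proof.
apply: (@ae_flow_swap _ _ R mu (fun y => ride y.1 y.2) rational_flow measurable_ride
  preserves_ride).
apply: ae_countable => rho; have [r0|r0] := boolP (0 < ratr rho :> R).
  have := flow_ae oU Hg hback (ltW r0); apply: ae_imp => w Hw _; exact: Hw.
by apply: aeW.
Qed.

Section one_slice.
Variables (z : W) (T : R).
Hypotheses (Uz : U z)
  (lus : Lone leb ((fun r => us_of (r, z)) \_ `](- bt z), (ft z)[))
  (good : {ae leb, forall s, rational_flow (ride s z)})
  (HT : forall v : nat -> R, (forall n, - bt z < v n) ->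
     v n @[n --> \oo] --> - bt z -> f (ride (v n) z) @[n --> \oo] --> T).

Let us := (fun r => us_of (r, z)) \_ `](- bt z), (ft z)[.

Let win (a s : R) r := us r * ((a <= r)%R%:R * (r <= s)%R%:R).

Let win_le a s r : `|win a s r| <= `|us r|.
Proof.
by rewrite normrM ler_piMr// normrM mulr_ile1// ger0_norm// lern1 leq_b1.
Qed.

Let mwin a s : measurable_fun setT (win a s).
Proof.
apply: measurable_funM; first exact: Lone_meas lus.
by apply: measurable_funM; apply: measurable_le_indic.
Qed.

Let Lwin a s : Lone leb (win a s).
Proof. exact: (@Lone_le _ _ _ leb _ us (mwin a s) (win_le a s) lus). Qed.

Let step (rho : rat) (s : R) : - bt z < s < ft z -> rational_flow (ride s z) ->
  0 < (ratr rho : R) < s + bt z ->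
  f (ride (s - ratr rho) z) - f (ride s z) = - \int[leb]_r win (s - ratr rho) s r.
Proof.
move=> /andP[ps sq] Gs /andP[r0 rs].
have Ur t : 0 <= t <= ratr rho -> - bt z < s - t < ft z.
  by move=> /andP[t0 tr]; apply/andP; split; lra.
have fd : flow_domain back (-1) U (ratr rho) (ride s z).
  by move=> t /Ur tr; rewrite back_ride; exact: ride_phase.
have := Gs rho r0 fd; rewrite back_ride !patch_in; last 2 first.
- by apply: ride_phase => //; rewrite ps.
- by apply: ride_phase => //; apply: Ur; rewrite lexx ltW.
move=> ->.
have pr : preserves leb (fun t : R => - t + s).
  have H := preserves_comp (preserves_shift s) (@preserves_opp R).
  exact: H.
rewrite -(preserves_int pr (Lwin _ _)) -(intN (preserves_Lone pr (Lwin _ _))).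
apply: eq_Rintegral => t _; rewrite back_ride indic_itvcc /win.
have -> : (s - ratr rho <= - t + s) = (t <= ratr rho) by rewrite [- t + s]addrC lerD2l lerN2.
have -> : (- t + s <= s) = (0 <= t) by rewrite gerDr oppr_le0.
have [t0|t0] := boolP (0 <= t); last by rewrite mul0r !mulr0 oppr0.
have [tr|tr] := boolP (t <= ratr rho); last by rewrite mul0r mul0r mulr0 oppr0.
have Ut : - bt z < s - t < ft z by apply: Ur; rewrite t0.
rewrite patch_in; last exact: ride_phase.
rewrite !mulr1 mul1r /us patchE [- t + s]addrC mem_set; last by rewrite /= in_itv.
have -> : afield back (-1) (ride (s - t) z) = -1 *: stream z.
  apply: injective_projections; last by rewrite /= scaler0.
  apply: injective_projections; rewrite /= ?add0r//.
  by rewrite /GRing.scale /= mulr1.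
by rewrite dot7Z mulN1r.
Qed.

Let slice_win s : s < ft z ->
  (fun r => us_of (r, z)) \_ `](- bt z), s] = win (- bt z) s.
Proof.
move=> sq; apply/funext => r; rewrite /win /us !patchE !mem_setE !in_itv /=.
have [pr|pr] := boolP (- bt z < r); last by rewrite mul0r.
have [rs|rs] := boolP (r <= s); last by rewrite !mulr0.
by rewrite (le_lt_trans rs sq) (ltW pr) !mulr1.
Qed.

(** For almost every s the flow identity holds for all rational durations shorter than s + p. As
    they tend to s + p, the values of f converge to T by [HT], which concerns f itself along every
    sequence and so meets no null set; the integrals converge by dominated convergence. *)
Lemma slice_ae : {ae leb, forall s, - bt z < s < ft z ->
  u_of (s, z) = T + \int[leb]_r ((fun r => us_of (r, z)) \_ `](- bt z), s]) r}.
Proof.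
apply: ae_imp good => s Gs /andP[ps sq].
have L0 : 0 < s + bt z by lra.
(* Below s + p by less than the fraction 1 / (k + 1) of it; for k = 0 the lower bound is 0, so all
   durations are positive. *)
have hk (k : nat) : exists rho : rat, s + bt z - (s + bt z) * harmonic k < ratr rho < s + bt z.
  have : s + bt z - (s + bt z) * harmonic k < s + bt z.
    by rewrite ltrBlDr ltrDl mulr_gt0// /harmonic invr_gt0.
  by move=> /rat_in_itvoo[rho]; rewrite in_itv /= => H; exists rho.
have [rho Hrho] := choice hk.
have r0 k : 0 < ratr (rho k) :> R.
  have /andP[+ _] := Hrho k; apply: le_lt_trans.
  rewrite subr_ge0; apply: ler_piMr; first exact: ltW.
  by rewrite /harmonic invf_le1 ?ltr0n ?ler1n.
have rL k : ratr (rho k) < s + bt z by have /andP[] := Hrho k.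
have rcv : (ratr (rho k) : R) @[k --> \oo] --> s + bt z.
  apply: (@squeeze_cvgr _ _ _ _ (fun k => s + bt z - (s + bt z) * harmonic k)
    (fun=> s + bt z)).
  - by apply: nearW => k; have /andP[h1 h2] := Hrho k; rewrite !ltW.
  - rewrite -[X in _ --> X]subr0 -[X in _ - X](mulr0 (s + bt z)).
    apply: cvgB; first exact: cvg_cst.
    by apply: cvgM; [exact: cvg_cst|exact: cvg_harmonic].
  - exact: cvg_cst.
pose v k := s - ratr (rho k).
have vp k : - bt z < v k by rewrite /v; have := rL k; lra.
have vcv : v k @[k --> \oo] --> - bt z.
  have -> : - bt z = s - (s + bt z) by ring.
  by apply: cvgB => //; exact: cvg_cst.
have E k : f (ride (v k) z) = f (ride s z) - \int[leb]_r win (v k) s r.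
  rewrite -(step _ Gs) ?ps ?sq//; last by rewrite r0 rL.
  by rewrite -/(v k) [RHS]addrC subrK.
have [|||||_ C] := @int_dct _ _ _ leb (fun k r => win (v k) s r)
  ((fun r => us_of (r, z)) \_ `](- bt z), s]) (fun r => `|us r|).
- by move=> k; exact: mwin.
- by rewrite slice_win//; exact: mwin.
- apply: aeW => r; rewrite /win /us !patchE !mem_setE !in_itv /=.
  have [pr|pr] := boolP (- bt z < r); last first.
    by under eq_fun do rewrite mul0r; exact: cvg_cst.
  have [rs|rs] := boolP (r <= s); last first.
    by under eq_fun do rewrite mulr0 mulr0; exact: cvg_cst.
  rewrite (le_lt_trans rs sq) /=.
  apply: cvg_near_cst.
  have vr : \forall k \near \oo, v k < r by exact: (cvgr_lt _ vcv).
  by move: vr; apply: filterS => k vr; rewrite (ltW vr) !mulr1.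
- exact: Lone_norm lus.
- by move=> k r; exact: win_le.
have C1 := HT vp vcv; rewrite (funext E) in C1.
have C2 : f (ride s z) - \int[leb]_r win (v k) s r @[k --> \oo] -->
    f (ride s z) - \int[leb]_r ((fun r => us_of (r, z)) \_ `](- bt z), s]) r.
  by apply: cvgB; [exact: cvg_cst|exact: C].
have := cvg_lim (@Rhausdorff R) C1; rewrite (cvg_lim (@Rhausdorff R) C2) => <-.
by rewrite subrK.
Qed.

End one_slice.

End slices.

(** * The distributional derivative of the segment integral *)

Section conclusion.
Variables (f : W -> R) (Df : W -> W).
Hypothesis Hg : distr_grad U f Df.
Hypothesis Hf : integrable_on_compacts (closed_phase xi Omega) U f.
Hypothesis HDf : forall d, ([set et R] `|` @xv_dir R) d ->
  integrable_on_compacts (closed_phase xi Omega) U (fun z => dot7 (Df z) d).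
Hypothesis e0 : e.1.1 = 0.

Local Notation u := (u_of f).
Local Notation us := (us_of Df).
Local Notation ue := (ue_of Df).
Local Notation I z := `](- bt z), (ft z)[%classic.

Lemma phase_closed : U `<=` closed_phase xi Omega.
Proof.
move=> z [Oz z0].
have oO : open Omega by case: HO => -[].
split; [exact: subset_closure|exact: z0|].
by move=> [[_ ni] _]; apply: ni; exact: open_nbhs_nbhs (conj oO Oz).
Qed.

Definition entry_trace (z : W) : R :=
  lim (f (traj Omega j z tau) @[tau --> (tc Omega j.+1 z)^'+]).

Hypothesis Hlim : {ae mu, forall z, U z ->
  cvg (f (traj Omega j z tau) @[tau --> (tc Omega j.+1 z)^'+])}.

Definition regular_slice (z : W) :=
  [/\ Lone leb ((fun s => u (s, z)) \_ (I z)), Lone leb ((fun s => us (s, z)) \_ (I z)),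
      Lone leb ((fun s => ue (s, z)) \_ (I z)),
      f (traj Omega j z tau) @[tau --> (tc Omega j.+1 z)^'+] --> entry_trace z &
      {ae leb, forall s, - bt z < s < ft z ->
        u (s, z) = entry_trace z + \int[leb]_r ((fun r => us (r, z)) \_ `](- bt z), s]) r}].

Lemma slab_slice K (h : R * W -> R) z : K z ->
  (fun s => (h \_ (slab K bt ft)) (s, z)) = (fun s => h (s, z)) \_ (I z).
Proof.
move=> Kz; apply/funext => s; rewrite !patchE mem_setE in_itv.
by congr (if _ then _ else _); apply/idP/idP; rewrite inE; [case|split].
Qed.

Lemma ae_regular_slice : {ae mu, forall z, U z -> regular_slice z}.
Proof.
apply: (ae_on_open7 oU) => K cK KU.
have a1 := ae_Lone2 (Lone_u Hf cK KU).
have a2 := ae_Lone2 (Lone_us HDf cK KU).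
have a3 := ae_Lone2 (Lone_ue HDf cK KU).
have a4 := ae_rational_flow Hg.
apply: (ae_imp2 _ Hlim (ae_imp2 (fun z x y => conj x y) a4
  (ae_imp2 (fun z x y => conj x y) a1 (ae_imp2 (fun z x y => conj x y) a2 a3)))).
move=> z Lz.
move=> [gz [l1 [l2 l3]]].
move=> Kz.
have Uz := KU z Kz.
rewrite !(slab_slice _ Kz) in l1 l2 l3.
split; [exact: l1|exact: l2|exact: l3|exact: Lz|].
apply: (slice_ae Uz l2 gz) => v vp vcv.
have /cvg_at_rightP H := Lz Uz.
have E n : ride (v n) z = traj Omega j z (z.1.1 - delay Omega j z + v n).
  by rewrite (trajE HO Uz) (rideE _ Uz).
under eq_fun do rewrite E; apply: H; rewrite (tcSE HO Uz).
rewrite -[back_time Omega j z](patch_in _ Uz) -/bt.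
split; first by move=> n; rewrite ltrD2l.
by apply: cvgD => //; exact: cvg_cst.
Qed.

(** [slab_density] on one segment, freed of the compact set K so that a single function serves all
    test functions. *)
Definition density_slice (z : W) (s : R) : R :=
  ((fun s => ue (s, z)) \_ (I z)) s +
  ((fun s => us (s, z)) \_ (I z)) s * slab_speed bt ft dbt dft s z +
  ((fun s => u (s, z)) \_ (I z)) s * slab_rate bt ft dbt dft z.

Definition transport_derivative (z : W) : R := \int[leb]_s density_slice z s.

Let lgt0 z : U z -> 0 < bt z + ft z.
Proof. by move=> Uz; rewrite ltr_wpDr// ?bt_gt0// ft_ge0. Qed.

Let Ilt z : U z -> - bt z < ft z.
Proof. by move=> /lgt0 lz; rewrite -subr_gt0 opprK addrC. Qed.

Lemma transport_derivativeE z : U z -> regular_slice z ->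
  transport_derivative z =
  \int[leb]_s (((fun s => ue (s, z)) \_ (I z)) s +
     dft z * ((fun s => us (s, z)) \_ (I z)) s) + (dbt z + dft z) * entry_trace z.
Proof.
move=> Uz [l1 l2 l3 _ rep]; have ab := Ilt Uz; have lz := lgt0 Uz.
pose th s := slab_param bt ft s z.
have dth (s : R) : is_derive s (1 : R) th (bt z + ft z)^-1 by exact: is_derive_slab_param.
have cc : continuous (fun _ : R => (bt z + ft z)^-1) by move=> s; exact: cvg_cst.
(* The choice c = theta, with c' = 1 / (p + q), c = 0 at -p and c = 1 at q, isolates the trace. *)
have := slice_ibp ab l1 l2 rep dth cc.
have -> : th (ft z) - th (- bt z) = 1.
  by rewrite /th /slab_param addNr mul0r subr0 addrC divff// gt_eqF.
have th1 : th (ft z) = 1 by rewrite /th /slab_param addrC divff// gt_eqF.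
rewrite mulr1 th1 => H.
have lm : Lone leb (fun s => ((fun s => us (s, z)) \_ (I z)) s * (1 - th s)).
  have c2 : continuous (fun s : R => 1 - th s).
    move=> s; apply: cvgB; first exact: cvg_cst.
    apply: cvgM; last exact: cvg_cst.
    by apply: cvgD; [exact: cvg_id|exact: cvg_cst].
  exact: (Lone_sliceM ab c2 l2).
have lp : Lone leb (fun s => ((fun s => u (s, z)) \_ (I z)) s * (bt z + ft z)^-1).
  exact: (Lone_sliceM ab cc l1).
(* This rests on gamma = d_e q - (1 - theta) d_e (p + q). *)
have E s : density_slice z s =
   (((fun s => ue (s, z)) \_ (I z)) s + dft z * ((fun s => us (s, z)) \_ (I z)) s) +
   (dbt z + dft z) * (((fun s => u (s, z)) \_ (I z)) s * (bt z + ft z)^-1 -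
     ((fun s => us (s, z)) \_ (I z)) s * (1 - th s)).
  rewrite /density_slice /slab_speed /slab_rate -/(th s).
  move: (_ \_ _) (_ \_ _) (_ \_ _) => A B C.
  by move: (bt z + ft z)^-1 => k; ring.
rewrite /transport_derivative (funext E).
rewrite (intD (LoneD l3 (LoneZ _ l2)) (LoneZ _ (LoneB lp lm))).
rewrite (intZ _ (LoneB lp lm)) (intB lp lm) H.
by rewrite addrK.
Qed.

Lemma tc_ftE z : U z -> tc Omega j z = z.1.1 - delay Omega j z + ft z.
Proof. by move=> Uz; rewrite (tcE HO Uz) /ft patch_in// addrAC. Qed.

Lemma tcS_btE z : U z -> tc Omega j.+1 z = z.1.1 - delay Omega j z - bt z.
Proof. by move=> Uz; rewrite (tcSE HO Uz) /bt patch_in. Qed.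

(** The substitution tau = t - delay + s; the time is kept as a separate argument of [h] because
    [dtraj] depends on it. *)
Lemma int_traj z (h : W -> R -> R) (g : R -> R) : U z ->
  measurable_fun setT (g \_ (I z)) ->
  (forall s, - bt z < s < ft z ->
     h (traj Omega j z (z.1.1 - delay Omega j z + s)) (z.1.1 - delay Omega j z + s) = g s) ->
  \int[leb]_(tau in `]tc Omega j.+1 z, tc Omega j z[) h (traj Omega j z tau) tau =
  \int[leb]_s (g \_ (I z)) s.
Proof.
move=> Uz mg hg; pose c := z.1.1 - delay Omega j z.
rewrite -(preserves_Rint (preserves_shift (- c)) mg) Rintegral_mkcond.
apply: eq_Rintegral => tau _; rewrite !patchE !mem_setE !in_itv /=.
rewrite (tc_ftE Uz) (tcS_btE Uz) -/c.
have -> : (c - bt z < tau < c + ft z) = (- bt z < tau - c < ft z).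
  by rewrite [in RHS]ltrBrDr [in RHS]ltrBlDr [- bt z + c]addrC [ft z + c]addrC.
by case: ifPn => // H; rewrite -(hg _ H) -/c addrC subrK.
Qed.

Lemma segment_integralE z : U z ->
  \int[leb]_(tau in `]tc Omega j.+1 z, tc Omega j z[) f (traj Omega j z tau) =
  \int[leb]_s ((fun s => u (s, z)) \_ (I z)) s.
Proof.
move=> Uz; apply: (int_traj (h := fun w _ => f w)) => //; last first.
  by move=> s sI; rewrite (trajE HO Uz) /u_of /= (rideE _ Uz).
have lf : locint U f.
  move=> K cK KU; apply/(@Lone_on _ _ R mu K f (compact_measurable7 cK)).
  have := Hf cK (subset_trans KU phase_closed); rewrite setIidl//.
have mfU := locint_measurable oU lf.
have mr : measurable_fun setT (fun s : R => ride s z).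
  exact: (measurable_fun_pair1 z measurable_ride).
have mI : measurable (I z) by exact: measurable_itv.
have -> : (fun s => u (s, z)) \_ (I z) = (fun s => (f \_ U) (ride s z)) \_ (I z).
  apply/funext => s; rewrite !patchE mem_setE in_itv /=; case: ifPn => // sI.
  by rewrite /u_of /= [RHS]patchE mem_set//; exact: ride_phase.
apply/(measurable_restrictT _ mI); apply: measurable_funTS.
exact: measurableT_comp mfU mr.
Qed.

(** The coefficient of the limit is d_e t^j - d_e t^(j+1) = d_e (p + q), the delay cancelling. In
    the integral, [ride_vel] plus d_e q times [stream] is [dtraj], by [dtrajE]. *)
Lemma transport_derivative_formula z : U z -> regular_slice z ->
  transport_derivative z =
  \int[leb]_(tau in `]tc Omega j.+1 z, tc Omega j z[)
     dot7 (dtraj Omega j e z tau) (Df (traj Omega j z tau)) +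
  lim (('D_e (tc Omega j) z - 'D_e (tc Omega j.+1) z) * f (traj Omega j z tau)
     @[tau --> (tc Omega j.+1 z)^'+]).
Proof.
move=> Uz rz; have [_ l2 l3 cvgT _] := rz; rewrite (transport_derivativeE Uz rz).
congr (_ + _); last first.
  have [_ ->] := is_derive_tc HO j Uz e0; have [_ ->] := is_derive_tcS HO j Uz e0.
  rewrite /dbt /dft !patch_in//.
  have -> : dfore_time xi Omega e j z - ddelay xi Omega e j z -
      (- ddelay xi Omega e j z - dback_time xi Omega e j z) =
    dback_time xi Omega e j z + dfore_time xi Omega e j z by ring.
  apply/esym/cvg_lim; first exact: Rhausdorff.
  by apply: cvgM => //; exact: cvg_cst.
pose g s := dot7 (Df (ride s z)) (ride_vel s z + dft z *: stream z).
have gE : (fun s => ((fun s => ue (s, z)) \_ (I z)) s +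
     dft z * ((fun s => us (s, z)) \_ (I z)) s) = g \_ (I z).
  apply/funext => s; rewrite !patchE; case: ifPn => _; last by rewrite mulr0 addr0.
  by rewrite /g dot7D dot7Z.
rewrite (_ : \int[leb]_s _ = \int[leb]_s (g \_ (I z)) s); last first.
  by rewrite -gE.
apply/esym.
apply: (int_traj (h := fun w tau => dot7 (dtraj Omega j e z tau) (Df w))) => //.
  by rewrite -gE; exact: Lone_meas (LoneD l3 (LoneZ _ l2)).
move=> s sI; rewrite (trajE HO Uz) -(rideE _ Uz) dot7C (dtrajE HO j Uz e0).
rewrite /g; congr (dot7 _ _).
rewrite /ride_vel /stream /dft /ddl !patch_in//.
apply: injective_projections; last by rewrite /= !scaler0 subr0.
apply: injective_projections; rewrite /=; last by rewrite scaler0 subr0.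
by rewrite sub0r /GRing.scale /= mulr1.
Qed.

Let segment z := \int[leb]_(tau in `]tc Omega j.+1 z, tc Omega j z[) f (traj Omega j z tau).

Let segment_slab K z : compact K -> K `<=` U -> K z ->
  segment z = \int[leb]_s (u \_ (slab K bt ft)) (s, z).
Proof.
move=> cK KU Kz; rewrite /segment (segment_integralE (KU z Kz)).
by rewrite -(slab_slice u Kz).
Qed.

Let derivative_slab K z : K z ->
  transport_derivative z =
  \int[leb]_s slab_density K bt ft dbt dft u us ue (s, z).
Proof.
move=> Kz; apply: eq_Rintegral => s _.
by rewrite /density_slice /slab_density /= -!(slab_slice _ Kz).
Qed.

Let Lone_density K : compact K -> K `<=` U ->
  Lone (sfprod leb mu) (slab_density K bt ft dbt dft u us ue).
Proof.
move=> cK KU; have [M M0 HM] := ride_bounds cK KU.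
apply: (@Lone_slab_density _ _ R mu K bt ft dbt dft M u us ue).
all: try exact: measurable_bt.
all: try exact: measurable_ft.
all: try exact: measurable_dbt.
all: try exact: measurable_dft.
all: try exact: measurable_ilength.
- exact: compact_measurable7.
- by move=> z /KU; exact: lgt0.
- by move=> z /HM[[_ _ +] _].
- by move=> z /HM[_ [+ _ _]].
- by move=> z /HM[_ [_ + _]].
- exact: Lone_u.
- exact: Lone_us.
- exact: Lone_ue.
Qed.

Let integrable_of_slab (h : R * W -> R) (F : W -> R) K : compact K -> K `<=` U ->
  Lone (sfprod leb mu) h -> (forall z, K z -> F z = \int[leb]_s h (s, z)) ->
  mu.-integrable (K `&` U) (EFin \o F).
Proof.
move=> cK KU lh FE; rewrite setIidl//.
have mK := compact_measurable7 cK.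
apply: (@Lone_on _ _ R mu K F mK).2.
rewrite (_ : F \_ K = (fun z => \int[leb]_s h (s, z)) \_ K).
  exact: (@Lone_patch _ _ R mu K _ mK (Lone_fubini2 lh)).
apply/funext => z; rewrite !patchE; case: ifPn => // /[1!inE] Kz; exact: FE.
Qed.

Lemma distr_deriv_segment : distr_deriv U e segment transport_derivative.
Proof.
split=> [K cK KU|K cK KU|phi [sphi [K [cK KU phi0]]]].
- exact: (integrable_of_slab cK KU (Lone_u Hf cK KU)
    (fun z Kz => segment_slab cK KU Kz)).
- exact: (integrable_of_slab cK KU (Lone_density cK KU)
    (fun z Kz => derivative_slab Kz)).
have cphi := smooth_continuous sphi.
have mdphi0 : forall z, ~ K z -> 'D_e phi z = 0.
  move=> z nKz; have oK : open (~` K).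
    by apply: closed_openC; apply: compact_closed => //; exact: norm_hausdorff.
  rewrite (@near_eq_derive _ _ _ _ (cst 0)) ?derive_cst//.
  have : nbhs z (~` K) by exact: open_nbhs_nbhs.
  by apply: filterS => y /phi0 ->.
have cdphi := smooth_continuous (smooth_derive e sphi).
have [M1 H1] := compact_support_bounded cK cphi phi0.
have [M2 H2] := compact_support_bounded cK cdphi mdphi0.
have [M3 M30 H3] := ride_bounds cK KU.
pose M := Num.max M1 (Num.max M2 M3).
have M1M : M1 <= M by rewrite le_max lexx.
have M2M : M2 <= M by rewrite !le_max lexx orbT.
have M3M : M3 <= M by rewrite !le_max lexx !orbT.
(* Both integrals over the phase space reduce to the compact set K carrying phi, over which the two
   functions are slab integrals. *)
have cut (F psi : W -> R) (h : R * W -> R) : (forall z, ~ K z -> psi z = 0) ->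
    (forall z, K z -> F z = \int[leb]_s h (s, z)) ->
    \int[mu]_(z in U) (F z * psi z) = \int[mu]_z ((\int[leb]_s h (s, z)) * psi z).
  move=> psi0 FE; rewrite Rintegral_mkcond; apply: eq_Rintegral => z _.
  rewrite patchE; have [Kz|nKz] := pselect (K z).
    by rewrite mem_set ?FE//; exact: KU.
  by rewrite psi0// !mulr0; case: ifP.
rewrite (cut _ _ _ mdphi0 (fun z Kz => segment_slab cK KU Kz)).
rewrite (cut _ _ _ phi0 (fun z Kz => derivative_slab Kz)).
apply: (@slab_identity _ _ R mu K bt ft dbt dft phi ('D_e phi) M).
- exact: compact_measurable7.
- exact: measurable_bt.
- exact: measurable_ft.
- exact: measurable_dbt.
- exact: measurable_dft.
- exact: continuous_measurable7.
- exact: continuous_measurable7.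
- exact: measurable_ilength.
- by move=> z /KU; exact: lgt0.
- by move=> z /H3[[_ _ h] _]; exact: le_trans h M3M.
- by move=> z /H3[_ [h _ _]]; exact: le_trans h M3M.
- by move=> z /H3[_ [_ h _]]; exact: le_trans h M3M.
- by move=> z; exact: le_trans (H1 z) M1M.
- by move=> z; exact: le_trans (H2 z) M2M.
- exact: Lone_u.
- exact: Lone_us.
- exact: Lone_ue.
- move=> n s; exact: (transport_identity Hg n s cK KU sphi phi0 e0).
- have := ae_regular_slice; apply: ae_imp => z Hz Kz c c' dc cc cp cq.
  have Uz := KU z Kz; have [l1 l2 _ _ rep] := Hz Uz.
  have := slice_ibp (Ilt Uz) l1 l2 rep dc cc; rewrite cp cq subrr mulr0 add0r.
  have ccont : continuous c.
    move=> s; apply: differentiable_continuous; apply/derivable1_diffP.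
    by have [] := dc s.
  have lc := Lone_sliceM (Ilt Uz) ccont l2.
  have sl (h : R * W -> R) s :
      (h \_ (slab K bt ft)) (s, z) = ((fun s => h (s, z)) \_ (I z)) s.
    by rewrite -(slab_slice h Kz).
  move=> H; transitivity (\int[leb]_s (((fun s => u (s, z)) \_ (I z)) s * c' s)).
    by apply: eq_Rintegral => s _; rewrite sl.
  transitivity (- \int[leb]_s (((fun s => us (s, z)) \_ (I z)) s * c s)).
    rewrite H -(intN lc).
    by apply: eq_Rintegral => s _; rewrite sub0r mulrN.
  by congr (- _); apply: eq_Rintegral => s _; rewrite sl.
Qed.

End conclusion.

End transport.

Theorem lemma3 (R : realType) (xi : R3 R -> R) (Omega : set (R3 R))
    (f : txv R -> R) (Df : txv R -> txv R) (j : nat) (e : txv R)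
  (HOmega : convex_domain xi Omega)
  (He : @xv_dir R e)
  (Hgrad : distr_grad (phase Omega) f Df)
  (Hf : integrable_on_compacts (closed_phase xi Omega) (phase Omega) f)
  (HDf : forall d, ([set et R] `|` @xv_dir R) d ->
     integrable_on_compacts (closed_phase xi Omega) (phase Omega)
       (fun z => dot7 (Df z) d))
  (Hlim : {ae @leb7 R, forall z, phase Omega z ->
     cvg (f (traj Omega j z tau) @[tau --> (tc Omega j.+1 z)^'+])}) :
  exists2 G : txv R -> R,
    {ae @leb7 R, forall z, phase Omega z ->
       G z =
       \int[@lebesgue_measure R]_(tau in `]tc Omega j.+1 z, tc Omega j z[)
          dot7 (dtraj Omega j e z tau) (Df (traj Omega j z tau))
       + lim (('D_e (tc Omega j) z - 'D_e (tc Omega j.+1) z)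
                * f (traj Omega j z tau) @[tau --> (tc Omega j.+1 z)^'+])} &
    distr_deriv (phase Omega) e
      (fun z =>
         \int[@lebesgue_measure R]_(tau in `]tc Omega j.+1 z, tc Omega j z[)
           f (traj Omega j z tau))
      G.
Proof.
have e0 : e.1.1 = 0 by case: He => i [] ->.
(* The derivative is an integral defined for every z; the required formula holds on regular slices,
   that is almost everywhere in the phase space. *)
exists (transport_derivative xi Omega j e f Df).
  have := ae_regular_slice HOmega e Hgrad Hf HDf Hlim; apply: ae_imp => z Hz Uz.
  exact: (transport_derivative_formula HOmega e0 Uz (Hz Uz)).
exact: (distr_deriv_segment HOmega Hgrad Hf HDf e0 Hlim).
Qed.
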